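(* Let $\varphi$ and $\psi$ be degree-four rational maps on $\mathbb{P}^1$ over $k$ with Clebsch–Gordan pairs $(F,G)$ and $(F',G')$, and let $J_1,\dots,J_{50}$ be the fifty joint invariants $J_{a,b}^{(r)}$ listed in the context, of total degrees $d_1,\dots,d_{50}$ ($d=a+b$). Then $\varphi$ and $\psi$ are conjugate if and only if there is $\lambda\in k^\times$ with $$J_i(F',G')=\lambda^{d_i}J_i(F,G)\qquad(1\le i\le 50),$$ that is, if and only if $(J_1,\dots,J_{50})$ takes the same value in the weighted projective space $\mathbb{P}(d_1,\dots,d_{50})$ at $\varphi$ and $\psi$.
   Context: $k$ is an algebraically closed field of characteristic zero. $V_n$ is the space of binary forms of order (degree) $n$ in $x,y$ over $k$. A degree-four rational map is $\varphi=[f_0:f_1]$ with $f_0,f_1\in V_4$, $\mathrm{Res}(f_0,f_1)\ne0$, taken up to a common nonzero scalar; two such maps are conjugate if $\psi=\gamma\varphi\gamma^{-1}$ for some $\gamma\in\mathrm{PGL}_2(k)$. The Clebsch–Gordan pair of $\varphi$ is $(F,G)=(yf_0-xf_1,\ (f_0)_x+(f_1)_y)\in V_5\oplus V_3$ (defined up to a common nonzero scalar). Transvectants: for binary forms $A,B$ of orders $m,n$, $$(A,B)_r=\frac{(m-r)!(n-r)!}{m!\,n!}\sum_{j=0}^r(-1)^j\binom rj\frac{\partial^rA}{\partial x^{r-j}\partial y^j}\frac{\partial^rB}{\partial x^j\partial y^{r-j}}.$$ Covariants of the quintic $F$: $H=(F,F)_2$, $i=(F,F)_4$, $t=(F,H)_1$,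 $c_{3,5}=(i,F)_1$, $c_{3,3}=(i,F)_2$, $c_{4,6}=(c_{3,3},F)_1$, $c_{4,4}=(c_{3,3},F)_2$, $c_{4,0}=(i,i)_2$, $c_{5,3}=(c_{3,3},i)_1$, $c_{5,1}=(c_{3,3},i)_2$, $c_{6,4}=(c_{4,4},i)_1$, $c_{6,2}=(c_{3,3},c_{3,3})_2$, $c_{7,5}=(c_{4,4},c_{3,3})_1$, $c_{7,1}=(c_{4,4},c_{3,5})_4$, $c_{8,2}=(c_{4,4},c_{4,6})_4$, $c_{8,0}=(c_{4,4},c_{4,4})_4$, $c_{9,3}=(c_{6,2},c_{3,3})_1$, $c_{12,0}=(c_{6,2},c_{6,2})_2$, $c_{13,1}=(c_{7,1},c_{6,2})_1$, $c_{18,0}=(c_{13,1},c_{5,1})_1$. Covariants of the cubic $G$: $h=(G,G)_2$, $q=(G,h)_1$, $D=(h,h)_2$. The fifty invariants (the subscript is the bidegree in the coefficients of $(F,G)$; products inside transvectants are ordinary products of forms): $J_{0,4}^{(1)}=D$; $J_{1,3}^{(1)}=(F,Gh)_5$; $J_{2,2}^{(1)}=(i,h)_2$; $J_{2,2}^{(2)}=(H,G^2)_6$; $J_{3,1}^{(1)}=(c_{3,3},G)_3$; $J_{4,0}^{(1)}=c_{4,0}$; $J_{1,5}^{(1)}=(F,hq)_5$; $J_{2,4}^{(1)}=(H,Gq)_6$; $J_{3,3}^{(1)}=(c_{3,3},q)_3$; $J_{3,3}^{(2)}=(c_{3,5},Gh)_5$; $J_{3,3}^{(3)}=(t,G^3)_9$;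 $J_{4,2}^{(1)}=(c_{4,6},G^2)_6$; $J_{5,1}^{(1)}=(c_{5,3},G)_3$; $J_{2,6}^{(1)}=(H,q^2)_6$; $J_{3,5}^{(1)}=(c_{3,5},hq)_5$; $J_{3,5}^{(2)}=(t,G^2q)_9$; $J_{3,5}^{(3)}=(F^3,G^5)_{15}$; $J_{4,4}^{(1)}=(c_{4,4},h^2)_4$; $J_{4,4}^{(2)}=(c_{4,6},Gq)_6$; $J_{4,4}^{(3)}=(F^2i,G^4)_{12}$; $J_{5,3}^{(1)}=(c_{5,3},q)_3$; $J_{5,3}^{(2)}=(Fc_{4,4},G^3)_9$; $J_{5,3}^{(3)}=(Fi^2,G^3)_9$; $J_{6,2}^{(1)}=(c_{6,2},h)_2$; $J_{6,2}^{(2)}=(ic_{4,4},G^2)_6$; $J_{6,2}^{(3)}=(i^3,G^2)_6$; $J_{7,1}^{(1)}=(ic_{5,1},G)_3$; $J_{8,0}^{(1)}=c_{8,0}$; $J_{3,7}^{(1)}=(F^3,G^4q)_{15}$; $J_{4,6}^{(1)}=(F^2i,G^3q)_{12}$; $J_{5,5}^{(1)}=(Fc_{4,4},G^2q)_9$; $J_{5,5}^{(2)}=(F^2c_{3,5},G^5)_{15}$; $J_{6,4}^{(1)}=(c_{6,4},h^2)_4$; $J_{6,4}^{(2)}=(ic_{4,4},Gq)_6$; $J_{6,4}^{(3)}=(Fic_{3,5},G^4)_{12}$; $J_{7,3}^{(1)}=(ic_{5,1},q)_3$; $J_{7,3}^{(2)}=(c_{7,5},Gh)_5$; $J_{7,3}^{(3)}=(c_{3,5}c_{4,4},G^3)_9$;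 $J_{8,2}^{(1)}=(c_{8,2},h)_2$; $J_{8,2}^{(2)}=(c_{3,5}c_{5,1},G^2)_6$; $J_{9,1}^{(1)}=(c_{9,3},G)_3$; $J_{9,1}^{(2)}=(ic_{7,1},G)_3$; $J_{9,3}^{(1)}=(ic_{7,1},q)_3$; $J_{10,2}^{(1)}=(c_{5,1}^2,h)_2$; $J_{11,1}^{(1)}=(c_{5,1}c_{6,2},G)_3$; $J_{12,0}^{(1)}=c_{12,0}$; $J_{12,2}^{(1)}=(c_{5,1}c_{7,1},h)_2$; $J_{13,1}^{(1)}=(c_{6,2}c_{7,1},G)_3$; $J_{15,1}^{(1)}=(c_{7,1}c_{8,2},G)_3$; $J_{18,0}^{(1)}=c_{18,0}$. *)

(* Defs.v *)
From HB Require Import structures.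
From mathcomp Require Import all_boot all_order all_algebra.
From mathcomp Require Export mpoly.

Set Implicit Arguments.
Unset Strict Implicit.
Unset Printing Implicit Defensive.

Import GRing.Theory.
Local Open Scope ring_scope.

(* The space V_n of binary forms of order n: the variables x, y are 'X_0, 'X_1
   and [dhomog] is the library's type of homogeneous polynomials. *)
Notation bform k n := (dhomog 2 k n).

Definition mxy (a b : nat) : 'X_{1..2} := [multinom of [:: a; b]].

Section BinaryForms.
Variable k : fieldType.

Lemma dhomog_mderiv n i (p : {mpoly k[2]}) :
  p \is n.-homog -> p^`M(i) \is (n.-1).-homog.
Proof.
move=> /dhomogP hp; rewrite (mpolyE p) raddf_sum big_seq.
apply: rpred_sum => m /hp hm.
rewrite /= mderivZ mderivX; apply/dhomogZ.
case: (posnP (m i)) => [->|mi_gt0]; first by rewrite scale0r rpred0.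
apply/dhomogZ; rewrite dhomogX.
have le_im : (U_(i) <= m)%MM.
  by apply/mnm_lepP => j; rewrite mnm1E; case: eqP => // <-.
have /eqP := submK le_im; move/eqP/(congr1 mdeg).
rewrite mdegD mdeg1 => /eqP.
by rewrite (hm : mdeg m = n) addn1 => /eqP <-.
Qed.

Lemma dhomog_mderivm n (m : 'X_{1..2}) (p : {mpoly k[2]}) :
  p \is n.-homog -> p^`M[m] \is (n - mdeg m).-homog.
Proof.
rewrite mderivm_foldr mdegE => hp.
set s := flatten _.
have -> : (\sum_(i < 2) m i)%N = size s.
  rewrite size_flatten /shape -map_comp sumnE big_map big_enum /=.
  by apply: eq_bigr => i _; rewrite size_nseq.
elim: s => [|i s IHs] /=; first by rewrite subn0.
by rewrite subnS; apply: dhomog_mderiv.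
Qed.

Lemma mderivm_gt n (m : 'X_{1..2}) (p : {mpoly k[2]}) :
  p \is n.-homog -> (n < mdeg m)%N -> p^`M[m] = 0.
Proof.
move=> /dhomogP hp lt_nm; rewrite (mpolyE p) raddf_sum big_seq big1 // => q /hp.
rewrite /= => hq; rewrite mderivmZ mderivmX.
suff [i lt_i] : exists i : 'I_2, (q i < m i)%N.
  by rewrite (bigD1 i) //= ffact_small // mul0n scale0r scaler0.
apply/existsP; apply: contraLR lt_nm; rewrite negb_exists => /forallP le_mq.
rewrite -leqNgt -hq !mdegE; apply: leq_sum => i _.
by rewrite leqNgt; apply: le_mq.
Qed.

Definition transvectant_poly r m n (A B : {mpoly k[2]}) : {mpoly k[2]} :=
  (((m - r)`! * (n - r)`!)%:R / (m`! * n`!)%:R) *: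
    \sum_(j < r.+1) ((-1) ^+ j * 'C(r, j)%:R) *:
       (A^`M[mxy (r - j) j] * B^`M[mxy j (r - j)]).

Lemma transvectant_homog r m n (A : bform k m) (B : bform k n) :
  transvectant_poly r m n A B \is (m + n - 2 * r).-homog.
Proof.
apply/dhomogZ/rpred_sum => j _; apply/dhomogZ.
have le_jr : (j <= r)%N by rewrite -ltnS.
have d1 : mdeg (mxy (r - j) j) = r.
  by rewrite mdegE !big_ord_recl big_ord0 !multinomE !(tnth_nth 0%N) /= addn0 subnK.
have d2 : mdeg (mxy j (r - j)) = r.
  by rewrite mdegE !big_ord_recl big_ord0 !multinomE !(tnth_nth 0%N) /= addn0 subnKC.
have [lt_mr|le_rm] := ltnP m r.
  by rewrite (@mderivm_gt m) ?d1 ?mul0r ?rpred0 //; case: A.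
have [lt_nr|le_rn] := ltnP n r.
  by rewrite (@mderivm_gt n _ B) ?d2 ?mulr0 ?rpred0 //; case: B.
have -> : (m + n - 2 * r = (m - r) + (n - r))%N.
  by rewrite mul2n -addnn subnDA addnC -addnBA // addnC addnBA.
apply: dhomogM.
  by rewrite -[X in (m - X)%N]d1; apply: dhomog_mderivm; case: A.
by rewrite -[X in (n - X)%N]d2; apply: dhomog_mderivm; case: B.
Qed.

Definition transvectant r m n (A : bform k m) (B : bform k n) :
  bform k (m + n - 2 * r) := DHomog (transvectant_homog r A B).

Lemma bmul_homog m n (A : bform k m) (B : bform k n) :
  (A : {mpoly k[2]}) * B \is (m + n).-homog.
Proof. by apply: dhomogM; [case: A | case: B]. Qed.

Definition bmul m n (A : bform k m) (B : bform k n) : bform k (m + n) :=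
  DHomog (bmul_homog A B).

Lemma bexp_homog n r (A : bform k n) :
  (A : {mpoly k[2]}) ^+ r \is (n * r).-homog.
Proof. by apply: dhomogMn; case: A. Qed.

Definition bexp n (A : bform k n) r : bform k (n * r) :=
  DHomog (bexp_homog r A).

Definition bconst (A : bform k 0) : k := (A : {mpoly k[2]})@_0%MM.

(* The coefficient of x^(n-j) y^j. *)
Definition bcoef n (A : bform k n) (j : nat) : k :=
  (A : {mpoly k[2]})@_(mxy (n - j) j).

(* The Sylvester determinant of forms of orders m and n; unlike the library's
   univariate [resultant], the orders are fixed, so that a common root at
   infinity is detected. *)
Definition bresultant m n (A : bform k m) (B : bform k n) : k :=
  \det (\matrix_(i < n + m, j < n + m)
    if (i < n)%N
    then (if (i <= j <= i + m)%N then bcoef A (j - i) else 0)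
    else (if (i - n <= j <= i - n + n)%N then bcoef B (j - (i - n)) else 0)).

End BinaryForms.

Notation "''T_' r ( A , B )" := (transvectant r A B)
  (at level 8, r at level 2, format "''T_' r ( A ,  B )").
Notation "A *b B" := (bmul A B) (at level 40, left associativity).
Notation "A ^b r" := (bexp A r) (at level 30, right associativity).

Section RationalMaps.
Variable k : fieldType.

(* A lift of a degree-d rational map [f_0 : f_1]; the common nonzero scalar is
   accounted for by [same_map]. *)
Record ratmap (d : nat) := Ratmap {
  ratmap_comp :> 'I_2 -> bform k d;
  ratmap_res : bresultant (ratmap_comp 0) (ratmap_comp 1) != 0 }.

Definition same_map (f g : 'I_2 -> {mpoly k[2]}) : Prop :=
  exists2 c : k, c != 0 & forall i, g i = c *: f i.

(* The column (x, y) multiplied by M. *)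
Definition linear_change (M : 'M[k]_2) : 2.-tuple {mpoly k[2]} :=
  [tuple \sum_(j < 2) M i j *: 'X_j | i < 2].

(* gamma \o f \o gamma^-1 on lifts. *)
Definition conj_lift (gamma : 'M[k]_2) (f : 'I_2 -> {mpoly k[2]}) (i : 'I_2) :
  {mpoly k[2]} :=
  \sum_(j < 2) gamma i j *: (f j \mPo linear_change (invmx gamma)).

(* Scalar matrices act trivially up to [same_map], so quantifying over GL_2 is
   quantifying over PGL_2. *)
Definition conjugate d (phi psi : ratmap d) : Prop :=
  exists2 gamma : 'M[k]_2, gamma \in unitmx &
    same_map (conj_lift gamma (fun i => phi i)) (fun i => psi i).

Lemma CG_F_homog d (phi : ratmap d) :
  'X_1 * (phi 0 : {mpoly k[2]}) - 'X_0 * (phi 1 : {mpoly k[2]}) \is d.+1.-homog.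
Proof.
have hX i : ('X_i : {mpoly k[2]}) \is 1.-homog by rewrite dhomogX; apply/eqP/mdeg1.
by apply: rpredB; apply: (@dhomogM _ _ _ 1 _ d) => //; case: (phi _).
Qed.

Lemma CG_G_homog d (phi : ratmap d) :
  (phi 0 : {mpoly k[2]})^`M(0) + (phi 1 : {mpoly k[2]})^`M(1) \is d.-1.-homog.
Proof. by apply: rpredD; apply: dhomog_mderiv; case: (phi _). Qed.

(* The Clebsch-Gordan pair of the chosen lift; its other representatives are
   those of the rescaled lifts. *)
Definition CG_F d (phi : ratmap d) : bform k d.+1 := DHomog (CG_F_homog phi).
Definition CG_G d (phi : ratmap d) : bform k d.-1 := DHomog (CG_G_homog phi).

End RationalMaps.

Section QuinticCovariants.
Variables (k : fieldType) (F : bform k 5).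

Definition cov_H : bform k 6 := 'T_2(F, F).
Definition cov_i : bform k 2 := 'T_4(F, F).
Definition cov_t : bform k 9 := 'T_1(F, cov_H).
Definition c3_5 : bform k 5 := 'T_1(cov_i, F).
Definition c3_3 : bform k 3 := 'T_2(cov_i, F).
Definition c4_6 : bform k 6 := 'T_1(c3_3, F).
Definition c4_4 : bform k 4 := 'T_2(c3_3, F).
Definition c4_0 : bform k 0 := 'T_2(cov_i, cov_i).
Definition c5_3 : bform k 3 := 'T_1(c3_3, cov_i).
Definition c5_1 : bform k 1 := 'T_2(c3_3, cov_i).
Definition c6_4 : bform k 4 := 'T_1(c4_4, cov_i).
Definition c6_2 : bform k 2 := 'T_2(c3_3, c3_3).
Definition c7_5 : bform k 5 := 'T_1(c4_4, c3_3).
Definition c7_1 : bform k 1 := 'T_4(c4_4, c3_5).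
Definition c8_2 : bform k 2 := 'T_4(c4_4, c4_6).
Definition c8_0 : bform k 0 := 'T_4(c4_4, c4_4).
Definition c9_3 : bform k 3 := 'T_1(c6_2, c3_3).
Definition c12_0 : bform k 0 := 'T_2(c6_2, c6_2).
Definition c13_1 : bform k 1 := 'T_1(c7_1, c6_2).
Definition c18_0 : bform k 0 := 'T_1(c13_1, c5_1).

End QuinticCovariants.

Section CubicCovariants.
Variables (k : fieldType) (G : bform k 3).

Definition cov_h : bform k 2 := 'T_2(G, G).
Definition cov_q : bform k 3 := 'T_1(G, cov_h).
Definition cov_D : bform k 0 := 'T_2(cov_h, cov_h).

End CubicCovariants.

(* The bidegrees (a, b), in the order of [joint_invariants]. *)
Definition joint_bidegrees : 50.-tuple (nat * nat) := [tuple
  (0, 4); (1, 3); (2, 2); (2, 2); (3, 1); (4, 0);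
  (1, 5); (2, 4); (3, 3); (3, 3); (3, 3); (4, 2); (5, 1);
  (2, 6); (3, 5); (3, 5); (3, 5); (4, 4); (4, 4); (4, 4);
  (5, 3); (5, 3); (5, 3); (6, 2); (6, 2); (6, 2); (7, 1); (8, 0);
  (3, 7); (4, 6); (5, 5); (5, 5); (6, 4); (6, 4); (6, 4);
  (7, 3); (7, 3); (7, 3); (8, 2); (8, 2); (9, 1); (9, 1);
  (9, 3); (10, 2); (11, 1); (12, 0);
  (12, 2); (13, 1);
  (15, 1);
  (18, 0)]%N.

Definition joint_degree (i : 'I_50) : nat :=
  ((tnth joint_bidegrees i).1 + (tnth joint_bidegrees i).2)%N.

Section JointInvariants.
Variables (k : fieldType) (F : bform k 5) (G : bform k 3).

Local Notation H := (cov_H F).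
Local Notation i := (cov_i F).
Local Notation t := (cov_t F).
Local Notation c35 := (c3_5 F).
Local Notation c33 := (c3_3 F).
Local Notation c46 := (c4_6 F).
Local Notation c44 := (c4_4 F).
Local Notation c53 := (c5_3 F).
Local Notation c51 := (c5_1 F).
Local Notation c64 := (c6_4 F).
Local Notation c62 := (c6_2 F).
Local Notation c75 := (c7_5 F).
Local Notation c71 := (c7_1 F).
Local Notation c82 := (c8_2 F).
Local Notation c93 := (c9_3 F).
Local Notation h := (cov_h G).
Local Notation q := (cov_q G).

Definition joint_invariant_forms : 50.-tuple (bform k 0) := [tuple
  cov_D G;
  'T_5(F, G *b h);
  'T_2(i, h);
  'T_6(H, G ^b 2);
  'T_3(c33, G);
  c4_0 F;

  'T_5(F, h *b q);
  'T_6(H, G *b q);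
  'T_3(c33, q);
  'T_5(c35, G *b h);
  'T_9(t, G ^b 3);
  'T_6(c46, G ^b 2);
  'T_3(c53, G);

  'T_6(H, q ^b 2);
  'T_5(c35, h *b q);
  'T_9(t, G ^b 2 *b q);
  'T_15(F ^b 3, G ^b 5);
  'T_4(c44, h ^b 2);
  'T_6(c46, G *b q);
  'T_12(F ^b 2 *b i, G ^b 4);
  'T_3(c53, q);
  'T_9(F *b c44, G ^b 3);
  'T_9(F *b i ^b 2, G ^b 3);
  'T_2(c62, h);
  'T_6(i *b c44, G ^b 2);
  'T_6(i ^b 3, G ^b 2);
  'T_3(i *b c51, G);
  c8_0 F;

  'T_15(F ^b 3, G ^b 4 *b q);
  'T_12(F ^b 2 *b i, G ^b 3 *b q);
  'T_9(F *b c44, G ^b 2 *b q);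
  'T_15(F ^b 2 *b c35, G ^b 5);
  'T_4(c64, h ^b 2);
  'T_6(i *b c44, G *b q);
  'T_12(F *b i *b c35, G ^b 4);
  'T_3(i *b c51, q);
  'T_5(c75, G *b h);
  'T_9(c35 *b c44, G ^b 3);
  'T_2(c82, h);
  'T_6(c35 *b c51, G ^b 2);
  'T_3(c93, G);
  'T_3(i *b c71, G);

  'T_3(i *b c71, q);
  'T_2(c51 ^b 2, h);
  'T_3(c51 *b c62, G);
  c12_0 F;

  'T_2(c51 *b c71, h);
  'T_3(c62 *b c71, G);

  'T_3(c71 *b c82, G);

  c18_0 F].

Definition joint_invariant (j : 'I_50) : k :=
  bconst (tnth joint_invariant_forms j).

End JointInvariants.

(* Points of the weighted projective space P(d_0, ..., d_(N-1)): nonzero vectors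
   up to the weighted action of k^*. *)
Definition wproj_eq (k : fieldType) N (d : 'I_N -> nat) (u v : 'I_N -> k) :
  Prop :=
  [/\ exists j, u j != 0, exists j, v j != 0
    & exists2 lambda : k, lambda != 0 & forall j, v j = lambda ^+ d j * u j].

(* Main.v *)
(* A map phi is recovered from its pair (F, G), as 5 f_0 = F_y + x G and
   5 f_1 = - F_x + y G, and conjugation by SL2 is substitution in (F, G); so the
   claim is that the invariants separate the SL2-orbits of those pairs for which no
   point is both a multiple root of F and a root of G.  Up to SL2, the cubic G is
   a (x^3 + y^3), x^2 y, x^3 or 0.  In the first three cases F is reduced by
   the stabilizer of G, and its coefficients are found from the invariants by solving
   linear equations one after the other, up to a cube root of unity.  If G = 0, the
   same classification is applied to the cubic covariant c_{3,3}, to which F is apolar: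
   this leaves one explicit family of quintics for each type of c_{3,3}, a triple root
   being impossible.  The values of the invariants on the normal forms are computed by
   reflection, with dense integer polynomials; they also show that some invariant is
   nonzero. *)
From Stdlib Require Import ZArith.
Require Import Defs.
From mathcomp Require Import all_boot all_order all_algebra.
From mathcomp Require Import ssrZ ring zify.

Set Implicit Arguments.
Unset Strict Implicit.
Unset Printing Implicit Defensive.

Import GRing.Theory.
Local Open Scope ring_scope.

(** * Dense polynomials over Z in several variables, for computation by reflection *)

(** Every solving step divides by a pivot, and the normal forms are cut so that each carries a
    nonzero pivot [nfnz t]; this is where nondegeneracy enters, since it excludes the pairs on which
    the available pivots all vanish. The forms are ordered so that the invariant [nfJ t] is nonzero
    on form t and zero on all later ones; hence equal invariants force equal types. Some pivots are
    known only through a cube or a fourth power, and the missing root of unity is supplied by an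
    element of SL2 that preserves the shape of the form. The scalar lambda is absorbed by rescaling
    a lift, and a square root of the determinant reduces GL2 to SL2, so what remains is to compare
    two pairs with equal invariants. The factorial normalizations are nonzero in characteristic zero
    and would only introduce fractions; the invariants are therefore computed over Z, up to a
    nonzero constant. *)

Fixpoint pol (n : nat) : Type := if n is n'.+1 then seq (pol n') else Z.

Fixpoint pconst n (z : Z) : pol n :=
  if n is n'.+1 return pol n then [:: pconst n' z] else z.

Definition pzero n : pol n := if n is n'.+1 return pol n then [::] else Z0.

Fixpoint pvar n (i : nat) : pol n :=
  match n return pol n with
  | 0 => Z0
  | n'.+1 => if i is i'.+1 then [:: pvar n' i'] else [:: pzero n'; pconst n' 1]
  end.

Fixpoint ladd T (add : T -> T -> T) (s t : seq T) : seq T :=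
  match s, t with
  | [::], _ => t
  | _, [::] => s
  | a :: s', b :: t' => add a b :: ladd add s' t'
  end.

Fixpoint padd n : pol n -> pol n -> pol n :=
  if n is n'.+1 return pol n -> pol n -> pol n then ladd (@padd n')
  else Z.add.

Fixpoint lmul T (z : T) (add mul : T -> T -> T) (s t : seq T) : seq T :=
  if s is a :: s' then
    ladd add [seq mul a b | b <- t] (z :: lmul z add mul s' t)
  else [::].

Fixpoint pmul n : pol n -> pol n -> pol n :=
  if n is n'.+1 return pol n -> pol n -> pol n then
    lmul (pzero n') (@padd n') (@pmul n')
  else Z.mul.

Fixpoint pzerob n : pol n -> bool :=
  if n is n'.+1 return pol n -> bool then all (@pzerob n')
  else fun z => Z.eqb z 0.

(** The first nonzero coefficient in the nested lists. It only serves as a scale factor in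
    [proportional], so any other nonzero coefficient would do. *)
Fixpoint plead n : pol n -> Z :=
  if n is n'.+1 return pol n -> Z then
    foldr (fun p z => if Z.eqb (plead p) 0 then z else plead p) Z0
  else id.

(* [PP] embeds an already computed polynomial. *)
Inductive pexp n :=
  PV of nat | PC of Z | PP of pol n
| PAdd of pexp n & pexp n | PMul of pexp n & pexp n | PExp of pexp n & nat.
Arguments PV {n}.
Arguments PC {n}.

Fixpoint pnorm n (e : pexp n) : pol n :=
  match e with
  | PV i => pvar n i
  | PC z => pconst n z
  | PP p => p
  | PAdd a b => padd (pnorm a) (pnorm b)
  | PMul a b => pmul (pnorm a) (pnorm b)
  | PExp a m => iter m (pmul (pnorm a)) (pconst n 1)
  end.

Definition popp n (p : pol n) := pmul (pconst n (Zneg xH)) p.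
Definition peqb n (p q : pol n) := pzerob (padd p (popp q)).

(** Proportionality over the rationals, tested without fractions. Both sides must be nonzero, which
    makes the ratio invertible in characteristic zero. *)
Definition proportional n (p q : pol n) : bool :=
  [&& ~~ Z.eqb (plead p) 0, ~~ Z.eqb (plead q) 0 &
      peqb (pmul (pconst n (plead q)) p) (pmul (pconst n (plead p)) q)].

Section Evaluation.
Variable R : comRingType.

Definition zk (z : Z) : R := (int_of_Z z)%:~R.

Lemma zkD a b : zk (Z.add a b) = zk a + zk b.
Proof. by rewrite /zk -[(Z.add a b)]/(a + b) rmorphD /= rmorphD. Qed.

Lemma zkM a b : zk (Z.mul a b) = zk a * zk b.
Proof. by rewrite /zk -[(Z.mul a b)]/(a * b) rmorphM /= rmorphM. Qed.

Lemma zk_nat n : zk (Z.of_nat n) = n%:R.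
Proof. by rewrite /zk (_ : int_of_Z (Z.of_nat n) = n) //; lia. Qed.

Fixpoint peval n : (nat -> R) -> pol n -> R :=
  if n is n'.+1 return (nat -> R) -> pol n -> R then
    fun rho => foldr (fun a x => peval (fun i => rho i.+1) a + rho 0 * x) 0
  else fun _ z => zk z.

Lemma peval_const n rho z : peval rho (pconst n z) = zk z.
Proof. by elim: n rho => //= n IHn rho; rewrite IHn mulr0 addr0. Qed.

Lemma peval_zero n rho : peval rho (pzero n) = 0.
Proof. by case: n. Qed.

Lemma peval_var n rho i : (i < n)%N -> peval rho (pvar n i) = rho i.
Proof.
elim: n rho i => // n IHn rho [|i] lt_in /=; last by rewrite IHn // mulr0 addr0.
by rewrite peval_zero peval_const mulr0 addr0 mulr1 add0r.
Qed.

Lemma peval_add n rho (p q : pol n) :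
  peval rho (padd p q) = peval rho p + peval rho q.
Proof.
elim: n rho p q => [|n IHn] rho p q; first exact: zkD.
elim: p q => [|a p IHp] [|b q] /=; rewrite ?add0r ?addr0 //.
by move: (IHp q) => /= ->; rewrite IHn; ring.
Qed.

Lemma peval_mul n rho (p q : pol n) :
  peval rho (pmul p q) = peval rho p * peval rho q.
Proof.
elim: n rho p q => [|n IHn] rho p q; first exact: zkM.
elim: p q => [|a p IHp] q /=; first by rewrite mul0r.
have /= -> := @peval_add n.+1 rho [seq pmul a b | b <- q].
move: (IHp q) => /= ->; rewrite peval_zero add0r mulrDl mulrA.
congr (_ + _); elim: q => [|b q IHq] /=; first by rewrite mulr0.
rewrite IHn IHq; ring.
Qed.

Lemma peval_zerob n rho (p : pol n) : pzerob p -> peval rho p = 0.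
Proof.
elim: n rho p => [|n IHn] rho p /=; first by move=> /Z.eqb_eq ->.
by elim: p => //= a p IHp /andP[/IHn-> /IHp->]; rewrite mulr0 addr0.
Qed.

Lemma peval_eqb n rho (p q : pol n) : peqb p q -> peval rho p = peval rho q.
Proof.
move=> /(peval_zerob rho); rewrite peval_add peval_mul peval_const.
by rewrite (_ : zk (Zneg xH) = -1) // mulN1r => /subr0_eq.
Qed.

Fixpoint pden n (rho : nat -> R) (e : pexp n) : R :=
  match e with
  | PV i => rho i
  | PC z => zk z
  | PP p => peval rho p
  | PAdd a b => pden rho a + pden rho b
  | PMul a b => pden rho a * pden rho b
  | PExp a m => pden rho a ^+ m
  end.

Fixpoint pwf n (e : pexp n) : bool :=
  match e with
  | PV i => (i < n)%N
  | PAdd a b | PMul a b => pwf a && pwf b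
  | PExp a m => pwf a
  | _ => true
  end.

Lemma pnormP n rho (e : pexp n) : pwf e -> peval rho (pnorm e) = pden rho e.
Proof.
elim: e => [i|z|p|a IHa b IHb|a IHa b IHb|a IHa m] /=.
- exact: peval_var.
- by move=> _; apply: peval_const.
- by [].
- by move=> /andP[/IHa <- /IHb <-]; apply: peval_add.
- by move=> /andP[/IHa <- /IHb <-]; apply: peval_mul.
- move=> /IHa <-; elim: m => [|m IHm] /=; first by rewrite peval_const.
  by rewrite peval_mul IHm exprS.
Qed.

Lemma pden_eq n rho (a b : pexp n) :
  [&& pwf a, pwf b & peqb (pnorm a) (pnorm b)] -> pden rho a = pden rho b.
Proof.
by move=> /and3P[wa wb]; rewrite -!pnormP //; apply: peval_eqb.
Qed.

End Evaluation.

Section CharZero.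
Variables (k : fieldType) (hk : [pchar k] =i pred0).

Lemma natr0_eq0 n : (n%:R == 0 :> k) = (n == 0)%N.
Proof. by move/pcharf0P: hk. Qed.

Lemma zk_eq0 z : (zk k z == 0) = Z.eqb z 0.
Proof.
apply/idP/idP => [|/Z.eqb_eq -> //].
rewrite /zk -[X in Z.eqb X]int_of_ZK.
case: (int_of_Z z) => n; first by rewrite -pmulrn natr0_eq0 => /eqP ->.
by rewrite NegzE mulrNz oppr_eq0 -pmulrn natr0_eq0.
Qed.

Lemma proportionalP n (p q : pol n) : proportional p q ->
  exists2 c : k, c != 0 & forall rho, peval rho p = c * peval rho q.
Proof.
move=> /and3P[p0 q0 /(peval_eqb (R := k)) e].
have p0' : zk k (plead p) != 0 by rewrite zk_eq0.
have q0' : zk k (plead q) != 0 by rewrite zk_eq0.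
exists (zk k (plead p) / zk k (plead q)); first by rewrite mulf_neq0 ?invr_eq0.
move=> rho; have := e rho; rewrite !peval_mul !peval_const => {}e.
by apply: (mulfI q0'); rewrite e mulrA mulrCA mulfV // mulr1.
Qed.

End CharZero.

(** * Transvectants on coefficient lists *)

Fixpoint zffact (n m : nat) : Z :=
  if m is m'.+1 then Z.mul (Z.of_nat n) (zffact n.-1 m') else 1.

Fixpoint zbin (n m : nat) : Z :=
  match n, m with
  | _, 0 => 1
  | 0, _.+1 => 0
  | n'.+1, m'.+1 => Z.add (zbin n' m) (zbin n' m')
  end.

Definition zsum (s : seq Z) : Z := foldr Z.add Z0 s.

(* The integer w with (x^(m-a) y^a, x^(n-b) y^b)_r = w x^. y^. before normalization. *)
Definition tweight m n r a b : Z :=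
  zsum [seq Z.mul (Z.mul (if odd j then Zneg 1 else 1) (zbin r j))
    (Z.mul (Z.mul (zffact (m - a) (r - j)) (zffact a j))
           (Z.mul (zffact (n - b) j) (zffact b (r - j)))) | j <- iota 0 r.+1].

Section Transvectants.
Variable k : fieldType.
Local Notation zk := (zk k).

Lemma zk_ffact n m : zk (zffact n m) = (n ^_ m)%:R.
Proof.
elim: m n => [|m IHm] n; first by rewrite ffactn0.
by rewrite /= zkM IHm ffactnS natrM zk_nat.
Qed.

Lemma zk_bin n m : zk (zbin n m) = 'C(n, m)%:R.
Proof.
elim: n m => [|n IHn] [|m] //=.
by rewrite zkD !IHn binS natrD.
Qed.

Lemma zk_sum T (f : T -> Z) s :
  zk (zsum [seq f x | x <- s]) = \sum_(x <- s) zk (f x).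
Proof.
by elim: s => [|x s IHs] /=; rewrite ?big_nil // big_cons zkD IHs.
Qed.

Lemma zk_tweight m n r a b : zk (tweight m n r a b) = \sum_(j < r.+1)
  ((-1) ^+ j * 'C(r, j)%:R) * (((m - a) ^_ (r - j) * a ^_ j)%N%:R *
     ((n - b) ^_ j * b ^_ (r - j))%N%:R).
Proof.
rewrite zk_sum -[iota 0 r.+1]/(index_iota 0 r.+1) big_mkord.
apply: eq_bigr => j _; rewrite !zkM !zk_ffact zk_bin !natrM; congr (_ * _ * _).
by rewrite -signr_odd; case: odd.
Qed.

(** A nonzero weight has a summand whose four falling factorials are all nonzero; their bounds add
    up to the claim. This makes the truncated subtraction in the index a + b - r exact and keeps the
    index in range. *)
Lemma tweight_neq0 m n r a b : (a <= m)%N -> (b <= n)%N ->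
  zk (tweight m n r a b) != 0 -> (r <= a + b)%N && (a + b <= m + n - r)%N.
Proof.
move=> am bn; rewrite zk_tweight => w0.
have [j wj] : exists j : 'I_r.+1, ((m - a) ^_ (r - j) * a ^_ j *
    ((n - b) ^_ j * b ^_ (r - j)) != 0)%N.
  apply/existsP; apply: contraR w0; rewrite negb_exists => /forallP w0.
  rewrite big1 // => j _; rewrite -natrM; move: (w0 j); rewrite negbK => /eqP ->.
  by rewrite mulr0.
have jr := ltn_ord j.
move: wj; rewrite -lt0n !muln_gt0 !ffact_gt0; lia.
Qed.

Definition bf n (c : nat -> k) : {mpoly k[2]} :=
  \sum_(j < n.+1) c j *: 'X_[mxy (n - j) j].

(** The transvectant without its factorial factor: it is integral on monomials and does not refer to
    the orders of the forms. *)
Definition tsum r (A B : {mpoly k[2]}) : {mpoly k[2]} :=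
  \sum_(j < r.+1) ((-1) ^+ j * 'C(r, j)%:R) *:
       (A^`M[mxy (r - j) j] * B^`M[mxy j (r - j)]).

Lemma mxy0 a b : mxy a b ord0 = a.
Proof. by rewrite multinomE (tnth_nth 0%N). Qed.

Lemma mxy1 a b : mxy a b (lift ord0 ord0) = b.
Proof. by rewrite multinomE (tnth_nth 0%N). Qed.

Lemma mxy_eq (m : 'X_{1..2}) : m = mxy (m ord0) (m (lift ord0 ord0)).
Proof.
apply/mnmP => i; have [->|->] : i = ord0 \/ i = lift ord0 ord0.
  by case: i => [[|[|//]] lt_i]; [left|right]; apply: val_inj.
- by rewrite mxy0.
- by rewrite mxy1.
Qed.

Lemma mderivm_mxy a b c d : ('X_[mxy a b] : {mpoly k[2]})^`M[mxy c d] =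
  (a ^_ c * b ^_ d)%N%:R *: 'X_[mxy (a - c) (b - d)].
Proof.
rewrite mderivmX !big_ord_recl big_ord0 /= !mxy0 !mxy1 muln1; congr (_ *: 'X_[_]).
by rewrite [LHS]mxy_eq !mnmBE !mxy0 !mxy1.
Qed.

Lemma mpolyX_mxyM a b c d :
  'X_[mxy a b] * 'X_[mxy c d] = 'X_[mxy (a + c) (b + d)] :> {mpoly k[2]}.
Proof.
by rewrite -mpolyXD; congr 'X_[_]; rewrite [LHS]mxy_eq !mnmDE !mxy0 !mxy1.
Qed.

Lemma tsum_mxy m n r a b : (a <= m)%N -> (b <= n)%N ->
  tsum r 'X_[mxy (m - a) a] 'X_[mxy (n - b) b] =
  zk (tweight m n r a b) *: 'X_[mxy (m + n - 2 * r - (a + b - r)) (a + b - r)].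
Proof.
move=> am bn; rewrite zk_tweight scaler_suml; apply: eq_bigr => j _.
rewrite !mderivm_mxy -scalerAl -scalerAr !scalerA mpolyX_mxyM.
set u := (_ * _)%N; set v := (_ * _)%N; rewrite -mulrA -natrM.
(* The truncated exponents can be wrong only where a falling factorial vanishes, and there the term
   is zero. *)
have [->|uv] := eqVneq (u * v)%N 0%N; first by rewrite mulr0 !scale0r.
congr (_ *: 'X_[_]); have jr := ltn_ord j.
move: uv; rewrite -lt0n /u /v !muln_gt0 !ffact_gt0 => uv; have [-> ->] : (m - a - (r - j)
    + (n - b - j) = m + n - 2 * r - (a + b - r) /\ a - j + (b - (r - j)) = a + b - r)%N
    by lia.
by [].
Qed.

Lemma tsum_suml r (I : Type) s (P : pred I) (c : I -> k) A B :
  tsum r (\sum_(i <- s | P i) c i *: A i) B = \sum_(i <- s | P i) c i *: tsum r (A i) B.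
Proof.
rewrite /tsum; under [RHS]eq_bigr => i _ do rewrite scaler_sumr.
rewrite exchange_big; apply: eq_bigr => j _.
rewrite linear_sum /= mulr_suml scaler_sumr; apply: eq_bigr => i _.
by rewrite mderivmZ -scalerAl !scalerA mulrC.
Qed.

Lemma tsum_sumr r (I : Type) s (P : pred I) (c : I -> k) A B :
  tsum r A (\sum_(i <- s | P i) c i *: B i) = \sum_(i <- s | P i) c i *: tsum r A (B i).
Proof.
rewrite /tsum; under [RHS]eq_bigr => i _ do rewrite scaler_sumr.
rewrite exchange_big; apply: eq_bigr => j _.
rewrite linear_sum /= mulr_sumr scaler_sumr; apply: eq_bigr => i _.
by rewrite mderivmZ -scalerAr !scalerA mulrC.
Qed.

End Transvectants.

(** * Coefficient lists with polynomial entries *)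

Section Computation.
Variable N : nat.

Definition psum (s : seq (pol N)) : pol N := foldr (@padd N) (pzero N) s.

Definition pcoef (s : seq (pol N)) j := nth (pzero N) s j.

(** The entry of index l collects the pairs (a, b) with a + b = l + r; the filter keeps b = l + r -
    a between 0 and n. *)
Definition ptrans m n r (s t : seq (pol N)) : seq (pol N) :=
  mkseq (fun l => psum [seq pmul (pconst N (tweight m n r a (l + r - a)))
                          (pmul (pcoef s a) (pcoef t (l + r - a)))
                       | a <- iota 0 m.+1 & (a <= l + r <= n + a)%N])
        (m + n - 2 * r).+1.

Definition pprod m n (s t : seq (pol N)) : seq (pol N) :=
  mkseq (fun l => psum [seq pmul (pcoef s a) (pcoef t (l - a))
                       | a <- iota 0 m.+1 & (a <= l <= n + a)%N])
        (m + n).+1.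

Variables (k : fieldType) (rho : nat -> k).

Definition pform n (s : seq (pol N)) : {mpoly k[2]} :=
  bf n (fun j => peval rho (pcoef s j)).

Lemma peval_sum T (f : T -> pol N) s :
  peval rho (psum [seq f x | x <- s]) = \sum_(x <- s) peval rho (f x).
Proof.
elim: s => [|x s IHs] /=; first by rewrite big_nil peval_zero.
by rewrite peval_add IHs big_cons.
Qed.

(* Reindexing of a double sum over a, b by the y-degree l = a + b - r. *)
Lemma form_convol m n d r (f : nat -> nat -> k) (X : nat -> {mpoly k[2]}) :
  (forall a b, (a <= m)%N -> (b <= n)%N -> f a b != 0 -> (r <= a + b <= d + r)%N) ->
  \sum_(l < d.+1) (\sum_(a <- iota 0 m.+1 | (a <= l + r <= n + a)%N)
     f a (l + r - a)%N) *: X l =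
  \sum_(a < m.+1) \sum_(b < n.+1) f a b *: X (a + b - r)%N.
Proof.
move=> hf; under eq_bigr => l _.
  rewrite -[iota 0 m.+1]/(index_iota 0 m.+1) big_mkord scaler_suml big_mkcond /=; over.
rewrite exchange_big; apply: eq_bigr => a _ /=; rewrite -big_mkcond /=.
transitivity (\sum_(l < d.+1) \sum_(b < n.+1 | (a + b == l + r)%N) f a b *: X l).
  rewrite big_mkcond; apply: eq_bigr => l _.
  case: ifP => [h|/negbT h]; last first.
    by rewrite big1 // => b; have := ltn_ord b; move: h; lia.
  have hb : (l + r - a < n.+1)%N by lia.
  rewrite (bigD1 (Ordinal hb)) /=; last by lia.
  rewrite big1 ?addr0 // => b /andP[/eqP e /eqP ne]; case: ne; apply: val_inj => /=; lia.
rewrite (exchange_big_dep predT) //=; apply: eq_bigr => b _.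
have [f0|f0] := eqVneq (f a b) 0.
  by rewrite f0 scale0r big1 // => l _; rewrite scale0r.
have h := hf a b (ltn_ord a) (ltn_ord b) f0.
have hl : (a + b - r < d.+1)%N by lia.
rewrite (bigD1 (Ordinal hl)) /=; last by lia.
rewrite big1 ?addr0 // => l /andP[/eqP e /eqP ne]; case: ne; apply: val_inj => /=; lia.
Qed.

Lemma pform_trans m n r s t :
  tsum r (pform m s) (pform n t) = pform (m + n - 2 * r) (ptrans m n r s t).
Proof.
rewrite [X in tsum r X]/pform /bf tsum_suml.
under eq_bigr => a _.
  rewrite /pform /bf tsum_sumr scaler_sumr.
  under eq_bigr => b _.
    rewrite (tsum_mxy k r (ltn_ord a : (a <= m)%N) (ltn_ord b : (b <= n)%N)) !scalerA;
        over.
  over.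
rewrite /pform /bf /ptrans; under [RHS]eq_bigr => l _.
  rewrite /pcoef nth_mkseq // peval_sum big_filter.
  under eq_bigr => a _ do rewrite !peval_mul peval_const.
  over.
pose X l : {mpoly k[2]} := 'X_[mxy (m + n - 2 * r - l) l].
pose f a b := zk k (tweight m n r a b) * (peval rho (pcoef s a) * peval rho (pcoef t b)).
rewrite (@form_convol m n _ r f X); last first.
  move=> a b am bn; have [w0|/(tweight_neq0 am bn) h _] := eqVneq (zk k (tweight m n r a
      b)) 0.
    by rewrite /f w0 mul0r eqxx.
  lia.
apply: eq_bigr => a _; apply: eq_bigr => b _; rewrite /f /X; congr (_ *: _).
ring.
Qed.

Lemma pform_prod m n s t : pform m s * pform n t = pform (m + n) (pprod m n s t).
Proof.
rewrite /pform /bf /pprod; under [RHS]eq_bigr => l _.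
  rewrite /pcoef nth_mkseq // peval_sum big_filter.
  under eq_bigr => a _ do rewrite !peval_mul.
  (* The added zeros bring the product into the shape of [form_convol] with r = 0. *)
  under eq_bigl => a do rewrite -[X in (_ <= X <= _)%N]addn0.
  under eq_bigr => a _ do rewrite -[X in (X - a)%N]addn0.
  over.
pose X l : {mpoly k[2]} := 'X_[mxy (m + n - l) l].
pose f a b := (peval rho (pcoef s a) * peval rho (pcoef t b)).
rewrite (@form_convol m n _ 0 f X); last by move=> *; lia.
rewrite mulr_suml; apply: eq_bigr => a _.
rewrite mulr_sumr; apply: eq_bigr => b _.
rewrite -scalerAl -scalerAr scalerA mpolyX_mxyM /f /X; congr (_ *: 'X_[_]).
have := ltn_ord a; have := ltn_ord b => *; congr mxy; lia.
Qed.

End Computation.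

(** * Covariants as expressions *)

(** One syntax with two readings, as forms ([csem]) and as coefficient lists ([ucomp]), so that
    homogeneity in the scalar, equivariance and correctness of the computation are each a single
    induction. *)
Inductive cexp := CF | CG | CT of nat & cexp & cexp | CM of cexp & cexp | CX of cexp &
    nat.

Fixpoint cord e :=
  match e with
  | CF => 5%N | CG => 3%N
  | CT r a b => (cord a + cord b - 2 * r)%N
  | CM a b => (cord a + cord b)%N
  | CX a m => (cord a * m)%N
  end.

Fixpoint cdeg e :=
  match e with
  | CF => 1%N | CG => 1%N
  | CT r a b => (cdeg a + cdeg b)%N
  | CM a b => (cdeg a + cdeg b)%N
  | CX a m => (cdeg a * m)%N
  end.

Definition ei := CT 4 CF CF.
Definition eH := CT 2 CF CF.
Definition et := CT 1 CF eH.
Definition e35 := CT 1 ei CF.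
Definition e33 := CT 2 ei CF.
Definition e46 := CT 1 e33 CF.
Definition e44 := CT 2 e33 CF.
Definition e53 := CT 1 e33 ei.
Definition e51 := CT 2 e33 ei.
Definition e64 := CT 1 e44 ei.
Definition e62 := CT 2 e33 e33.
Definition e75 := CT 1 e44 e33.
Definition e71 := CT 4 e44 e35.
Definition e82 := CT 4 e44 e46.
Definition e93 := CT 1 e62 e33.
Definition eh := CT 2 CG CG.
Definition eQ := CT 1 CG eh.

Definition joint_exps : seq cexp := [::
  CT 2 eh eh;
  CT 5 CF (CM CG eh);
  CT 2 ei eh;
  CT 6 eH (CX CG 2);
  CT 3 e33 CG;
  CT 2 ei ei;

  CT 5 CF (CM eh eQ);
  CT 6 eH (CM CG eQ);
  CT 3 e33 eQ;
  CT 5 e35 (CM CG eh);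
  CT 9 et (CX CG 3);
  CT 6 e46 (CX CG 2);
  CT 3 e53 CG;

  CT 6 eH (CX eQ 2);
  CT 5 e35 (CM eh eQ);
  CT 9 et (CM (CX CG 2) eQ);
  CT 15 (CX CF 3) (CX CG 5);
  CT 4 e44 (CX eh 2);
  CT 6 e46 (CM CG eQ);
  CT 12 (CM (CX CF 2) ei) (CX CG 4);
  CT 3 e53 eQ;
  CT 9 (CM CF e44) (CX CG 3);
  CT 9 (CM CF (CX ei 2)) (CX CG 3);
  CT 2 e62 eh;
  CT 6 (CM ei e44) (CX CG 2);
  CT 6 (CX ei 3) (CX CG 2);
  CT 3 (CM ei e51) CG;
  CT 4 e44 e44;

  CT 15 (CX CF 3) (CM (CX CG 4) eQ);
  CT 12 (CM (CX CF 2) ei) (CM (CX CG 3) eQ);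
  CT 9 (CM CF e44) (CM (CX CG 2) eQ);
  CT 15 (CM (CX CF 2) e35) (CX CG 5);
  CT 4 e64 (CX eh 2);
  CT 6 (CM ei e44) (CM CG eQ);
  CT 12 (CM (CM CF ei) e35) (CX CG 4);
  CT 3 (CM ei e51) eQ;
  CT 5 e75 (CM CG eh);
  CT 9 (CM e35 e44) (CX CG 3);
  CT 2 e82 eh;
  CT 6 (CM e35 e51) (CX CG 2);
  CT 3 e93 CG;
  CT 3 (CM ei e71) CG;

  CT 3 (CM ei e71) eQ;
  CT 2 (CX e51 2) eh;
  CT 3 (CM e51 e62) CG;
  CT 2 e62 e62;

  CT 2 (CM e51 e71) eh;
  CT 3 (CM e62 e71) CG;

  CT 3 (CM e71 e82) CG;

  CT 1 (CT 1 e71 e62) e51].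

Definition jexp i := nth CF joint_exps i.

(** * Expressions as forms, and linear substitutions *)

Section Semantics.
Variable k : fieldType.
Implicit Types (F G A B : {mpoly k[2]}) (M : 'M[k]_2).

Fixpoint csem F G e : {mpoly k[2]} :=
  match e with
  | CF => F
  | CG => G
  | CT r a b => transvectant_poly r (cord a) (cord b) (csem F G a) (csem F G b)
  | CM a b => csem F G a * csem F G b
  | CX a m => csem F G a ^+ m
  end.

Definition Jinv F G i : k := (csem F G (jexp i))@_0%MM.

Lemma joint_invariantE (F : bform k 5) (G : bform k 3) (i : 'I_50) :
  joint_invariant F G i = Jinv F G i.
Proof.
rewrite /joint_invariant /bconst /Jinv (tnth_nth 0); congr (_@_ _).
pose v (p : bform k 0) : {mpoly k[2]} := p.
(* The two lists are convertible: the coercions unfold to [csem], and the orders computed by [cord]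
   reduce to numerals. *)
have e : map v (joint_invariant_forms F G) = [seq csem F G e | e <- joint_exps].
  by [].
rewrite -[LHS]/(v _) -(nth_map _ 0 v) ?size_tuple // e.
by rewrite (nth_map CF) // -(size_map (csem F G)) -e size_map size_tuple.
Qed.

Lemma joint_degreeE (i : 'I_50) : joint_degree i = cdeg (jexp i).
Proof.
rewrite /joint_degree !(tnth_nth (0, 0)%N) /jexp.
by move: i; case; do 50! [case=> //].
Qed.

Definition tnorm r m n : k := ((m - r)`! * (n - r)`!)%:R / (m`! * n`!)%:R.

Lemma transvectant_polyE r m n A B :
  transvectant_poly r m n A B = tnorm r m n *: tsum r A B.
Proof. by []. Qed.

Lemma tsumZ r a b A B : tsum r (a *: A) (b *: B) = (a * b) *: tsum r A B.
Proof.
rewrite /tsum scaler_sumr; apply: eq_bigr => j _.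
rewrite !mderivmZ -scalerAl -scalerAr !scalerA.
by congr (_ *: _); ring.
Qed.

Lemma csem_scale c F G e : csem (c *: F) (c *: G) e = c ^+ cdeg e *: csem F G e.
Proof.
elim: e => [||r a IHa b IHb|a IHa b IHb|a IHa m] //=; rewrite ?IHa ?IHb.
- by rewrite !transvectant_polyE tsumZ !scalerA exprD mulrC.
- by rewrite -scalerAl -scalerAr scalerA exprD.
- by rewrite exprZn exprM.
Qed.

Lemma sum2 (V : zmodType) (f : 'I_2 -> V) : \sum_(i < 2) f i = f 0 + f 1.
Proof.
rewrite !big_ord_recl big_ord0 addr0; congr (f _ + f _); exact: val_inj.
Qed.

Lemma I2P (i : 'I_2) : i = 0 \/ i = 1.
Proof. by case: i => [[|[|//]] lt_i]; [left|right]; apply: val_inj. Qed.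

Definition act M A := A \mPo linear_change M.

Lemma actD M A B : act M (A + B) = act M A + act M B.
Proof. exact: comp_mpolyD. Qed.

Lemma actM M A B : act M (A * B) = act M A * act M B.
Proof. exact: rmorphM. Qed.

Lemma actX M A m : act M (A ^+ m) = act M A ^+ m.
Proof. exact: rmorphXn. Qed.

Lemma actZ M c A : act M (c *: A) = c *: act M A.
Proof. exact: comp_mpolyZ. Qed.

Lemma actC M c : act M c%:MP = c%:MP.
Proof. exact: comp_mpolyC. Qed.

Lemma act_var M i : act M 'X_i = M i 0 *: 'X_0 + M i 1 *: 'X_1.
Proof.
by rewrite /act comp_mpolyXU -tnth_nth tnth_mktuple sum2.
Qed.

(** Substitutions and derivations are determined by constants and variables; the lemmas on [act] are
    checked there. *)
Lemma mpoly2_ind (P : {mpoly k[2]} -> Prop) :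
  (forall c, P c%:MP) -> (forall i, P 'X_i) ->
  (forall A B, P A -> P B -> P (A + B)) -> (forall A B, P A -> P B -> P (A * B)) ->
  forall A, P A.
Proof.
move=> hC hX hD hM; elim/mpolyind => [|c m A _ _ hA]; first exact: (hC 0).
apply: hD => //; rewrite -mul_mpolyC; apply: (hM) => //.
rewrite mpolyXE_id; elim/big_rec: _ => [|i B _ hB]; first exact: (hC 1).
apply: (hM) => //; elim: (m i) => [|d IHd]; first exact: (hC 1).
by rewrite exprS; apply: hM.
Qed.

Lemma act_comp M N A : act N (act M A) = act (M *m N) A.
Proof.
elim/mpoly2_ind: A => [c|i|A B hA hB|A B hA hB].
- by rewrite !actC.
- rewrite !act_var actD !actZ !act_var !mxE !sum2.
  by rewrite !scalerDr !scalerA addrACA -!scalerDl.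
- by rewrite !actD hA hB.
- by rewrite !actM hA hB.
Qed.

Lemma act1 A : act 1%:M A = A.
Proof.
elim/mpoly2_ind: A => [c|i|A B hA hB|A B hA hB].
- by rewrite !actC.
- rewrite act_var !mxE.
  have [->|->] := I2P i.
  + by rewrite eqxx scale1r scale0r addr0.
  + by rewrite eqxx scale1r scale0r add0r.
- by rewrite !actD hA hB.
- by rewrite !actM hA hB.
Qed.

(** The chain rule. *)
Lemma mderiv_act M j A :
  (act M A)^`M(j) = M 0 j *: act M (A^`M(0)) + M 1 j *: act M (A^`M(1)).
Proof.
elim/mpoly2_ind: A => [c|i|A B hA hB|A B hA hB].
- by rewrite !actC !mderivC /act !comp_mpoly0 !scaler0 addr0.
- have dX j' i' : ('X_i' : {mpoly k[2]})^`M(j') = (i' == j')%:R%:MP.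
    rewrite mderivX mnm1E; case: eqP => [->|_]; last by rewrite scale0r.
    by rewrite -{1}[U_(j')%MM]add0m addmK mpolyX0 scale1r.
  rewrite act_var mderivD !mderivZ !dX !actC -!mul_mpolyC -!mpolyCM -!mpolyCD.
  by have [->|->] := I2P i; have [->|->] := I2P j; rewrite !eqxx /= !(mulr0, mulr1,
      addr0, add0r).
- rewrite (actD M A) mderivD hA hB !(mderivD _ A B) !(actD M _^`M(_)).
  move: (act M A^`M(0)) (act M A^`M(1)) (act M B^`M(0)) (act M B^`M(1)) => a0 a1 b0 b1.
  by rewrite !scalerDr addrACA.
- rewrite (actM M A) mderivM hA hB !(mderivM _ A B) !(actD M (_ * _)) !actM.
  move: (act M A) (act M B) (act M A^`M(0)) (act M A^`M(1)) (act M B^`M(0)) (act M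
      B^`M(1)).
  by move=> a b a0 a1 b0 b1; rewrite -!mul_mpolyC; ring.
Qed.

End Semantics.

(** * Equivariance of transvectants *)

Section Equivariance.
Variable k : fieldType.
Implicit Types (F G A B : {mpoly k[2]}) (M : 'M[k]_2).

Lemma mderivm_S0 a b A : A^`M[mxy a.+1 b] = A^`M(0)^`M[mxy a b].
Proof.
rewrite -mderivmU1m -mderivmDm; congr (_^`M[_]).
by rewrite [RHS]mxy_eq !mnmDE !mxy0 !mxy1 !mnm1E.
Qed.

Lemma mderivm_S1 a b A : A^`M[mxy a b.+1] = A^`M(1)^`M[mxy a b].
Proof.
rewrite -mderivmU1m -mderivmDm; congr (_^`M[_]).
by rewrite [RHS]mxy_eq !mnmDE !mxy0 !mxy1 !mnm1E.
Qed.

(* Cayley's Omega process, one step at a time. *)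
Lemma tsumS r A B :
  tsum r.+1 A B = tsum r A^`M(0) B^`M(1) - tsum r A^`M(1) B^`M(0).
Proof.
pose X j : {mpoly k[2]} := A^`M[mxy (r.+1 - j) j] * B^`M[mxy j (r.+1 - j)].
pose c j : k := (-1) ^+ j.
have -> : tsum r A^`M(0) B^`M(1) = \sum_(j < r.+1) (c j * 'C(r, j)%:R) *: X j.
  apply: eq_bigr => j _; rewrite /X subSn; last by rewrite -ltnS.
  by rewrite mderivm_S0 mderivm_S1.
have -> : tsum r A^`M(1) B^`M(0) = \sum_(j < r.+1) (c j * 'C(r, j)%:R) *: X j.+1.
  by apply: eq_bigr => j _; rewrite /X subSS mderivm_S0 mderivm_S1.
rewrite -sumrN /tsum big_ord_recl /=.
(* Pascal's rule splits each binomial coefficient; the two halves are the two sums above, the first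
   one after a shift of index. *)
transitivity (X 0%N + \sum_(j < r.+1) ((c j.+1 * 'C(r, j.+1)%:R) *: X j.+1 -
                                      (c j * 'C(r, j)%:R) *: X j.+1)).
  congr (_ + _); first by rewrite expr0 bin0 mulr1 scale1r.
  apply: eq_bigr => j _; rewrite /bump /= add1n binS natrD -/(X j.+1) -scalerBl.
  by congr (_ *: _); rewrite /c exprS; ring.
rewrite big_split /= addrA; congr (_ + _).
transitivity (\sum_(j < r.+2) (c j * 'C(r, j)%:R) *: X j).
  by rewrite [RHS]big_ord_recl /c expr0 bin0 mulr1 scale1r.
by rewrite big_ord_recr /= bin_small // mulr0 scale0r addr0.
Qed.

Lemma tsumDl r A A' B : tsum r (A + A') B = tsum r A B + tsum r A' B.
Proof.
rewrite /tsum -big_split; apply: eq_bigr => j _ /=.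
by rewrite mderivmD mulrDl scalerDr.
Qed.

Lemma tsumDr r A B B' : tsum r A (B + B') = tsum r A B + tsum r A B'.
Proof.
rewrite /tsum -big_split; apply: eq_bigr => j _ /=.
by rewrite mderivmD mulrDr scalerDr.
Qed.

Lemma actB M A B : act M (A - B) = act M A - act M B.
Proof. exact: comp_mpolyB. Qed.

Lemma det2 M : \det M = M 0 0 * M 1 1 - M 0 1 * M 1 0.
Proof.
rewrite (expand_det_row _ 0) sum2 /cofactor !det_mx11 !mxE /= expr0 expr1 mul1r mulN1r
    mulrN.
by congr (_ * M _ _ - _ * M _ _); apply: val_inj.
Qed.

Lemma tsum_comb r a b c d A A' B B' :
  tsum r (a *: A + b *: A') (c *: B + d *: B') =
  (a * c) *: tsum r A B + (a * d) *: tsum r A B' +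
  ((b * c) *: tsum r A' B + (b * d) *: tsum r A' B').
Proof. by rewrite tsumDl !tsumDr !tsumZ. Qed.

(** By the chain rule, the operator of [tsumS], antisymmetric in the two derivatives, is multiplied
    by the determinant of M; each of the r steps contributes one such factor. *)
Lemma tsum_act r M A B :
  tsum r (act M A) (act M B) = (\det M) ^+ r *: act M (tsum r A B).
Proof.
elim: r A B => [|r IHr] A B.
  rewrite /tsum !big_ord_recl !big_ord0 !addr0 /= !expr0 !bin0 !mulr1 !scale1r.
  rewrite -!/(act _ _) (_ : mxy 0 0 = 0%MM) ?mderivm0m ?actM //.
  by rewrite [RHS]mxy_eq !mnm0E.
rewrite tsumS (mderiv_act M 0 A) (mderiv_act M 1 A) (mderiv_act M 0 B) (mderiv_act M 1 B).
rewrite !tsum_comb !IHr tsumS actB exprS; move: (\det M ^+ r) => d; rewrite det2.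
move: (act M (tsum r A^`M(0) B^`M(0))) (act M (tsum r A^`M(0) B^`M(1)))
  (act M (tsum r A^`M(1) B^`M(0))) (act M (tsum r A^`M(1) B^`M(1))) => t00 t01 t10 t11.
rewrite -!mul_mpolyC; ring.
Qed.

Lemma csem_act M F G e : \det M = 1 -> csem (act M F) (act M G) e = act M (csem F G e).
Proof.
move=> dM; elim: e => [||r a IHa b IHb|a IHa b IHb|a IHa m] //=; rewrite ?IHa ?IHb.
- by rewrite !transvectant_polyE tsum_act dM expr1n scale1r actZ.
- by rewrite actM.
- by rewrite actX.
Qed.

(** A linear substitution fixes the origin, where the constant coefficient is the value. *)
Lemma act_coef0 M A : (act M A)@_0%MM = A@_0%MM.
Proof.
elim/mpoly2_ind: A => [c|i|A B hA hB|A B hA hB].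
- by rewrite actC.
- by rewrite act_var mcoeffD !mcoeffZ !mcoeffX !mnm1_eq0 !mulr0 addr0.
- by rewrite actD !mcoeffD hA hB.
- by rewrite actM !(rmorphM (mcoeff 0%MM)) /= hA hB.
Qed.

Lemma Jinv_act M F G i : \det M = 1 -> Jinv (act M F) (act M G) i = Jinv F G i.
Proof. by move=> dM; rewrite /Jinv csem_act // act_coef0. Qed.

End Equivariance.

(** * Symbolic evaluation of the invariants *)

Section Symbolic.
Variable N : nat.
Implicit Types (f g : seq (pol N)).

Fixpoint pformX n f m : seq (pol N) :=
  if m is m'.+1 then pprod n (n * m') f (pformX n f m') else [:: pconst N 1].

Fixpoint ucomp f g e : seq (pol N) :=
  match e with
  | CF => f
  | CG => g
  | CT r a b => ptrans (cord a) (cord b) r (ucomp f g a) (ucomp f g b)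
  | CM a b => pprod (cord a) (cord b) (ucomp f g a) (ucomp f g b)
  | CX a m => pformX (cord a) (ucomp f g a) m
  end.

(* Coefficients are listed in the order x^n, x^(n-1) y, ..., y^n. *)
Implicit Types (s t : seq (pexp N)).

Definition Jpol s t i : pol N :=
  pcoef (ucomp (map (@pnorm N) s) (map (@pnorm N) t) (jexp i)) 0.

Fixpoint pgcd n : pol n -> Z :=
  if n is n'.+1 return pol n -> Z then foldr (fun p z => Z.gcd (pgcd p) z) Z0 else id.

Fixpoint pdivc n (z : Z) : pol n -> pol n :=
  if n is n'.+1 return pol n -> pol n then map (@pdivc n' z) else fun y => Z.div y z.

(** Division by the content keeps the constants of the later certificates small. Nothing is proved
    about [pgcd] and [pdivc]: proportionality to [Jpol] is tested by [Jcheck]. *)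
Definition Jprim s t i : pexp N := PP (pdivc (pgcd (Jpol s t i)) (Jpol s t i)).

Definition Jcheck s t i (u : pexp N) : bool :=
  [&& all (@pwf N) s, all (@pwf N) t, pwf u, cord (jexp i) == 0%N &
      proportional (Jpol s t i) (pnorm u)].

Definition Jcheck0 s t i : bool :=
  [&& all (@pwf N) s, all (@pwf N) t, cord (jexp i) == 0%N & pzerob (Jpol s t i)].

(** Equality rather than proportionality: the ratios between the coefficients of a covariant
    matter. *)
Definition ccheck s t e (us : seq (pexp N)) : bool :=
  [&& all (@pwf N) s, all (@pwf N) t, all (@pwf N) us &
      all (fun j => peqb (pcoef (ucomp (map (@pnorm N) s) (map (@pnorm N) t) e) j)
                         (pnorm (nth (PC Z0) us j))) (iota 0 (cord e).+1)].

Variables (k : fieldType) (hk : [pchar k] =i pred0).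
Implicit Types rho : nat -> k.

Definition sform (rho : nat -> k) n s : {mpoly k[2]} :=
  bf n (fun j => pden rho (nth (PC Z0) s j)).

Lemma nth_pnorm rho s j : all (@pwf N) s ->
  peval rho (pcoef (map (@pnorm N) s) j) = pden rho (nth (PC Z0) s j).
Proof.
move=> /(all_nthP (PC Z0)) ws; rewrite /pcoef.
have [lt_js|le_sj] := ltnP j (size s).
  by rewrite (nth_map (PC Z0)) // pnormP // ws.
by rewrite !nth_default ?size_map // peval_zero.
Qed.

Lemma sform_pform rho n s : all (@pwf N) s ->
  sform rho n s = pform rho n (map (@pnorm N) s).
Proof. by move=> ws; apply: eq_bigr => j _; rewrite nth_pnorm. Qed.

Lemma pformX_correct rho n f m : pform rho (n * m) (pformX n f m) = pform rho n f ^+ m.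
Proof.
elim: m => [|m IHm].
  rewrite muln0 expr0 /pform /bf big_ord_recl big_ord0 addr0 /pcoef /=.
  rewrite peval_const scale1r -(mpolyX0 2 k); congr 'X_[_].
  by rewrite [RHS]mxy_eq !mnm0E.
by rewrite exprS -IHm mulnS pform_prod.
Qed.

(** The product of the factorial factors that [ucomp] leaves out. *)
Fixpoint ccst e : k :=
  match e with
  | CT r a b => tnorm k r (cord a) (cord b) * (ccst a * ccst b)
  | CM a b => ccst a * ccst b
  | CX a m => ccst a ^+ m
  | _ => 1
  end.

Lemma ccst_neq0 e : ccst e != 0.
Proof.
elim: e => [||r a IHa b IHb|a IHa b IHb|a IHa m] /=; rewrite ?oner_eq0 ?mulf_neq0
    ?expf_neq0 //.
- by rewrite natr0_eq0 // -lt0n muln_gt0 !fact_gt0.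
- by rewrite invr_eq0 natr0_eq0 // -lt0n muln_gt0 !fact_gt0.
Qed.

Lemma csem_pform rho f g e :
  csem (pform rho 5 f) (pform rho 3 g) e = ccst e *: pform rho (cord e) (ucomp f g e).
Proof.
elim: e => [||r a IHa b IHb|a IHa b IHb|a IHa m] /=; rewrite ?scale1r //.
- by rewrite transvectant_polyE IHa IHb tsumZ scalerA pform_trans.
- by rewrite IHa IHb -scalerAl -scalerAr scalerA pform_prod.
- by rewrite IHa exprZn pformX_correct.
Qed.

Lemma bf_coef0 n (c : nat -> k) : n = 0%N -> (bf n c)@_0%MM = c 0%N.
Proof.
move=> ->; rewrite /bf big_ord_recl big_ord0 addr0 mcoeffZ mcoeffX.
rewrite (_ : mxy _ _ = 0%MM) ?eqxx ?mulr1 //.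
by rewrite [RHS]mxy_eq !mnm0E.
Qed.

Lemma Jinv_sform rho s t i : all (@pwf N) s -> all (@pwf N) t -> cord (jexp i) == 0%N ->
  Jinv (sform rho 5 s) (sform rho 3 t) i = ccst (jexp i) * peval rho (Jpol s t i).
Proof.
move=> ws wt /eqP d0.
by rewrite /Jinv !sform_pform // csem_pform mcoeffZ bf_coef0.
Qed.

Lemma Jinv_check s t i u : Jcheck s t i u -> exists2 c : k, c != 0 &
  forall rho, Jinv (sform rho 5 s) (sform rho 3 t) i = c * pden rho u.
Proof.
move=> /and5P[ws wt wu d0 /(proportionalP hk)[c c0 e]].
exists (ccst (jexp i) * c) => [|rho]; first by rewrite mulf_neq0 ?ccst_neq0.
by rewrite Jinv_sform // e pnormP // mulrA.
Qed.

Lemma Jinv_check0 rho s t i : Jcheck0 s t i ->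
  Jinv (sform rho 5 s) (sform rho 3 t) i = 0.
Proof.
by move=> /and4P[ws wt d0 z]; rewrite Jinv_sform // peval_zerob // mulr0.
Qed.

Lemma csem_check rho s t e us : ccheck s t e us ->
  csem (sform rho 5 s) (sform rho 3 t) e = ccst e *: sform rho (cord e) us.
Proof.
move=> /and4P[ws wt wu /allP h]; rewrite (sform_pform rho 5) // (sform_pform rho 3) //
    csem_pform; congr (_ *: _).
rewrite /pform /sform /bf; apply: eq_bigr => j _; congr (_ *: _).
rewrite -pnormP; last first.
  have [lt_j|le_j] := ltnP j (size us); last by rewrite nth_default.
  exact: (all_nthP (PC Z0) wu).
by apply: peval_eqb; apply: h; rewrite mem_iota add0n ltn_ord.
Qed.

(** The unknown constant between the invariant and u is the same at both points, so it cancels. *)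
Lemma Jinv_known s t i u rho rho' : Jcheck s t i u ->
  Jinv (sform rho 5 s) (sform rho 3 t) i = Jinv (sform rho' 5 s) (sform rho' 3 t) i ->
  pden rho u = pden rho' u.
Proof.
by move=> /Jinv_check[c c0 e]; rewrite !e => /(mulfI c0).
Qed.

(* Evaluation points that agree on [us] agree on every [t] with
   Q(us) t = P(us), as soon as Q(us) does not vanish. *)
Definition agree rho rho' (u : pexp N) := pden rho u = pden rho' u.

(** P is a template: its variable of index i stands for the i-th entry of [us], not for a
    coordinate. An embedded polynomial makes no sense in a template and is sent to 0. *)
Fixpoint psubst (us : seq (pexp N)) (P : pexp N) : pexp N :=
  match P with
  | PV i => nth (PC Z0) us i
  | PAdd a b => PAdd (psubst us a) (psubst us b)
  | PMul a b => PMul (psubst us a) (psubst us b)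
  | PExp a m => PExp (psubst us a) m
  | PC z => PC z
  | PP _ => PC Z0
  end.

Fixpoint agree_all rho rho' us : Prop :=
  if us is u :: us' then agree rho rho' u /\ agree_all rho rho' us' else True.

Lemma agree_nth rho rho' us i : agree_all rho rho' us -> agree rho rho' (nth (PC Z0) us
    i).
Proof.
elim: us i => [|u us IHus] i /=; first by rewrite nth_nil.
by move=> [hu /IHus hus]; case: i.
Qed.

Lemma agree_subst rho rho' us P : agree_all rho rho' us -> agree rho rho' (psubst us P).
Proof.
rewrite /agree => h; elim: P => //= [i|a -> b -> //|a -> b -> //|a -> //].
exact: agree_nth.
Qed.

(** The certificate of a solving step: one polynomial identity, valid at all points at once, that
    expresses v as a quotient in [us]. *)
Definition solves us (Q P v : pexp N) : bool :=
  [&& pwf (PMul (psubst us Q) v), pwf (psubst us P) &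
      peqb (pnorm (PMul (psubst us Q) v)) (pnorm (psubst us P))].

Lemma agree_solve rho rho' us Q P v : solves us Q P v ->
  pden rho (psubst us Q) != 0 -> agree_all rho rho' us -> agree rho rho' v.
Proof.
move=> e q0 h.
have /= et := pden_eq rho e; have /= et' := pden_eq rho' e.
apply: (mulfI q0); rewrite et (agree_subst P h) -et'.
by rewrite (agree_subst Q h).
Qed.

End Symbolic.

Declare Scope pexp_scope.
Delimit Scope pexp_scope with pexp.
Bind Scope pexp_scope with pexp.
Notation "a + b" := (PAdd a b) : pexp_scope.
Notation "a * b" := (PMul a b) : pexp_scope.
Notation "a ^+ m" := (PExp a m) : pexp_scope.
Notation "z %:z" := (@PC 7 z) (at level 2, format "z %:z") : pexp_scope.
Notation "''c_' i" := (@PV 7 i) (at level 8, i at level 2, format "''c_' i") : pexp_scope.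
Notation "a - b" := (PAdd a (PMul (PC (Zneg 1)) b)) : pexp_scope.

Definition quintic (s : seq (pexp 7)) : seq (pexp 7) :=
  [seq PMul (PC (Z.of_nat 'C(5, j))) (nth (PC Z0) s j) | j <- iota 0 6].

(* The normal forms (F, G), numbered by t < 8.  F is the sum of the
   'C(5, j) c_j x^(5-j) y^j with the coefficients c_j listed by [nfc], and G is
   a (x^3 + y^3) with a = 'c_6, x^2 y (twice), x^3 (twice) or 0 (three times).
   When G = 0, the cases are: the cubic covariant c_{3,3} of F is proportional to
   x^3 + y^3, proportional to x^2 y, or zero. *)
Definition nfc t : seq (pexp 7) := nth [::]
  [:: [:: 'c_0; 'c_1; 'c_2; 'c_3; 'c_4; 'c_5];
      [:: 'c_0; 'c_1; 'c_2; 'c_3; 'c_4; 'c_5];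
      [:: 'c_0; 'c_1; 'c_2; 'c_3; 'c_4; 0%:z];
      [:: 'c_0; 'c_1; 'c_2; 'c_3; 0%:z; 'c_5];
      [:: 'c_0; 'c_1; 'c_2; 0%:z; 'c_4; 0%:z];
      [:: 'c_0; 'c_1; 'c_2; 'c_0; 'c_1; 'c_2];
      [:: 'c_0; 'c_1; 0%:z; 0%:z; 0%:z; 'c_5];
      [:: 'c_0 * 'c_1 ^+ 2; 0%:z; 'c_0 * 'c_1; 0%:z; 'c_0]]%pexp t.

Definition nfF t := quintic (nfc t).

Definition nfG t : seq (pexp 7) := nth [::]
  [:: [:: 'c_6; 0%:z; 0%:z; 'c_6];
      [:: 0%:z; 1%:z];
      [:: 0%:z; 1%:z];
      [:: 1%:z];
      [:: 1%:z]]%pexp t.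

(* [nfJ t] is the index of an invariant that vanishes on all later normal forms
   and is proportional to the power [nfexp t] of [nfnz t] on form t; the form is
   admissible when [nfnz t] does not vanish. *)
Definition nfJ t : nat := nth 0%N [:: 0; 6; 1; 16; 3; 45; 27; 5]%N t.

Definition nfnz t : pexp 7 := (nth 1%:z
  [:: 'c_6; 'c_5; 'c_4; 'c_5; 'c_4;
      'c_0 ^+ 3 + 'c_1 ^+ 3 + 'c_2 ^+ 3 - 3%:z * 'c_0 * 'c_1 * 'c_2;
      'c_1 ^+ 5 * 'c_5 ^+ 3; 'c_0 ^+ 4 * 'c_1 ^+ 3] t)%pexp.

Definition nfexp t : nat := nth 1%N [:: 4; 1; 1; 3; 2; 4; 1; 1]%N t.

Lemma nf_detect t : (t < 8)%N ->
  Jcheck (nfF t) (nfG t) (nfJ t) (PExp (nfnz t) (nfexp t)).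
Proof.
have : all (fun t => Jcheck (nfF t) (nfG t) (nfJ t) (PExp (nfnz t) (nfexp t))) (iota 0 8).
  by vm_compute.
by move=> /allP h lt_t8; apply: h; rewrite mem_iota.
Qed.

Lemma nf_vanish t u : (t < u < 8)%N -> Jcheck0 (nfF u) (nfG u) (nfJ t).
Proof.
have : all (fun u => all (fun t => Jcheck0 (nfF u) (nfG u) (nfJ t)) (iota 0 u)) (iota 0
    8).
  by vm_compute.
move=> /allP h /andP[tu u8]; have := h u; rewrite mem_iota => /(_ u8) /allP; apply.
by rewrite mem_iota.
Qed.

(** * Invariants determine the coordinates of a normal form *)

Section CoordinatesFromInvariants.
Variables (k : fieldType) (hk : [pchar k] =i pred0).
Implicit Types rho : nat -> k.

Definition nfJp t i := Jprim (nfF t) (nfG t) i.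

(** The invariants that suffice on form t, in the order in which [sep0] to [sep7] use them; in that
    order the equations are triangular by blocks. *)
Definition sepJ t : seq nat := nth [::]
  [:: [:: 1; 6; 2; 3; 7; 13; 4; 8; 9; 14; 10; 15; 16; 28];
      [:: 6; 1; 13; 7; 2; 14]; [:: 1; 7; 2; 8; 4]; [:: 3; 10; 19; 31];
      [:: 3; 10; 4; 25; 24; 27]; [:: 27; 5; 49]; [:: 27; 49]; [:: 5]]%N t.

Definition same_J t rho rho' := forall i, i \in sepJ t -> agree rho rho' (nfJp t i).

Lemma sep_check t i : (t < 8)%N -> i \in sepJ t -> Jcheck (nfF t) (nfG t) i (nfJp t i).
Proof.
have : all (fun t => all (fun i => Jcheck (nfF t) (nfG t) i (nfJp t i)) (sepJ t)) (iota 0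
    8).
  by vm_compute.
by move=> /allP h t8; have := h t; rewrite mem_iota => /(_ t8) /allP; apply.
Qed.

Lemma same_JP t rho rho' : (t < 8)%N ->
  (forall i, (i < 50)%N -> Jinv (sform rho 5 (nfF t)) (sform rho 3 (nfG t)) i =
             Jinv (sform rho' 5 (nfF t)) (sform rho' 3 (nfG t)) i) ->
  same_J t rho rho'.
Proof.
move=> t8 h i it; apply: (Jinv_known hk (sep_check t8 it)); apply: h.
have /allP -> // : all (fun i => (i < 50)%N) (sepJ t).
by move: t t8 {it}; do 8! case=> //.
Qed.

Ltac solve_side nz :=
  rewrite /=; repeat first [exact: nz | apply: expf_neq0 | apply: mulf_neq0
                             | by rewrite zk_eq0].

(* Below, the polynomials P come from solving linear equations: Q(us) v is written as a
   combination of monomials in the quantities us already determined. *)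
Lemma sep0 rho rho' : same_J 0 rho rho' -> agree rho rho' 'c_6%pexp ->
  pden rho 'c_6%pexp != 0 ->
  agree_all rho rho' [:: 'c_1; 'c_4; 'c_0 * 'c_2; 'c_0 * 'c_5; 'c_2 * 'c_3; 'c_3 * 'c_5;
      'c_3 ^+ 3; 'c_2 ^+ 3; 'c_2 ^+ 2 * 'c_5; 'c_3 ^+ 2 * 'c_0; 'c_5 ^+ 2 * 'c_2; 'c_0 ^+
      2 * 'c_3; 'c_5 ^+ 3; 'c_0 ^+ 3]%pexp.
Proof.
move=> J a0 nz.
have j1 := J 1%N isT.
have j2 := J 2%N isT.
have j3 := J 3%N isT.
have j4 := J 4%N isT.
have j6 := J 6%N isT.
have j7 := J 7%N isT.
have j8 := J 8%N isT.
have j9 := J 9%N isT.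
have j10 := J 10%N isT.
have j13 := J 13%N isT.
have j14 := J 14%N isT.
have j15 := J 15%N isT.
have j16 := J 16%N isT.
have j28 := J 28%N isT.
(* The targets are the generators of the monomials fixed by diag(w, w^2), w^3 = 1, which preserves
   x^3 + y^3: c_1, c_4, four products and eight cubics in c_0, c_3 (weight 2) and c_2, c_5 (weight
   1). In the templates ['c_0] is the first entry of the list, that is the coefficient a of G. The
   invariants 1 and 6 are linear in F. *)
have a1 : agree rho rho' ('c_1)%pexp.
  apply: (@agree_solve _ _ rho rho' [:: 'c_6; nfJp 0 1; nfJp 0 6]%pexp
    (2%:z * 'c_0 ^+ 5)%pexp
    ('c_2 - 'c_0 ^+ 2 * 'c_1)%pexp _ _ _
    (conj a0 (conj j1 (conj j6 I)))); [by vm_compute | solve_side nz].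
have a2 : agree rho rho' ('c_4)%pexp.
  apply: (@agree_solve _ _ rho rho' [:: 'c_6; nfJp 0 1; nfJp 0 6]%pexp
    (2%:z * 'c_0 ^+ 5)%pexp
    ('c_2 + 'c_0 ^+ 2 * 'c_1)%pexp _ _ _
    (conj a0 (conj j1 (conj j6 I)))); [by vm_compute | solve_side nz].
(* The invariants 2, 3, 7 and 13 are quadratic in F and give a linear system for the four
   products. *)
have a3 : agree rho rho' ('c_0 * 'c_2)%pexp.
  apply: (@agree_solve _ _ rho rho' [:: 'c_6; 'c_1; 'c_4; nfJp 0 2; nfJp 0 3; nfJp 0 7;
      nfJp 0 13]%pexp
    (40%:z * 'c_0 ^+ 6)%pexp
    ('c_6 - 20%:z * 'c_0 ^+ 2 * 'c_5 + 'c_0 ^+ 4 * 'c_4 + 40%:z * 'c_0 ^+ 6 * 'c_1 ^+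
        2)%pexp _ _ _
    (conj a0 (conj a1 (conj a2 (conj j2 (conj j3 (conj j7 (conj j13 I)))))))); [by
        vm_compute | solve_side nz].
have a4 : agree rho rho' ('c_0 * 'c_5)%pexp.
  apply: (@agree_solve _ _ rho rho' [:: 'c_6; 'c_1; 'c_4; nfJp 0 2; nfJp 0 3; nfJp 0 7;
      nfJp 0 13]%pexp
    (10%:z * 'c_0 ^+ 6)%pexp
    ('c_6 - 'c_0 ^+ 4 * 'c_4 - 8%:z * 'c_0 ^+ 4 * 'c_3 + 10%:z * 'c_0 ^+ 6 * 'c_1 *
        'c_2)%pexp _ _ _
    (conj a0 (conj a1 (conj a2 (conj j2 (conj j3 (conj j7 (conj j13 I)))))))); [by
        vm_compute | solve_side nz].
have a5 : agree rho rho' ('c_2 * 'c_3)%pexp.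
  apply: (@agree_solve _ _ rho rho' [:: 'c_6; 'c_1; 'c_4; nfJp 0 2; nfJp 0 3; nfJp 0 7;
      nfJp 0 13]%pexp
    (20%:z * 'c_0 ^+ 6)%pexp
    (0%:z - 'c_6 + 'c_0 ^+ 4 * 'c_4 - 2%:z * 'c_0 ^+ 4 * 'c_3 + 20%:z * 'c_0 ^+ 6 * 'c_1
        * 'c_2)%pexp _ _ _
    (conj a0 (conj a1 (conj a2 (conj j2 (conj j3 (conj j7 (conj j13 I)))))))); [by
        vm_compute | solve_side nz].
have a6 : agree rho rho' ('c_3 * 'c_5)%pexp.
  apply: (@agree_solve _ _ rho rho' [:: 'c_6; 'c_1; 'c_4; nfJp 0 2; nfJp 0 3; nfJp 0 7;
      nfJp 0 13]%pexp
    (40%:z * 'c_0 ^+ 6)%pexp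
    ('c_6 + 20%:z * 'c_0 ^+ 2 * 'c_5 + 'c_0 ^+ 4 * 'c_4 + 40%:z * 'c_0 ^+ 6 * 'c_2 ^+
        2)%pexp _ _ _
    (conj a0 (conj a1 (conj a2 (conj j2 (conj j3 (conj j7 (conj j13 I)))))))); [by
        vm_compute | solve_side nz].
(* The remaining eight invariants are cubic in F; their system for the eight cubic monomials is
   solved in blocks of sizes 4, 2 and 2. *)
have a7 : agree rho rho' ('c_3 ^+ 3)%pexp.
  apply: (@agree_solve _ _ rho rho' [:: 'c_6; 'c_1; 'c_4; 'c_0 * 'c_2; 'c_0 * 'c_5; 'c_2
      * 'c_3; 'c_3 * 'c_5; nfJp 0 4; nfJp 0 8; nfJp 0 9; nfJp 0 14]%pexp
    (60%:z * 'c_0 ^+ 7)%pexp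
    (0%:z - 'c_0 ^+ 2 * 'c_10 - 'c_0 ^+ 4 * 'c_9 - 6%:z * 'c_0 ^+ 4 * 'c_8 - 6%:z * 'c_0
        ^+ 6 * 'c_7 + 100%:z * 'c_0 ^+ 7 * 'c_2 * 'c_5 + 10%:z * 'c_0 ^+ 7 * 'c_2 * 'c_4
        - 20%:z * 'c_0 ^+ 7 * 'c_1 * 'c_6 - 30%:z * 'c_0 ^+ 7 * 'c_1 * 'c_2 ^+ 2)%pexp _
        _ _
    (conj a0 (conj a1 (conj a2 (conj a3 (conj a4 (conj a5 (conj a6 (conj j4 (conj j8
        (conj j9 (conj j14 I)))))))))))); [by vm_compute | solve_side nz].
have a8 : agree rho rho' ('c_2 ^+ 3)%pexp.
  apply: (@agree_solve _ _ rho rho' [:: 'c_6; 'c_1; 'c_4; 'c_0 * 'c_2; 'c_0 * 'c_5; 'c_2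
      * 'c_3; 'c_3 * 'c_5; nfJp 0 4; nfJp 0 8; nfJp 0 9; nfJp 0 14]%pexp
    (60%:z * 'c_0 ^+ 7)%pexp
    ('c_0 ^+ 2 * 'c_10 - 'c_0 ^+ 4 * 'c_9 - 6%:z * 'c_0 ^+ 4 * 'c_8 + 6%:z * 'c_0 ^+ 6 *
        'c_7 - 20%:z * 'c_0 ^+ 7 * 'c_2 * 'c_3 + 100%:z * 'c_0 ^+ 7 * 'c_1 * 'c_5 + 10%:z
        * 'c_0 ^+ 7 * 'c_1 * 'c_4 - 30%:z * 'c_0 ^+ 7 * 'c_1 ^+ 2 * 'c_2)%pexp _ _ _
    (conj a0 (conj a1 (conj a2 (conj a3 (conj a4 (conj a5 (conj a6 (conj j4 (conj j8
        (conj j9 (conj j14 I)))))))))))); [by vm_compute | solve_side nz].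
have a9 : agree rho rho' ('c_2 ^+ 2 * 'c_5)%pexp.
  apply: (@agree_solve _ _ rho rho' [:: 'c_6; 'c_1; 'c_4; 'c_0 * 'c_2; 'c_0 * 'c_5; 'c_2
      * 'c_3; 'c_3 * 'c_5; nfJp 0 4; nfJp 0 8; nfJp 0 9; nfJp 0 14]%pexp
    (60%:z * 'c_0 ^+ 7)%pexp
    ('c_0 ^+ 2 * 'c_10 + 'c_0 ^+ 4 * 'c_9 - 24%:z * 'c_0 ^+ 4 * 'c_8 - 24%:z * 'c_0 ^+ 6
        * 'c_7 + 20%:z * 'c_0 ^+ 7 * 'c_2 * 'c_5 - 10%:z * 'c_0 ^+ 7 * 'c_2 * 'c_4 +
        80%:z * 'c_0 ^+ 7 * 'c_1 * 'c_6 - 30%:z * 'c_0 ^+ 7 * 'c_1 * 'c_2 ^+ 2)%pexp _ _ _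
    (conj a0 (conj a1 (conj a2 (conj a3 (conj a4 (conj a5 (conj a6 (conj j4 (conj j8
        (conj j9 (conj j14 I)))))))))))); [by vm_compute | solve_side nz].
have a10 : agree rho rho' ('c_3 ^+ 2 * 'c_0)%pexp.
  apply: (@agree_solve _ _ rho rho' [:: 'c_6; 'c_1; 'c_4; 'c_0 * 'c_2; 'c_0 * 'c_5; 'c_2
      * 'c_3; 'c_3 * 'c_5; nfJp 0 4; nfJp 0 8; nfJp 0 9; nfJp 0 14]%pexp
    (60%:z * 'c_0 ^+ 7)%pexp
    (0%:z - 'c_0 ^+ 2 * 'c_10 + 'c_0 ^+ 4 * 'c_9 - 24%:z * 'c_0 ^+ 4 * 'c_8 + 24%:z *
        'c_0 ^+ 6 * 'c_7 + 80%:z * 'c_0 ^+ 7 * 'c_2 * 'c_3 + 20%:z * 'c_0 ^+ 7 * 'c_1 *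
        'c_5 - 10%:z * 'c_0 ^+ 7 * 'c_1 * 'c_4 - 30%:z * 'c_0 ^+ 7 * 'c_1 ^+ 2 *
        'c_2)%pexp _ _ _
    (conj a0 (conj a1 (conj a2 (conj a3 (conj a4 (conj a5 (conj a6 (conj j4 (conj j8
        (conj j9 (conj j14 I)))))))))))); [by vm_compute | solve_side nz].
have a11 : agree rho rho' ('c_5 ^+ 2 * 'c_2)%pexp.
  apply: (@agree_solve _ _ rho rho' [:: 'c_6; 'c_1; 'c_4; 'c_0 * 'c_2; 'c_0 * 'c_5; 'c_2
      * 'c_3; 'c_3 * 'c_5; 'c_3 ^+ 3; 'c_2 ^+ 3; 'c_2 ^+ 2 * 'c_5; 'c_3 ^+ 2 * 'c_0; nfJp
      0 10; nfJp 0 15]%pexp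
    (168%:z * 'c_0 ^+ 7)%pexp
    ('c_0 ^+ 2 * 'c_12 + 3%:z * 'c_0 ^+ 4 * 'c_11 - 68%:z * 'c_0 ^+ 7 * 'c_10 - 136%:z *
        'c_0 ^+ 7 * 'c_9 + 16%:z * 'c_0 ^+ 7 * 'c_8 + 32%:z * 'c_0 ^+ 7 * 'c_7 + 504%:z *
        'c_0 ^+ 7 * 'c_2 * 'c_6 - 8%:z * 'c_0 ^+ 7 * 'c_2 * 'c_5 + 28%:z * 'c_0 ^+ 7 *
        'c_2 * 'c_4 - 16%:z * 'c_0 ^+ 7 * 'c_2 * 'c_3 - 336%:z * 'c_0 ^+ 7 * 'c_2 ^+ 3 -
        32%:z * 'c_0 ^+ 7 * 'c_1 * 'c_6 - 4%:z * 'c_0 ^+ 7 * 'c_1 * 'c_5 + 14%:z * 'c_0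
        ^+ 7 * 'c_1 * 'c_4 + 116%:z * 'c_0 ^+ 7 * 'c_1 * 'c_2 ^+ 2 + 58%:z * 'c_0 ^+ 7 *
        'c_1 ^+ 2 * 'c_2)%pexp _ _ _
    (conj a0 (conj a1 (conj a2 (conj a3 (conj a4 (conj a5 (conj a6 (conj a7 (conj a8
        (conj a9 (conj a10 (conj j10 (conj j15 I)))))))))))))); [by vm_compute |
        solve_side nz].
have a12 : agree rho rho' ('c_0 ^+ 2 * 'c_3)%pexp.
  apply: (@agree_solve _ _ rho rho' [:: 'c_6; 'c_1; 'c_4; 'c_0 * 'c_2; 'c_0 * 'c_5; 'c_2
      * 'c_3; 'c_3 * 'c_5; 'c_3 ^+ 3; 'c_2 ^+ 3; 'c_2 ^+ 2 * 'c_5; 'c_3 ^+ 2 * 'c_0; nfJp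
      0 10; nfJp 0 15]%pexp
    (168%:z * 'c_0 ^+ 7)%pexp
    (0%:z - 'c_0 ^+ 2 * 'c_12 + 3%:z * 'c_0 ^+ 4 * 'c_11 - 136%:z * 'c_0 ^+ 7 * 'c_10 -
        68%:z * 'c_0 ^+ 7 * 'c_9 + 32%:z * 'c_0 ^+ 7 * 'c_8 + 16%:z * 'c_0 ^+ 7 * 'c_7 -
        4%:z * 'c_0 ^+ 7 * 'c_2 * 'c_5 + 14%:z * 'c_0 ^+ 7 * 'c_2 * 'c_4 - 32%:z * 'c_0
        ^+ 7 * 'c_2 * 'c_3 - 16%:z * 'c_0 ^+ 7 * 'c_1 * 'c_6 - 8%:z * 'c_0 ^+ 7 * 'c_1 *
        'c_5 + 28%:z * 'c_0 ^+ 7 * 'c_1 * 'c_4 + 504%:z * 'c_0 ^+ 7 * 'c_1 * 'c_3 + 58%:z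
        * 'c_0 ^+ 7 * 'c_1 * 'c_2 ^+ 2 + 116%:z * 'c_0 ^+ 7 * 'c_1 ^+ 2 * 'c_2 - 336%:z *
        'c_0 ^+ 7 * 'c_1 ^+ 3)%pexp _ _ _
    (conj a0 (conj a1 (conj a2 (conj a3 (conj a4 (conj a5 (conj a6 (conj a7 (conj a8
        (conj a9 (conj a10 (conj j10 (conj j15 I)))))))))))))); [by vm_compute |
        solve_side nz].
have a13 : agree rho rho' ('c_5 ^+ 3)%pexp.
  apply: (@agree_solve _ _ rho rho' [:: 'c_6; 'c_1; 'c_4; 'c_0 * 'c_2; 'c_0 * 'c_5; 'c_2
      * 'c_3; 'c_3 * 'c_5; 'c_3 ^+ 3; 'c_2 ^+ 3; 'c_2 ^+ 2 * 'c_5; 'c_3 ^+ 2 * 'c_0; 'c_5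
      ^+ 2 * 'c_2; 'c_0 ^+ 2 * 'c_3; nfJp 0 16; nfJp 0 28]%pexp
    (2002%:z * 'c_0 ^+ 7)%pexp
    (0%:z - 'c_14 - 'c_0 ^+ 2 * 'c_13 - 132%:z * 'c_0 ^+ 7 * 'c_12 + 528%:z * 'c_0 ^+ 7 *
        'c_11 + 480%:z * 'c_0 ^+ 7 * 'c_10 - 720%:z * 'c_0 ^+ 7 * 'c_9 + 1600%:z * 'c_0
        ^+ 7 * 'c_8 - 2400%:z * 'c_0 ^+ 7 * 'c_7 + 5280%:z * 'c_0 ^+ 7 * 'c_2 * 'c_6 -
        7200%:z * 'c_0 ^+ 7 * 'c_2 * 'c_5 - 72%:z * 'c_0 ^+ 7 * 'c_2 * 'c_4 + 480%:z *
        'c_0 ^+ 7 * 'c_2 * 'c_3 + 2200%:z * 'c_0 ^+ 7 * 'c_2 ^+ 3 - 720%:z * 'c_0 ^+ 7 *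
        'c_1 * 'c_6 + 4800%:z * 'c_0 ^+ 7 * 'c_1 * 'c_5 + 48%:z * 'c_0 ^+ 7 * 'c_1 * 'c_4
        - 1320%:z * 'c_0 ^+ 7 * 'c_1 * 'c_3 - 900%:z * 'c_0 ^+ 7 * 'c_1 * 'c_2 ^+ 2 +
        600%:z * 'c_0 ^+ 7 * 'c_1 ^+ 2 * 'c_2 - 550%:z * 'c_0 ^+ 7 * 'c_1 ^+ 3)%pexp _ _ _
    (conj a0 (conj a1 (conj a2 (conj a3 (conj a4 (conj a5 (conj a6 (conj a7 (conj a8
        (conj a9 (conj a10 (conj a11 (conj a12 (conj j16 (conj j28 I)))))))))))))))); [by
        vm_compute | solve_side nz].
have a14 : agree rho rho' ('c_0 ^+ 3)%pexp.
  apply: (@agree_solve _ _ rho rho' [:: 'c_6; 'c_1; 'c_4; 'c_0 * 'c_2; 'c_0 * 'c_5; 'c_2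
      * 'c_3; 'c_3 * 'c_5; 'c_3 ^+ 3; 'c_2 ^+ 3; 'c_2 ^+ 2 * 'c_5; 'c_3 ^+ 2 * 'c_0; 'c_5
      ^+ 2 * 'c_2; 'c_0 ^+ 2 * 'c_3; nfJp 0 16; nfJp 0 28]%pexp
    (2002%:z * 'c_0 ^+ 7)%pexp
    (0%:z - 'c_14 + 'c_0 ^+ 2 * 'c_13 + 528%:z * 'c_0 ^+ 7 * 'c_12 - 132%:z * 'c_0 ^+ 7 *
        'c_11 - 720%:z * 'c_0 ^+ 7 * 'c_10 + 480%:z * 'c_0 ^+ 7 * 'c_9 - 2400%:z * 'c_0
        ^+ 7 * 'c_8 + 1600%:z * 'c_0 ^+ 7 * 'c_7 - 1320%:z * 'c_0 ^+ 7 * 'c_2 * 'c_6 +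
        4800%:z * 'c_0 ^+ 7 * 'c_2 * 'c_5 + 48%:z * 'c_0 ^+ 7 * 'c_2 * 'c_4 - 720%:z *
        'c_0 ^+ 7 * 'c_2 * 'c_3 - 550%:z * 'c_0 ^+ 7 * 'c_2 ^+ 3 + 480%:z * 'c_0 ^+ 7 *
        'c_1 * 'c_6 - 7200%:z * 'c_0 ^+ 7 * 'c_1 * 'c_5 - 72%:z * 'c_0 ^+ 7 * 'c_1 * 'c_4
        + 5280%:z * 'c_0 ^+ 7 * 'c_1 * 'c_3 + 600%:z * 'c_0 ^+ 7 * 'c_1 * 'c_2 ^+ 2 -
        900%:z * 'c_0 ^+ 7 * 'c_1 ^+ 2 * 'c_2 + 2200%:z * 'c_0 ^+ 7 * 'c_1 ^+ 3)%pexp _ _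
        _
    (conj a0 (conj a1 (conj a2 (conj a3 (conj a4 (conj a5 (conj a6 (conj a7 (conj a8
        (conj a9 (conj a10 (conj a11 (conj a12 (conj j16 (conj j28 I)))))))))))))))); [by
        vm_compute | solve_side nz].
exact: (conj a1 (conj a2 (conj a3 (conj a4 (conj a5 (conj a6 (conj a7 (conj a8 (conj a9
    (conj a10 (conj a11 (conj a12 (conj a13 (conj a14 I)))))))))))))).
Qed.

(** The stabilizer of x^2 y in SL2 is trivial, so every coordinate itself is determined, by division
    by c_5. *)
Lemma sep1 rho rho' : same_J 1 rho rho' ->
  pden rho 'c_5%pexp != 0 ->
  agree_all rho rho' [:: 'c_0; 'c_1; 'c_2; 'c_3; 'c_4; 'c_5]%pexp.
Proof.
move=> J nz.
have j1 := J 1%N isT.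
have j2 := J 2%N isT.
have j6 := J 6%N isT.
have j7 := J 7%N isT.
have j13 := J 13%N isT.
have j14 := J 14%N isT.
have a0 : agree rho rho' ('c_5)%pexp.
  apply: (@agree_solve _ _ rho rho' [:: nfJp 1 6]%pexp
    (1%:z)%pexp
    ('c_0)%pexp _ _ _
    (conj j6 I)); [by vm_compute | solve_side nz].
have a1 : agree rho rho' ('c_4)%pexp.
  apply: (@agree_solve _ _ rho rho' [:: nfJp 1 1]%pexp
    (1%:z)%pexp
    (0%:z - 'c_0)%pexp _ _ _
    (conj j1 I)); [by vm_compute | solve_side nz].
have a2 : agree rho rho' ('c_3)%pexp.
  apply: (@agree_solve _ _ rho rho' [:: 'c_5; 'c_4; nfJp 1 13]%pexp
    ('c_0)%pexp
    ('c_2 + 'c_1 ^+ 2)%pexp _ _ _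
    (conj a0 (conj a1 (conj j13 I)))); [by vm_compute | solve_side nz].
have a3 : agree rho rho' ('c_2)%pexp.
  apply: (@agree_solve _ _ rho rho' [:: 'c_5; 'c_4; 'c_3; nfJp 1 7]%pexp
    ('c_0)%pexp
    (0%:z - 'c_3 + 'c_1 * 'c_2)%pexp _ _ _
    (conj a0 (conj a1 (conj a2 (conj j7 I))))); [by vm_compute | solve_side nz].
have a4 : agree rho rho' ('c_1)%pexp.
  apply: (@agree_solve _ _ rho rho' [:: 'c_5; 'c_4; 'c_3; 'c_2; nfJp 1 2]%pexp
    ('c_0)%pexp
    (0%:z - 'c_4 - 3%:z * 'c_2 ^+ 2 + 4%:z * 'c_1 * 'c_3)%pexp _ _ _
    (conj a0 (conj a1 (conj a2 (conj a3 (conj j2 I)))))); [by vm_compute | solve_side nz].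
have a5 : agree rho rho' ('c_0)%pexp.
  apply: (@agree_solve _ _ rho rho' [:: 'c_5; 'c_4; 'c_3; 'c_2; 'c_1; nfJp 1 14]%pexp
    ('c_0 ^+ 2)%pexp
    ('c_5 + 6%:z * 'c_1 * 'c_2 ^+ 2 - 8%:z * 'c_1 ^+ 2 * 'c_3 - 2%:z * 'c_0 * 'c_2 * 'c_3
        + 5%:z * 'c_0 * 'c_1 * 'c_4)%pexp _ _ _
    (conj a0 (conj a1 (conj a2 (conj a3 (conj a4 (conj j14 I))))))); [by vm_compute |
        solve_side nz].
exact: (conj a5 (conj a4 (conj a3 (conj a2 (conj a1 (conj a0 I)))))).
Qed.

(** With c_5 = 0 the pivot of the preceding form is lost; c_4 replaces it, and partly different
    invariants are needed. *)
Lemma sep2 rho rho' : same_J 2 rho rho' ->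
  pden rho 'c_4%pexp != 0 ->
  agree_all rho rho' [:: 'c_0; 'c_1; 'c_2; 'c_3; 'c_4]%pexp.
Proof.
move=> J nz.
have j1 := J 1%N isT.
have j2 := J 2%N isT.
have j4 := J 4%N isT.
have j7 := J 7%N isT.
have j8 := J 8%N isT.
have a0 : agree rho rho' ('c_4)%pexp.
  apply: (@agree_solve _ _ rho rho' [:: nfJp 2 1]%pexp
    (1%:z)%pexp
    (0%:z - 'c_0)%pexp _ _ _
    (conj j1 I)); [by vm_compute | solve_side nz].
have a1 : agree rho rho' ('c_3)%pexp.
  apply: (@agree_solve _ _ rho rho' [:: 'c_4; nfJp 2 7]%pexp
    ('c_0)%pexp
    ('c_1)%pexp _ _ _
    (conj a0 (conj j7 I))); [by vm_compute | solve_side nz].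
have a2 : agree rho rho' ('c_2)%pexp.
  apply: (@agree_solve _ _ rho rho' [:: 'c_4; 'c_3; nfJp 2 2]%pexp
    (4%:z * 'c_0)%pexp
    ('c_2 + 3%:z * 'c_1 ^+ 2)%pexp _ _ _
    (conj a0 (conj a1 (conj j2 I)))); [by vm_compute | solve_side nz].
have a3 : agree rho rho' ('c_1)%pexp.
  apply: (@agree_solve _ _ rho rho' [:: 'c_4; 'c_3; 'c_2; nfJp 2 8]%pexp
    ('c_0 ^+ 2)%pexp
    (0%:z - 'c_3 - 'c_1 ^+ 3 + 2%:z * 'c_0 * 'c_1 * 'c_2)%pexp _ _ _
    (conj a0 (conj a1 (conj a2 (conj j8 I))))); [by vm_compute | solve_side nz].
have a4 : agree rho rho' ('c_0)%pexp.
  apply: (@agree_solve _ _ rho rho' [:: 'c_4; 'c_3; 'c_2; 'c_1; nfJp 2 4]%pexp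
    ('c_0 ^+ 2)%pexp
    ('c_4 - 'c_1 ^+ 2 * 'c_2 + 'c_0 * 'c_2 ^+ 2 + 'c_0 * 'c_1 * 'c_3)%pexp _ _ _
    (conj a0 (conj a1 (conj a2 (conj a3 (conj j4 I)))))); [by vm_compute | solve_side nz].
exact: (conj a4 (conj a3 (conj a2 (conj a1 (conj a0 I))))).
Qed.

(** The invariants give only c_5^3, because diag(w, w^2) with w^3 = 1 preserves x^3; agreement on
    c_5 is arranged beforehand in [uniq3]. *)
Lemma sep3 rho rho' : same_J 3 rho rho' -> agree rho rho' 'c_5%pexp ->
  pden rho 'c_5%pexp != 0 ->
  agree_all rho rho' [:: 'c_0; 'c_1; 'c_2; 'c_3]%pexp.
Proof.
move=> J a0 nz.
have j3 := J 3%N isT.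
have j10 := J 10%N isT.
have j19 := J 19%N isT.
have j31 := J 31%N isT.
have a1 : agree rho rho' ('c_3)%pexp.
  apply: (@agree_solve _ _ rho rho' [:: 'c_5; nfJp 3 3]%pexp
    ('c_0)%pexp
    ('c_1)%pexp _ _ _
    (conj a0 (conj j3 I))); [by vm_compute | solve_side nz].
have a2 : agree rho rho' ('c_2)%pexp.
  apply: (@agree_solve _ _ rho rho' [:: 'c_5; 'c_3; nfJp 3 10]%pexp
    ('c_0 ^+ 2)%pexp
    ('c_2)%pexp _ _ _
    (conj a0 (conj a1 (conj j10 I)))); [by vm_compute | solve_side nz].
have a3 : agree rho rho' ('c_1)%pexp.
  apply: (@agree_solve _ _ rho rho' [:: 'c_5; 'c_3; nfJp 3 19]%pexp
    ('c_0 ^+ 3)%pexp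
    ('c_2 - 3%:z * 'c_0 ^+ 2 * 'c_1 ^+ 2)%pexp _ _ _
    (conj a0 (conj a1 (conj j19 I)))); [by vm_compute | solve_side nz].
have a4 : agree rho rho' ('c_0)%pexp.
  apply: (@agree_solve _ _ rho rho' [:: 'c_5; 'c_3; 'c_2; nfJp 3 31]%pexp
    ('c_0 ^+ 4)%pexp
    (0%:z - 'c_3 - 2%:z * 'c_0 ^+ 3 * 'c_1 * 'c_2)%pexp _ _ _
    (conj a0 (conj a1 (conj a2 (conj j31 I))))); [by vm_compute | solve_side nz].
exact: (conj a4 (conj a3 (conj a2 (conj a1 I)))).
Qed.

Lemma sep4 rho rho' : same_J 4 rho rho' ->
  pden rho 'c_4%pexp != 0 ->
  agree_all rho rho' [:: 'c_4; 'c_1; 'c_2 ^+ 3; 'c_0 * 'c_2; 'c_0 ^+ 3]%pexp.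
Proof.
move=> J nz.
have j3 := J 3%N isT.
have j4 := J 4%N isT.
have j10 := J 10%N isT.
have j24 := J 24%N isT.
have j25 := J 25%N isT.
have j27 := J 27%N isT.
have a0 : agree rho rho' ('c_4 ^+ 2)%pexp.
  apply: (@agree_solve _ _ rho rho' [:: nfJp 4 3]%pexp
    (1%:z)%pexp
    (0%:z - 'c_0)%pexp _ _ _
    (conj j3 I)); [by vm_compute | solve_side nz].
have a1 : agree rho rho' ('c_4 ^+ 3)%pexp.
  apply: (@agree_solve _ _ rho rho' [:: nfJp 4 10]%pexp
    (1%:z)%pexp
    ('c_0)%pexp _ _ _
    (conj j10 I)); [by vm_compute | solve_side nz].
(* c_4 is the quotient of its cube by its square. It is fixed by diag(w, w^2), as is c_1, while c_0
   and c_2 are known only up to the cube root of unity. *)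
have a2 : agree rho rho' ('c_4)%pexp.
  apply: (@agree_solve _ _ rho rho' [:: 'c_4 ^+ 2; 'c_4 ^+ 3]%pexp
    ('c_0)%pexp
    ('c_1)%pexp _ _ _
    (conj a0 (conj a1 I))); [by vm_compute | solve_side nz].
have a3 : agree rho rho' ('c_1)%pexp.
  apply: (@agree_solve _ _ rho rho' [:: 'c_4; nfJp 4 4]%pexp
    ('c_0 ^+ 2)%pexp
    (0%:z - 'c_1)%pexp _ _ _
    (conj a2 (conj j4 I))); [by vm_compute | solve_side nz].
have a4 : agree rho rho' ('c_2 ^+ 3)%pexp.
  apply: (@agree_solve _ _ rho rho' [:: 'c_4; nfJp 4 25]%pexp
    ('c_0 ^+ 3)%pexp
    (0%:z - 'c_1)%pexp _ _ _
    (conj a2 (conj j25 I))); [by vm_compute | solve_side nz].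
have a5 : agree rho rho' ('c_0 * 'c_2)%pexp.
  apply: (@agree_solve _ _ rho rho' [:: 'c_4; 'c_2 ^+ 3; nfJp 4 24]%pexp
    ('c_0 ^+ 4)%pexp
    ('c_2 + 'c_0 ^+ 3 * 'c_1)%pexp _ _ _
    (conj a2 (conj a4 (conj j24 I)))); [by vm_compute | solve_side nz].
have a6 : agree rho rho' ('c_0 ^+ 3)%pexp.
  apply: (@agree_solve _ _ rho rho' [:: 'c_4; 'c_1; 'c_2 ^+ 3; 'c_0 * 'c_2; nfJp 4
      27]%pexp
    (2%:z * 'c_0 ^+ 5)%pexp
    (0%:z - 'c_4 + 18%:z * 'c_0 ^+ 2 * 'c_2 ^+ 2 - 38%:z * 'c_0 ^+ 3 * 'c_2 * 'c_3 +
        38%:z * 'c_0 ^+ 3 * 'c_1 ^+ 2 * 'c_2 + 22%:z * 'c_0 ^+ 4 * 'c_3 ^+ 2 - 54%:z *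
        'c_0 ^+ 4 * 'c_1 ^+ 2 * 'c_3 + 27%:z * 'c_0 ^+ 4 * 'c_1 ^+ 4)%pexp _ _ _
    (conj a2 (conj a3 (conj a4 (conj a5 (conj j27 I)))))); [by vm_compute | solve_side
        nz].
exact: (conj a2 (conj a3 (conj a4 (conj a5 (conj a6 I))))).
Qed.

(** The determining invariant of this form is the fourth power of [nfnz 5]; agreement on the value
    itself is arranged in [uniq5]. *)
Lemma sep5 rho rho' : same_J 5 rho rho' -> agree rho rho' (nfnz 5)%pexp ->
  pden rho (nfnz 5)%pexp != 0 ->
  agree_all rho rho' [:: 'c_1; 'c_0 * 'c_2; 'c_0 ^+ 3; 'c_2 ^+ 3]%pexp.
Proof.
move=> J a0 nz.
have j5 := J 5%N isT.
have j27 := J 27%N isT.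
have j49 := J 49%N isT.
have a1 : agree rho rho' ('c_1 ^+ 2 - 'c_0 * 'c_2)%pexp.
  apply: (@agree_solve _ _ rho rho' [:: (nfnz 5); nfJp 5 27]%pexp
    ('c_0 ^+ 2)%pexp
    ('c_1)%pexp _ _ _
    (conj a0 (conj j27 I))); [by vm_compute | solve_side nz].
have a2 : agree rho rho' ('c_1)%pexp.
  apply: (@agree_solve _ _ rho rho' [:: (nfnz 5); 'c_1 ^+ 2 - 'c_0 * 'c_2; nfJp 5 5]%pexp
    (4%:z * 'c_0)%pexp
    (0%:z - 'c_2 + 3%:z * 'c_1 ^+ 2)%pexp _ _ _
    (conj a0 (conj a1 (conj j5 I)))); [by vm_compute | solve_side nz].
have a3 : agree rho rho' ('c_0 * 'c_2)%pexp.
  apply: (@agree_solve _ _ rho rho' [:: 'c_1 ^+ 2 - 'c_0 * 'c_2; 'c_1]%pexp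
    (1%:z)%pexp
    ('c_1 ^+ 2 - 'c_0)%pexp _ _ _
    (conj a1 (conj a2 I))); [by vm_compute | solve_side nz].
have a4 : agree rho rho' ('c_0 ^+ 3 + 'c_2 ^+ 3)%pexp.
  apply: (@agree_solve _ _ rho rho' [:: (nfnz 5); 'c_1; 'c_0 * 'c_2]%pexp
    (1%:z)%pexp
    (3%:z * 'c_1 * 'c_2 - 'c_1 ^+ 3 + 'c_0)%pexp _ _ _
    (conj a0 (conj a2 (conj a3 I)))); [by vm_compute | solve_side nz].
(* All values found so far are symmetric in c_0 and c_2; the skew invariant c_{18,0} separates the
   two. *)
have a5 : agree rho rho' ('c_0 ^+ 3 - 'c_2 ^+ 3)%pexp.
  apply: (@agree_solve _ _ rho rho' [:: (nfnz 5); nfJp 5 49]%pexp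
    ('c_0 ^+ 5)%pexp
    ('c_1)%pexp _ _ _
    (conj a0 (conj j49 I))); [by vm_compute | solve_side nz].
have a6 : agree rho rho' ('c_0 ^+ 3)%pexp.
  apply: (@agree_solve _ _ rho rho' [:: 'c_0 ^+ 3 + 'c_2 ^+ 3; 'c_0 ^+ 3 - 'c_2 ^+ 3]%pexp
    (2%:z)%pexp
    ('c_1 + 'c_0)%pexp _ _ _
    (conj a4 (conj a5 I))); [by vm_compute | solve_side nz].
have a7 : agree rho rho' ('c_2 ^+ 3)%pexp.
  apply: (@agree_solve _ _ rho rho' [:: 'c_0 ^+ 3 + 'c_2 ^+ 3; 'c_0 ^+ 3 - 'c_2 ^+ 3]%pexp
    (2%:z)%pexp
    (0%:z - 'c_1 + 'c_0)%pexp _ _ _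
    (conj a4 (conj a5 I))); [by vm_compute | solve_side nz].
exact: (conj a2 (conj a3 (conj a6 (conj a7 I)))).
Qed.

Lemma sep6 rho rho' : same_J 6 rho rho' ->
  pden rho (nfnz 6)%pexp != 0 ->
  agree_all rho rho' [:: 'c_1 ^+ 5 * 'c_5 ^+ 3; 'c_0 * 'c_5]%pexp.
Proof.
move=> J nz.
have j27 := J 27%N isT.
have j49 := J 49%N isT.
have a0 : agree rho rho' ('c_1 ^+ 5 * 'c_5 ^+ 3)%pexp.
  apply: (@agree_solve _ _ rho rho' [:: nfJp 6 27]%pexp
    (1%:z)%pexp
    (0%:z - 'c_0)%pexp _ _ _
    (conj j27 I)); [by vm_compute | solve_side nz].
have a1 : agree rho rho' ('c_0 * 'c_5)%pexp.
  apply: (@agree_solve _ _ rho rho' [:: 'c_1 ^+ 5 * 'c_5 ^+ 3; nfJp 6 49]%pexp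
    ('c_0 ^+ 2)%pexp
    (0%:z - 'c_1)%pexp _ _ _
    (conj a0 (conj j49 I))); [by vm_compute | solve_side nz].
exact: (conj a0 (conj a1 I)).
Qed.

(** Here the torus gives the parameters ['c_0] and ['c_1] the weights -3 and 4, so that the monomial
    found has weight 0. *)
Lemma sep7 rho rho' : same_J 7 rho rho' ->
  pden rho (nfnz 7)%pexp != 0 ->
  agree_all rho rho' [:: 'c_0 ^+ 4 * 'c_1 ^+ 3]%pexp.
Proof.
move=> J nz.
have j5 := J 5%N isT.
have a0 : agree rho rho' ('c_0 ^+ 4 * 'c_1 ^+ 3)%pexp.
  apply: (@agree_solve _ _ rho rho' [:: nfJp 7 5]%pexp
    (1%:z)%pexp
    (0%:z - 'c_0)%pexp _ _ _
    (conj j5 I)); [by vm_compute | solve_side nz].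
exact: (conj a0 I).
Qed.

End CoordinatesFromInvariants.

(** * The action of SL2 on coordinates *)

Section SL2Action.
Variables (k : closedFieldType) (hk : [pchar k] =i pred0).
Implicit Types (rho c : nat -> k) (F G : {mpoly k[2]}) (M : 'M[k]_2).

Definition mx2 (m00 m01 m10 m11 : k) : 'M[k]_2 :=
  \matrix_(i, j) if i == 0 then if j == 0 then m00 else m01 else if j == 0 then m10 else
      m11.

Lemma det_mx2E m00 m01 m10 m11 : \det (mx2 m00 m01 m10 m11) = m00 * m11 - m01 * m10.
Proof. by rewrite det2 !mxE. Qed.

Definition sl2_equiv F G F' G' :=
  exists2 M : 'M[k]_2, \det M = 1 & F' = act M F /\ G' = act M G.

Lemma sl2_equiv_refl F G : sl2_equiv F G F G.
Proof. by exists 1%:M; rewrite ?det1 ?act1. Qed.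

Lemma sl2_equiv_trans F G F' G' F'' G'' :
  sl2_equiv F G F' G' -> sl2_equiv F' G' F'' G'' -> sl2_equiv F G F'' G''.
Proof.
move=> [M dM [-> ->]] [N dN [-> ->]]; exists (M *m N).
  by rewrite det_mulmx dM dN mulr1.
by rewrite !act_comp.
Qed.

Lemma sl2_equiv_sym F G F' G' : sl2_equiv F G F' G' -> sl2_equiv F' G' F G.
Proof.
move=> [M dM [-> ->]]; have uM : M \in unitmx by rewrite unitmxE dM unitr1.
exists (invmx M); first by rewrite det_inv dM invr1.
by rewrite !act_comp mulmxV // !act1.
Qed.

Lemma sl2_equiv_J F G F' G' i : sl2_equiv F G F' G' -> Jinv F' G' i = Jinv F G i.
Proof. by move=> [M dM [-> ->]]; apply: Jinv_act. Qed.

Lemma bf_ext n c c' : (forall j, (j <= n)%N -> c j = c' j) -> bf n c = bf n c'.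
Proof. by move=> e; apply: eq_bigr => j _; rewrite e // -ltnS. Qed.

Lemma mpolyX_mxy a b : 'X_[mxy a b] = 'X_0 ^+ a * 'X_1 ^+ b :> {mpoly k[2]}.
Proof.
rewrite mpolyXE_id !big_ord_recl big_ord0 mulr1 mxy0 mxy1.
by congr ('X_ _ ^+ _ * 'X_ _ ^+ _); apply: val_inj.
Qed.

Lemma act_mxy M a b :
  act M 'X_[mxy a b] = (M 0 0 *: 'X_0 + M 0 1 *: 'X_1) ^+ a * (M 1 0 *: 'X_0 + M 1 1 *:
      'X_1) ^+ b.
Proof. by rewrite mpolyX_mxy actM !actX !act_var. Qed.

Lemma act_diag s t n c :
  act (mx2 s 0 0 t) (bf n c) = bf n (fun j => s ^+ (n - j) * t ^+ j * c j).
Proof.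
rewrite /act /bf linear_sum; apply: eq_bigr => j _ /=; rewrite comp_mpolyZ -/(act _ _).
rewrite act_mxy !mxE /= !scale0r addr0 add0r !exprZn -scalerAl -scalerAr !scalerA.
by rewrite -mpolyX_mxy; congr (_ *: _); ring.
Qed.

Lemma act_anti s t n c :
  act (mx2 0 s t 0) (bf n c) = bf n (fun j => s ^+ j * t ^+ (n - j) * c (n - j)%N).
Proof.
rewrite /bf [RHS](reindex_inj rev_ord_inj) /act linear_sum; apply: eq_bigr => j _ /=.
rewrite comp_mpolyZ -/(act _ _).
have jn : (j <= n)%N by rewrite -ltnS.
rewrite act_mxy !mxE /= !scale0r addr0 add0r !exprZn -scalerAl -scalerAr !scalerA.
by rewrite subSS subKn // mpolyX_mxy ['X_0 ^+ j * _]mulrC; congr (_ *: _); ring.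
Qed.

Definition qf c := bf 5 (fun j => 'C(5, j)%:R * c j).

Lemma qf_ext c c' : (forall j, (j <= 5)%N -> c j = c' j) -> qf c = qf c'.
Proof. by move=> e; apply: bf_ext => j j5; rewrite e. Qed.

Lemma qf_diag s t c : act (mx2 s 0 0 t) (qf c) = qf (fun j => s ^+ (5 - j) * t ^+ j * c
    j).
Proof. by rewrite act_diag; apply: bf_ext => j _; rewrite mulrCA. Qed.

Lemma qf_anti s t c :
  act (mx2 0 s t 0) (qf c) = qf (fun j => s ^+ j * t ^+ (5 - j) * c (5 - j)%N).
Proof. by rewrite act_anti; apply: bf_ext => j j5; rewrite bin_sub // mulrCA. Qed.

Lemma nfF_qf rho t : sform rho 5 (nfF t) = qf (fun j => pden rho (nth (PC Z0) (nfc t) j)).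
Proof.
apply: bf_ext => j j5; rewrite (nth_map 0%N) ?size_iota // nth_iota //=.
by rewrite zk_nat.
Qed.

Definition same_inv rho rho' t := forall i, (i < 50)%N ->
  Jinv (sform rho 5 (nfF t)) (sform rho 3 (nfG t)) i =
  Jinv (sform rho' 5 (nfF t)) (sform rho' 3 (nfG t)) i.

Definition nequiv rho rho' t :=
  sl2_equiv (sform rho 5 (nfF t)) (sform rho 3 (nfG t))
        (sform rho' 5 (nfF t)) (sform rho' 3 (nfG t)).

Lemma same_inv_equiv rho rho'' rho' t : nequiv rho rho'' t ->
  same_inv rho rho' t -> same_inv rho'' rho' t.
Proof. by move=> e h i i50; rewrite (sl2_equiv_J i e) h. Qed.

Lemma root_exists n (a : k) : (0 < n)%N -> exists x : k, x ^+ n = a.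
Proof.
move=> n0; have [x hx] := @solve_monicpoly k n (fun i => if i == 0%N then a else 0) n0.
exists x; rewrite hx; case: n n0 {hx} => // n _.
by rewrite big_ord_recl /= expr0 mulr1 big1 ?addr0 // => i _; rewrite mul0r.
Qed.

(* A map T realised by the group multiplies the value of v by - iota, so that
   fourth roots of unity can be removed from that value. *)
Lemma twist_exists t (v : pexp 7) (iota : k) (T : (nat -> k) -> nat -> k) :
  iota ^+ 2 = -1 -> (forall rho, nequiv rho (T rho) t) ->
  (forall rho, pden (T rho) v = - iota * pden rho v) ->
  forall rho rho', pden rho v ^+ 4 = pden rho' v ^+ 4 -> pden rho v != 0 ->
  exists2 rho'', nequiv rho rho'' t & pden rho'' v = pden rho' v.
Proof.
move=> i2 hT hv rho rho' e4 v0.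
have hn n : nequiv rho (iter n T rho) t /\ pden (iter n T rho) v = (- iota) ^+ n * pden
    rho v.
  elim: n => [|n [IHe IHv]]; first by split; [apply: sl2_equiv_refl | rewrite expr0
      mul1r].
  split; first by rewrite iterS; apply: sl2_equiv_trans IHe (hT _).
  by rewrite iterS hv IHv mulrA exprS.
have [n en] : exists n, (- iota) ^+ n * pden rho v = pden rho' v.
  set a := pden rho v in e4 v0 *; set b := pden rho' v in e4 *.
  (* The factorization of a^4 - b^4 over the fourth roots of unity; each factor determines how often
     T is applied. *)
  have : (a - b) * (a + b) * ((iota * a - b) * (iota * a + b)) = 0.
    have -> : (a - b) * (a + b) * ((iota * a - b) * (iota * a + b)) =
      (a ^+ 2 - b ^+ 2) * (iota ^+ 2 * a ^+ 2 - b ^+ 2) by ring.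
    rewrite i2 (_ : _ * _ = b ^+ 4 - a ^+ 4); last by ring.
    by rewrite e4 subrr.
  move/eqP; rewrite !mulf_eq0 !subr_eq0 !addr_eq0 => /orP[/orP[]|/orP[]] /eqP e.
  - by exists 0%N; rewrite expr0 mul1r.
  - by exists 2%N; rewrite sqrrN i2 e mulN1r opprK.
  - exists 3%N; rewrite exprS sqrrN i2 -e; ring.
  - exists 1%N; rewrite expr1 mulNr e opprK //.
by have [h1 h2] := hn n; exists (iter n T rho) => //; rewrite h2.
Qed.

End SL2Action.

(** * Uniqueness of normal forms *)

Section NormalFormUniqueness.
Variables (k : closedFieldType) (hk : [pchar k] =i pred0).
Implicit Types (rho c : nat -> k) (F G : {mpoly k[2]}) (M : 'M[k]_2).

Lemma zk0 : zk k 0 = 0. Proof. by []. Qed.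
Lemma zk1 : zk k 1 = 1. Proof. by []. Qed.

Lemma nz_agree t rho rho' : (t < 8)%N -> same_inv rho rho' t ->
  pden rho (nfnz t) ^+ nfexp t = pden rho' (nfnz t) ^+ nfexp t.
Proof.
move=> t8 h; apply: (Jinv_known hk (nf_detect t8)); apply: h.
by move: t t8; do 8! case=> //.
Qed.

(* The weights of the diagonal element diag(w, w^2) with w^3 = 1 on c_0, c_3 and
   on c_2, c_5. *)
Lemma cube_root_orbit (x y z w x' y' z' w' : k) :
  x ^+ 3 = x' ^+ 3 -> x ^+ 2 * y = x' ^+ 2 * y' -> y ^+ 3 = y' ^+ 3 ->
  z ^+ 3 = z' ^+ 3 -> z ^+ 2 * w = z' ^+ 2 * w' -> w ^+ 3 = w' ^+ 3 ->
  x * z = x' * z' -> x * w = x' * w' -> y * z = y' * z' -> y * w = y' * w' ->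
  exists2 o : k, o ^+ 3 = 1 &
    [/\ x' = o ^+ 2 * x, y' = o ^+ 2 * y, z' = o * z & w' = o * w].
Proof.
have cube0 (a b : k) : a ^+ 3 = b ^+ 3 -> a = 0 -> b = 0.
  by move=> e a0; apply/eqP; have := expf_eq0 b 3; rewrite -e a0 expr0n eqxx /= => /esym
      ->.
have cubeN0 (a b : k) : a ^+ 3 = b ^+ 3 -> a != 0 -> b != 0.
  by move=> e; apply: contra_neq; exact: cube0 (esym e).
move=> x3 xxy y3 z3 zzw w3 xz xw yz yw.
have [x0|x0] := eqVneq x 0; last first.
  have x0' := cubeN0 _ _ x3 x0.
  (* x has weight o^2, the inverse of o, hence the quotient in this direction; the first nonzero
     coordinate determines o. *)
  exists (x / x'); first by rewrite expr_div_n x3 divff // expf_neq0.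
  have o2 : (x / x') ^+ 2 = x' / x.
    apply: (mulfI (expf_neq0 2 x0')); rewrite -exprMn mulrCA divff // mulr1.
    by apply: (mulIf x0); rewrite mulrA divfK // -!exprSr x3.
  split; first by rewrite o2 divfK.
  - apply: (mulfI (expf_neq0 2 x0')); rewrite -xxy mulrA -exprMn mulrCA divff //.
    by rewrite mulr1.
  - by apply: (mulfI x0'); rewrite -xz mulrA mulrCA divff // mulr1.
  - by apply: (mulfI x0'); rewrite -xw mulrA mulrCA divff // mulr1.
have x0' := cube0 _ _ x3 x0; subst x x'.
have [y0|y0] := eqVneq y 0; last first.
  have y0' := cubeN0 _ _ y3 y0.
  exists (y / y'); first by rewrite expr_div_n y3 divff // expf_neq0.
  have o2 : (y / y') ^+ 2 = y' / y.
    apply: (mulfI (expf_neq0 2 y0')); rewrite -exprMn mulrCA divff // mulr1.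
    by apply: (mulIf y0); rewrite mulrA divfK // -!exprSr y3.
  split; rewrite ?mulr0 //; first by rewrite o2 divfK.
  - by apply: (mulfI y0'); rewrite -yz mulrA mulrCA divff // mulr1.
  - by apply: (mulfI y0'); rewrite -yw mulrA mulrCA divff // mulr1.
have y0' := cube0 _ _ y3 y0; subst y y'.
have [z0|z0] := eqVneq z 0; last first.
  have z0' := cubeN0 _ _ z3 z0.
  (* z has weight o, so the quotient is taken the other way. *)
  exists (z' / z); first by rewrite expr_div_n z3 divff // expf_neq0.
  split; rewrite ?mulr0 //; first by rewrite divfK.
  apply: (mulfI (expf_neq0 2 z0')); rewrite -zzw !mulrA.
  by rewrite -exprSr -z3 (exprSr z 2) mulfK.
have z0' := cube0 _ _ z3 z0; subst z z'.
have [w0|w0] := eqVneq w 0; last first.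
  have w0' := cubeN0 _ _ w3 w0.
  exists (w' / w); first by rewrite expr_div_n w3 divff // expf_neq0.
  by split; rewrite ?mulr0 // divfK.
have w0' := cube0 _ _ w3 w0; subst w w'.
by exists 1; rewrite ?expr1n // !mulr0.
Qed.

Lemma cube_root_neq0 (o : k) : o ^+ 3 = 1 -> o != 0.
Proof. by move=> o3; have := oner_neq0 k; rewrite -o3; apply: contra_neq => ->; rewrite
    expr0n. Qed.

Lemma qf_mu3 o c : o ^+ 3 = 1 -> act (mx2 o 0 0 (o ^+ 2)) (qf c) =
  qf (fun j => nth 1 [:: o ^+ 2; 1; o; o ^+ 2; 1; o] j * c j).
Proof.
move=> o3; have e m : o ^+ (3 + m) = o ^+ m by rewrite exprD o3 mul1r.
rewrite qf_diag; apply: qf_ext => j j5; rewrite -exprM -exprD; congr (_ * _).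
case: j j5 => [|[|[|[|[|[|//]]]]]] _ /=.
- exact: (e 2).
- exact: (etrans (e 3) o3).
- by rewrite [LHS](e 4) (e 1%N) expr1.
- by rewrite [LHS](e 5) (e 2).
- by rewrite [LHS](e 6) (e 3).
- by rewrite [LHS](e 7) (e 4) (e 1%N) expr1.
Qed.

Lemma det_mu3 (o : k) : o ^+ 3 = 1 -> \det (mx2 o 0 0 (o ^+ 2)) = 1.
Proof. by move=> o3; rewrite det_mx2E mulr0 subr0 -exprS. Qed.

Lemma mu3_equiv o c c' n g g' : o ^+ 3 = 1 ->
  (forall j, (j <= 5)%N -> c' j = nth 1 [:: o ^+ 2; 1; o; o ^+ 2; 1; o] j * c j) ->
  (forall j, (j <= n)%N -> g' j = o ^+ (n - j) * (o ^+ 2) ^+ j * g j) ->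
  sl2_equiv (qf c) (bf n g) (qf c') (bf n g').
Proof.
move=> o3 ec eg; exists (mx2 o 0 0 (o ^+ 2)); first exact: det_mu3.
by rewrite qf_mu3 // act_diag (qf_ext ec) (bf_ext eg).
Qed.

Lemma nfG_const t rho rho' : (0 < t < 8)%N -> sform rho 3 (nfG t) = sform rho' 3 (nfG t).
Proof.
move=> t8; apply: bf_ext => j j3.
by case: t t8 => [|[|[|[|[|[|[|[|//]]]]]]]] // _; case: j j3 => [|[|[|[|//]]]].
Qed.

Lemma uniq1 rho rho' : pden rho (nfnz 1) != 0 -> same_inv rho rho' 1 -> nequiv rho rho' 1.
Proof.
move=> nz h; have [k0 [k1 [k2 [k3 [k4 [k5 _]]]]]] := sep1 hk (@same_JP _ hk 1 rho rho'
    isT h) nz.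
rewrite /nequiv !nfF_qf.
rewrite (@nfG_const 1 rho rho') //.
suff -> : qf (fun j => pden rho (nth (PC Z0) (nfc 1) j)) =
           qf (fun j => pden rho' (nth (PC Z0) (nfc 1) j)) by exact: sl2_equiv_refl.
by apply: qf_ext => -[|[|[|[|[|[|//]]]]]].
Qed.

Lemma uniq2 rho rho' : pden rho (nfnz 2) != 0 -> same_inv rho rho' 2 -> nequiv rho rho' 2.
Proof.
move=> nz h; have [k0 [k1 [k2 [k3 [k4 _]]]]] := sep2 hk (@same_JP _ hk 2 rho rho' isT h)
    nz.
rewrite /nequiv !nfF_qf.
rewrite (@nfG_const 2 rho rho') //.
suff -> : qf (fun j => pden rho (nth (PC Z0) (nfc 2) j)) =
           qf (fun j => pden rho' (nth (PC Z0) (nfc 2) j)) by exact: sl2_equiv_refl.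
by apply: qf_ext => -[|[|[|[|[|[|//]]]]]].
Qed.

Lemma uniq3 rho rho' : pden rho (nfnz 3) != 0 -> same_inv rho rho' 3 -> nequiv rho rho' 3.
Proof.
move=> nz h; have /= c5 := @nz_agree 3 _ _ isT h.
(* The cube root of unity by which the two values of c_5 differ is removed by moving rho along
   diag(o, o^2). *)
have [o o3 eo] : exists2 o : k, o ^+ 3 = 1 & rho' 5 = o * rho 5.
  exists (rho' 5 / rho 5); first by rewrite expr_div_n c5 divff // -c5 expf_neq0.
  by rewrite divfK.
pose rho1 j := nth 1 [:: o ^+ 2; 1; o; o ^+ 2; 1; o] j * rho j.
have e1 : nequiv rho rho1 3.
  rewrite /nequiv !nfF_qf; apply: (mu3_equiv o3).
    by case=> [|[|[|[|[|[|//]]]]]] _ /=; rewrite ?zk0 ?mulr0.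
  by case=> [|[|[|[|//]]]] _ /=; rewrite ?zk0 ?mulr0 // zk1 o3 expr0 !mulr1.
apply: (sl2_equiv_trans e1).
have h1 := same_inv_equiv e1 h.
have a5 : agree rho1 rho' 'c_5%pexp by rewrite /agree /= eo.
have nz1 : pden rho1 (nfnz 3) != 0.
  exact: mulf_neq0 (cube_root_neq0 o3) nz.
have [k0 [k1 [k2 [k3 _]]]] := sep3 (@same_JP _ hk 3 rho1 rho' isT h1) a5 nz1.
rewrite !nfF_qf.
rewrite (@nfG_const 3 rho1 rho') //.
suff -> : qf (fun j => pden rho1 (nth (PC Z0) (nfc 3) j)) =
           qf (fun j => pden rho' (nth (PC Z0) (nfc 3) j)) by exact: sl2_equiv_refl.
by apply: qf_ext => -[|[|[|[|[|[|//]]]]]].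
Qed.

Lemma uniq4 rho rho' : pden rho (nfnz 4) != 0 -> same_inv rho rho' 4 -> nequiv rho rho' 4.
Proof.
move=> nz h; have [/= c4 [/= c1 [/= c2 [/= c02 [/= c0 _]]]]] := sep4 hk (@same_JP _ hk 4
    rho rho' isT h) nz.
(* Only c_0 and c_2 are in doubt here; zeros fill the two other slots. *)
have [||||||||||o o3 [e0 _ e2 _]] := @cube_root_orbit (rho 0) 0 (rho 2) 0 (rho' 0) 0
    (rho' 2) 0;
  rewrite ?mulr0 ?mul0r ?expr0n //.
rewrite /nequiv !nfF_qf; apply: (mu3_equiv o3).
  case=> [|[|[|[|[|[|//]]]]]] _ /=; rewrite ?zk0 ?mulr0 ?mul1r //.
by case=> [|[|[|[|//]]]] _ /=; rewrite ?zk0 ?mulr0 // zk1 o3 expr0 !mulr1.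
Qed.

Lemma uniq0 rho rho' : pden rho (nfnz 0) != 0 -> pden rho' (nfnz 0) != 0 ->
  same_inv rho rho' 0 -> nequiv rho rho' 0.
Proof.
move=> nz nz' h; have a4 := @nz_agree 0 _ _ isT h.
have [iota i2] := @root_exists k 2 (-1) isT.
(* The exchange of x and y, scaled by iota to have determinant 1: it multiplies the quintic by
   iota^5 = iota and the cubic by iota^3 = - iota. Index 6 is the coefficient a of G. *)
pose T (r : nat -> k) j := if (j < 6)%N then iota * r (5 - j)%N else - iota * r j.
have [||rho1 e1 a1] := @twist_exists k 0 'c_6%pexp iota T i2 _ _ rho rho' a4 nz => //.
  move=> r; exists (mx2 0 iota iota 0); first by rewrite det_mx2E mulr0 sub0r -expr2 i2
      opprK.
  split.
    rewrite !nfF_qf qf_anti; apply: qf_ext => j j5.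
    rewrite -exprD subnKC // (exprD _ 4 1) (exprM _ 2 2) i2 sqrrN expr1n mul1r expr1.
    by case: j j5 => [|[|[|[|[|[|//]]]]]].
  rewrite act_anti; apply: bf_ext => j j3; rewrite -exprD subnKC // exprS i2 mulrN1.
  by case: j j3 => [|[|[|[|//]]]] _ /=; rewrite ?zk0 ?mulr0.
apply: (sl2_equiv_trans e1); have h1 := same_inv_equiv e1 h.
have nz1 : pden rho1 (nfnz 0) != 0 by rewrite a1.
have /= [c1 [c4 [c02 [c05 [c23 [c35 [c3 [c2 [c225 [c330 [c552 [c003 [c5 [c0
    _]]]]]]]]]]]]]] :=
  sep0 hk (@same_JP _ hk 0 rho1 rho' isT h1) a1 nz1.
have [||||||||||o o3 [e0 e3 e2 e5]] := @cube_root_orbit (rho1 0) (rho1 3) (rho1 2) (rho1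
    5)
  (rho' 0) (rho' 3) (rho' 2) (rho' 5) => //.
  by rewrite ![rho1 3 * _]mulrC ![rho' 3 * _]mulrC.
rewrite !nfF_qf; apply: (mu3_equiv o3).
  by case=> [|[|[|[|[|[|//]]]]]] _ /=; rewrite ?mul1r.
have o23 : (o ^+ 2) ^+ 3 = 1 by rewrite -exprM (exprM o 3 2) o3 expr1n.
by case=> [|[|[|[|//]]]] _ /=; rewrite ?zk0 ?mulr0 ?o3 ?o23 ?expr0 ?mulr1 ?mul1r.
Qed.

Lemma nfG0 t rho : (4 < t < 8)%N -> sform rho 3 (nfG t) = 0.
Proof.
move=> t8; apply: big1 => j _; rewrite (_ : pden _ _ = 0) ?scale0r //.
by case: t t8 => [|[|[|[|[|[|[|[|//]]]]]]]] // _; rewrite nth_nil.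
Qed.

Lemma equiv_noG t rho rho' M : (4 < t < 8)%N -> \det M = 1 ->
  sform rho' 5 (nfF t) = act M (sform rho 5 (nfF t)) -> nequiv rho rho' t.
Proof.
by move=> t8 dM e; exists M; rewrite // !nfG0 // /act comp_mpoly0.
Qed.

Lemma uniq5 rho rho' : pden rho (nfnz 5) != 0 -> pden rho' (nfnz 5) != 0 ->
  same_inv rho rho' 5 -> nequiv rho rho' 5.
Proof.
move=> nz nz' h; have a4 := @nz_agree 5 _ _ isT h.
have [iota i2] := @root_exists k 2 (-1) isT.
(* The same exchange; form 5 only reads the indices 0, 1 and 2, which keeps the truncated 2 - j
   harmless. *)
pose T (r : nat -> k) j := iota * r (2 - j)%N.
have [||rho1 e1 a1] := @twist_exists k 5 (nfnz 5) iota T i2 _ _ rho rho' a4 nz.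
- move=> r; apply: (@equiv_noG _ _ _ (mx2 0 iota iota 0)) => //.
    by rewrite det_mx2E mulr0 sub0r -expr2 i2 opprK.
  rewrite !nfF_qf qf_anti; apply: qf_ext => j j5.
  rewrite -exprD subnKC // (exprD _ 4 1) (exprM _ 2 2) i2 sqrrN expr1n mul1r expr1.
  by case: j j5 => [|[|[|[|[|[|//]]]]]].
- move=> r; have -> : - iota = iota ^+ 3 by rewrite exprS i2 mulrN1.
  by rewrite /= /T /=; ring.
apply: (sl2_equiv_trans e1); have h1 := same_inv_equiv e1 h.
have nz1 : pden rho1 (nfnz 5) != 0 by rewrite a1.
have [/= c1 [/= c02 [/= c0 [/= c2 _]]]] := sep5 hk (@same_JP _ hk 5 rho1 rho' isT h1) a1
    nz1.
have [||||||||||o o3 [e0 _ e2 _]] := @cube_root_orbit (rho1 0) 0 (rho1 2) 0 (rho' 0) 0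
    (rho' 2) 0;
  rewrite ?mulr0 ?mul0r ?expr0n //.
apply: (@equiv_noG _ _ _ (mx2 o 0 0 (o ^+ 2))) => //; first exact: det_mu3.
rewrite !nfF_qf qf_mu3 //; apply: qf_ext.
by case=> [|[|[|[|[|[|//]]]]]] _ /=; rewrite ?mul1r.
Qed.

Lemma torus_equiv t rho rho' s : (4 < t < 8)%N -> s != 0 ->
  (forall j, (j <= 5)%N -> pden rho' (nth (PC Z0) (nfc t) j) =
     s ^+ (5 - j) * s^-1 ^+ j * pden rho (nth (PC Z0) (nfc t) j)) -> nequiv rho rho' t.
Proof.
move=> t8 s0 e; apply: (@equiv_noG _ _ _ (mx2 s 0 0 s^-1)) => //.
  by rewrite det_mx2E mulr0 subr0 divff.
by rewrite !nfF_qf qf_diag; apply: qf_ext.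
Qed.

Lemma uniq6 rho rho' : pden rho (nfnz 6) != 0 -> pden rho' (nfnz 6) != 0 ->
  same_inv rho rho' 6 -> nequiv rho rho' 6.
Proof.
move=> nz nz' h.
have [/= E [/= c05 _]] := sep6 hk (@same_JP _ hk 6 rho rho' isT h) nz.
rewrite /agree /= in E c05.
move: nz; rewrite /= mulf_eq0 !expf_eq0 /= negb_or => /andP[c1 c5].
move: nz'; rewrite /= mulf_eq0 !expf_eq0 /= negb_or => /andP[c1' c5'].
set X := rho' 1 / rho 1; set Y := rho' 5 / rho 5.
have eX : rho' 1 = X * rho 1 by rewrite divfK.
have eY : rho' 5 = Y * rho 5 by rewrite divfK.
have XY : X ^+ 5 * Y ^+ 3 = 1.
  apply: (mulIf (mulf_neq0 (expf_neq0 5 c1) (expf_neq0 3 c5))).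
  by rewrite mul1r [RHS]E eX eY; ring.
have X0 : X != 0 by rewrite mulf_neq0 ?invr_eq0.
have Y0 : Y != 0 by rewrite mulf_neq0 ?invr_eq0.
(* The torus has to satisfy s^3 = X and s^-5 = Y; as 2 * 3 - 5 = 1, this forces s = X^2 Y. *)
pose s := X ^+ 2 * Y.
have s0 : s != 0 by rewrite mulf_neq0 ?expf_neq0.
have s3 : s ^+ 3 = X.
  by have -> : s ^+ 3 = X * (X ^+ 5 * Y ^+ 3); [rewrite /s; ring | rewrite XY mulr1].
have s5 : s ^+ 5 * Y = 1.
  by have -> : s ^+ 5 * Y = (X ^+ 5 * Y ^+ 3) ^+ 2; [rewrite /s; ring | rewrite XY
      expr1n].
apply: (torus_equiv _ s0) => //.
case=> [|[|[|[|[|[|//]]]]]] _ /=; rewrite ?zk0 ?mulr0 // ?expr0 ?mulr1 ?mul1r.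
- apply: (mulIf c5'); rewrite -c05 eY -[LHS]mul1r -s5; ring.
- rewrite -[rho' 1]/(rho' 1%N) eX -s3; congr (_ * _).
  by rewrite expr1 [s ^+ 4]exprSr mulfK.
- by rewrite exprVn eY; congr (_ * _); apply: (mulfI (expf_neq0 5 s0)); rewrite s5 divff
    ?expf_neq0.
Qed.

Lemma uniq7 rho rho' : pden rho (nfnz 7) != 0 -> pden rho' (nfnz 7) != 0 ->
  same_inv rho rho' 7 -> nequiv rho rho' 7.
Proof.
move=> nz nz' h.
have [/= E _] := sep7 hk (@same_JP _ hk 7 rho rho' isT h) nz.
rewrite /agree /= in E.
move: nz; rewrite /= mulf_eq0 !expf_eq0 /= negb_or => /andP[p r].
move: nz'; rewrite /= mulf_eq0 !expf_eq0 /= negb_or => /andP[p' r'].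
set X := rho' 0 / rho 0; set Y := rho' 1 / rho 1.
have eX : rho' 0 = X * rho 0 by rewrite divfK.
have eY : rho' 1 = Y * rho 1 by rewrite divfK.
have XY : X ^+ 4 * Y ^+ 3 = 1.
  apply: (mulIf (mulf_neq0 (expf_neq0 4 p) (expf_neq0 3 r))).
  by rewrite mul1r [RHS]E eX eY; ring.
have XY0 : X * Y != 0 by rewrite !mulf_neq0 ?invr_eq0.
(* The coefficient c_2 = ['c_0 * 'c_1] has torus weight 1 and is multiplied by X Y. *)
pose s := X * Y.
have sX : s^-1 ^+ 3 = X.
  apply: (mulIf (expf_neq0 3 XY0)); rewrite -exprMn mulVf // expr1n -XY; ring.
have sXY : s^-1 * (X * Y) = 1 by rewrite mulVf.
apply: (torus_equiv _ XY0) => //.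
case=> [|[|[|[|[|[|//]]]]]] _ /=; rewrite ?zk0 ?mulr0 // ?expr0 ?mulr1 ?mul1r.
- have -> : (X * Y) ^+ 5 = X * Y ^+ 2 * (X ^+ 4 * Y ^+ 3) by ring.
  by rewrite XY mulr1 eX eY; ring.
- have -> : (X * Y) ^+ 3 * s^-1 ^+ 2 = (s^-1 * (X * Y)) ^+ 2 * (X * Y) by ring.
  by rewrite sXY expr1n mul1r eX eY; ring.
- by rewrite eX exprSr sX expr1 mulrCA divff // mulr1.
Qed.

Theorem nf_unique t rho rho' : (t < 8)%N ->
  pden rho (nfnz t) != 0 -> pden rho' (nfnz t) != 0 ->
  same_inv rho rho' t -> nequiv rho rho' t.
Proof.
case: t => [|[|[|[|[|[|[|[|//]]]]]]]] _ nz nz'.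
- exact: uniq0.
- exact: uniq1.
- exact: uniq2.
- exact: uniq3.
- exact: uniq4.
- exact: uniq5.
- exact: uniq6.
- exact: uniq7.
Qed.

End NormalFormUniqueness.

(** * Normal forms of cubics *)

Section CubicNormalForms.
Variables (k : closedFieldType) (hk : [pchar k] =i pred0).
Implicit Types (rho c g : nat -> k) (F G : {mpoly k[2]}) (M : 'M[k]_2).

Lemma bf_coef n c j : (j <= n)%N -> (bf n c)@_(mxy (n - j) j) = c j.
Proof.
move=> jn; rewrite /bf raddf_sum (bigD1 (Ordinal (jn : (j < n.+1)%N))) //=.
rewrite mcoeffZ mcoeffX eqxx mulr1 big1 ?addr0 // => i ne_ij.
rewrite mcoeffZ mcoeffX; case: eqP => [e|_]; last by rewrite mulr0.
case/eqP: ne_ij; apply: val_inj => /=.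
by have := congr1 (fun m : 'X_{1..2} => m (lift ord0 ord0)) e; rewrite !mxy1.
Qed.

Lemma bf_inj n c c' : bf n c = bf n c' -> forall j, (j <= n)%N -> c j = c' j.
Proof. by move=> e j jn; rewrite -(bf_coef c jn) e bf_coef. Qed.

Lemma bf0 n : bf n (fun _ => 0 : k) = 0.
Proof. by apply: big1 => j _; rewrite scale0r. Qed.

Lemma homog_bf n F : F \is n.-homog -> F = bf n (fun j => F@_(mxy (n - j) j)).
Proof.
move=> hF; apply/mpolyP => m.
have [dm|dm] := eqVneq (mdeg m) n; last first.
  rewrite (dhomog_nemf_coeff hF dm) /bf raddf_sum big1 // => j _ /=.
  rewrite mcoeffZ mcoeffX; case: eqP => [e|_]; last by rewrite mulr0.
  case/eqP: dm; rewrite -e mdegE !big_ord_recl big_ord0 mxy0 mxy1 addn0 subnK //.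
  by rewrite -ltnS.
have em : m = mxy (n - m (lift ord0 ord0)) (m (lift ord0 ord0)).
  by rewrite [LHS]mxy_eq -dm mdegE !big_ord_recl big_ord0 addn0 addnK.
rewrite em bf_coef // -dm mdegE !big_ord_recl big_ord0 addn0; exact: leq_addl.
Qed.

Lemma mpolyXU_homog i : ('X_i : {mpoly k[2]}) \is 1.-homog.
Proof. by rewrite dhomogX; apply/eqP/mdeg1. Qed.

Lemma bf_homog n c : bf n c \is n.-homog.
Proof.
apply: rpred_sum => j _; apply: dhomogZ; rewrite dhomogX; apply/eqP.
by rewrite /= mdegE !big_ord_recl big_ord0 mxy0 mxy1 addn0 subnK // -ltnS.
Qed.

Lemma act_homog M n F : F \is n.-homog -> act M F \is n.-homog.
Proof.
move=> /homog_bf ->; rewrite /act /bf linear_sum; apply: rpred_sum => j _ /=.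
rewrite comp_mpolyZ -/(act _ _); apply: dhomogZ; rewrite act_mxy.
have jn : (j <= n)%N by rewrite -ltnS.
rewrite -[n in n.-homog](subnK jn); apply: dhomogM.
  by rewrite -[X in X.-homog]mul1n; apply: dhomogMn; apply: rpredD; apply: dhomogZ;
      apply: mpolyXU_homog.
by rewrite -[X in X.-homog]mul1n; apply: dhomogMn; apply: rpredD; apply: dhomogZ; apply:
    mpolyXU_homog.
Qed.

Lemma homog_qf F : F \is 5.-homog -> exists c, F = qf c.
Proof.
move=> hF; exists (fun j => 'C(5, j)%:R^-1 * F@_(mxy (5 - j) j)).
rewrite {1}(homog_bf hF); apply: bf_ext => j j5; rewrite mulrA divff ?mul1r //.
by rewrite natr0_eq0 // -lt0n bin_gt0.
Qed.

Lemma bin5E : ('C(5, 0) = 1) * ('C(5, 1) = 5) * ('C(5, 2) = 10) * ('C(5, 3) = 10) *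
  ('C(5, 4) = 5) * ('C(5, 5) = 1).
Proof. by []. Qed.

(* The coefficients after the substitution y -> u x + y. *)
Definition sheared u c j := nth 0
  [:: c 0 + 5%:R * u * c 1 + 10%:R * u ^+ 2 * c 2 + 10%:R * u ^+ 3 * c 3 + 5%:R * u ^+ 4
      * c 4 + u ^+ 5 * c 5;
      c 1 + 4%:R * u * c 2 + 6%:R * u ^+ 2 * c 3 + 4%:R * u ^+ 3 * c 4 + u ^+ 4 * c 5;
      c 2 + 3%:R * u * c 3 + 3%:R * u ^+ 2 * c 4 + u ^+ 3 * c 5;
      c 3 + 2%:R * u * c 4 + u ^+ 2 * c 5;
      c 4 + u * c 5; c 5] j.

Lemma qf_shear u c : act (mx2 1 0 u 1) (qf c) = qf (sheared u c).
Proof.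
rewrite /qf /bf /sheared !big_ord_recr !big_ord0 /= !add0r !bin5E !actD !actZ !act_mxy
    !mxE /= !mpolyX_mxy.
rewrite -!mul_mpolyC; ring.
Qed.

Lemma cubic_shear u g : act (mx2 1 0 u 1) (bf 3 g) = bf 3 (fun j => nth 0
  [:: g 0 + u * g 1 + u ^+ 2 * g 2 + u ^+ 3 * g 3;
      g 1 + 2%:R * u * g 2 + 3%:R * u ^+ 2 * g 3;
      g 2 + 3%:R * u * g 3; g 3] j).
Proof.
rewrite /bf !big_ord_recr !big_ord0 /= !add0r !actD !actZ !act_mxy !mxE /= !mpolyX_mxy.
rewrite -!mul_mpolyC; ring.
Qed.

Definition reach F F' := exists2 M : 'M[k]_2, \det M = 1 & act M F = F'.

Lemma reach_refl F : reach F F.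
Proof. by exists 1%:M; rewrite ?det1 ?act1. Qed.

Lemma reach_trans F F' F'' : reach F F' -> reach F' F'' -> reach F F''.
Proof.
move=> [M dM <-] [N dN <-]; exists (M *m N); last by rewrite act_comp.
by rewrite det_mulmx dM dN mulr1.
Qed.

Lemma reach_sym F F' : reach F F' -> reach F' F.
Proof.
move=> [M dM <-]; have uM : M \in unitmx by rewrite unitmxE dM unitr1.
by exists (invmx M); rewrite ?det_inv ?dM ?invr1 // act_comp mulmxV // act1.
Qed.

Lemma reach_shear_det (u : k) : \det (mx2 1 0 u 1) = 1.
Proof. by rewrite det_mx2E mul0r subr0 mulr1. Qed.

Lemma swap_det : \det (mx2 0 1 (-1) 0 : 'M[k]_2) = 1.
Proof. by rewrite det_mx2E mulr0 mul1r sub0r opprK. Qed.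

Lemma torus_det (s : k) : s != 0 -> \det (mx2 s 0 0 s^-1) = 1.
Proof. by move=> s0; rewrite det_mx2E mulr0 subr0 divff. Qed.

Lemma poly_root n (p : nat -> k) : (0 < n)%N -> p n != 0 ->
  exists u, \sum_(i < n.+1) p i * u ^+ i = 0.
Proof.
move=> n0 pn; have [u hu] := @solve_monicpoly k n (fun i => - (p i / p n)) n0.
exists u; rewrite big_ord_recr /= hu mulr_sumr -big_split big1 // => i _ /=.
by rewrite mulrA mulrN mulrCA divff // mulr1 mulNr subrr.
Qed.

Definition cb (s : seq k) := bf 3 (fun j => nth 0 s j).

Lemma bf_cb g : bf 3 g = cb [:: g 0; g 1; g 2; g 3].
Proof. by apply: bf_ext => -[|[|[|[|//]]]]. Qed.

Lemma cb_shear (u a b c d : k) : reach (cb [:: a; b; c; d])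
  (cb [:: a + u * b + u ^+ 2 * c + u ^+ 3 * d; b + 2%:R * u * c + 3%:R * u ^+ 2 * d;
      c + 3%:R * u * d; d]).
Proof. by exists (mx2 1 0 u 1); rewrite ?reach_shear_det // /cb cubic_shear. Qed.

Lemma cb_swap (a b c d : k) : reach (cb [:: a; b; c; d]) (cb [:: - d; c; - b; a]).
Proof.
exists (mx2 0 1 (-1) 0); first exact: swap_det.
rewrite /cb act_anti; apply: bf_ext => -[|[|[|[|//]]]] _ /=;
  rewrite expr1n mul1r ?expr0 ?expr1 ?sqrrN ?expr1n ?mul1r // ?mulN1r //.
by rewrite exprS sqrrN expr1n mulr1 mulN1r.
Qed.

Lemma cb_torus (s a b c d : k) : s != 0 -> reach (cb [:: a; b; c; d])
  (cb [:: s ^+ 3 * a; s * b; s^-1 * c; s^-1 ^+ 3 * d]).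
Proof.
move=> s0; exists (mx2 s 0 0 s^-1); first exact: torus_det.
rewrite /cb act_diag; apply: bf_ext => -[|[|[|[|//]]]] _ /=.
- by rewrite expr0 mulr1.
- by rewrite expr1 (exprSr s 1) mulfK.
- by rewrite expr1 (exprSr _ 1) mulrA divff // mul1r.
- by rewrite expr0 mul1r.
Qed.

(** The sum of the cubes of al x + be y and al x - be y is x times a diagonal quadratic form; read
    backwards, it brings such a cubic to a (x^3 + y^3). *)
Lemma two_cubes (al be a : k) :
  act (mx2 al be al (- be)) (cb [:: a; 0; 0; a]) =
  cb [:: 2%:R * a * al ^+ 3; 0; 6%:R * a * al * be ^+ 2; 0].
Proof.
rewrite /cb /bf !big_ord_recr !big_ord0 /= !add0r !actD !actZ !act_mxy !mxE /=
    !mpolyX_mxy.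
rewrite -!mul_mpolyC; ring.
Qed.

Lemma natr_neq0 n : (0 < n)%N -> n%:R != 0 :> k.
Proof. by move=> n_gt0; rewrite natr0_eq0 // -lt0n. Qed.

Lemma cubic_normal_form g :
  [\/ exists2 a, a != 0 & reach (bf 3 g) (cb [:: a; 0; 0; a]),
      reach (bf 3 g) (cb [:: 0; 1; 0; 0]), reach (bf 3 g) (cb [:: 1; 0; 0; 0]) |
      bf 3 g = 0].
Proof.
have two := natr_neq0 (isT : 0 < 2)%N; have three := natr_neq0 (isT : 0 < 3)%N; have four
    := natr_neq0 (isT : 0 < 4)%N.
(* A root of the cubic is moved to x = 0, so that x becomes a factor. *)
have [a [b [c r]]] : exists a b (c : k), reach (bf 3 g) (cb [:: a; b; c; 0]).
  rewrite bf_cb; have [->|g3] := eqVneq (g 3) 0.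
    by exists (g 0), (g 1), (g 2); apply: reach_refl.
  have [u] := poly_root (isT : 0 < 3)%N g3; rewrite !big_ord_recr big_ord0 /= add0r => hu.
  have := reach_trans (cb_shear u (g 0) (g 1) (g 2) (g 3)) (cb_swap _ _ _ _).
  have -> : g 0 + u * g 1 + u ^+ 2 * g 2 + u ^+ 3 * g 3 = 0 by rewrite -[RHS]hu; ring.
  by move=> r; do 3 eexists; exact: r.
have tq q : q != 0 -> reach (cb [:: 0; q; 0; 0]) (cb [:: 0; 1; 0; 0]).
  move=> q0; have := @cb_torus q^-1 0 q 0 0; rewrite invr_eq0 => /(_ q0).
  by rewrite !mulr0 mulVf.
have [c0|c0] := eqVneq c 0.
  subst c; have [b0|b0] := eqVneq b 0.
    subst b; have [a0|a0] := eqVneq a 0.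
      subst a; constructor 4; have [M _ <-] := reach_sym r.
      by rewrite /cb (bf_ext (c' := fun=> 0)) ?bf0 ?/act ?comp_mpoly0 // => -[|[|[|[|]]]].
    have [s hs] := @root_exists k 3 a^-1 isT.
    have s0 : s != 0 by apply: contraNneq a0 => s0; rewrite -invr_eq0 -hs s0 expr0n.
    constructor 3; apply: (reach_trans r).
    by have := @cb_torus s a 0 0 0 s0; rewrite !mulr0 hs mulVf.
  constructor 2; apply: (reach_trans r); apply: reach_trans (tq b b0).
  have := cb_shear (- (a / b)) a b 0 0; rewrite !mulr0 !addr0.
  by rewrite mulNr divfK // subrr.
(* The square is completed in the quadratic factor a x^2 + b x y + c y^2. *)
have r1 : reach (bf 3 g) (cb [:: a - b ^+ 2 / (4%:R * c); 0; c; 0]).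
  apply: (reach_trans r); have := cb_shear (- (b / (2%:R * c))) a b c 0.
  rewrite !mulr0 !addr0.
  have -> : a + - (b / (2%:R * c)) * b + (- (b / (2%:R * c))) ^+ 2 * c = a - b ^+ 2 /
      (4%:R * c).
    by field; rewrite c0 two four.
  by have -> : b + 2%:R * - (b / (2%:R * c)) * c = 0 by field; rewrite c0 two.
move: {r a}(a - _) r1 => a r.
have [a0|a0] := eqVneq a 0.
  subst a; constructor 2; apply: (reach_trans r); apply: reach_trans (cb_swap _ _ _ _) _.
  by rewrite oppr0; apply: tq.
(* In [two_cubes], determinant 1 forces be = - 1 / (2 al); comparing the coefficients of x y^2 and
   x^3 then gives the scalar 2 c al / 3 and al^4 = 3 a / (4 c). *)
have [al hal] := @root_exists k 4 (3%:R * a / (4%:R * c)) isT.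
have al0 : al != 0.
  have h : 3%:R * a / (4%:R * c) != 0 by rewrite !mulf_neq0 ?invr_eq0 ?mulf_neq0.
  by apply: contra_neq h => al0; rewrite -hal al0 expr0n.
constructor 1; exists (2%:R * c * al / 3%:R); first by rewrite !mulf_neq0 ?invr_eq0.
apply: (reach_trans r); apply: reach_sym.
exists (mx2 al (- (2%:R * al)^-1) al (2%:R * al)^-1).
  by rewrite det_mx2E; field; rewrite two al0.
rewrite -{2}[(2%:R * al)^-1]opprK two_cubes; congr (cb [:: _; _; _; _]).
- rewrite (_ : _ * _ = 4%:R * c / 3%:R * al ^+ 4); last by field.
  by rewrite hal; field; rewrite three four c0.
- by field; rewrite three two al0.
Qed.

End CubicNormalForms.

(** * Existence of normal forms *)

Section NormalFormExistence.
Variables (k : closedFieldType) (hk : [pchar k] =i pred0).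
Implicit Types (rho c g : nat -> k) (F G : {mpoly k[2]}) (M : 'M[k]_2).

(* No point is both a multiple root of F and a root of G. *)
Definition nondeg F G := forall M c g, \det M = 1 -> act M F = qf c -> act M G = bf 3 g ->
  c 4 = 0 -> c 5 = 0 -> g 3 = 0 -> False.

Definition has_nf F G := exists t rho, [/\ (t < 8)%N, pden rho (nfnz t) != 0 &
  sl2_equiv F G (sform rho 5 (nfF t)) (sform rho 3 (nfG t))].

Lemma nondeg_equiv F G F' G' : sl2_equiv F G F' G' -> nondeg F G -> nondeg F' G'.
Proof.
move=> [M dM [-> ->]] nd N c g dN; rewrite !act_comp; apply: nd.
by rewrite det_mulmx dM dN mulr1.
Qed.

Lemma has_nf_equiv F G F' G' : sl2_equiv F G F' G' -> has_nf F' G' -> has_nf F G.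
Proof.
move=> e [t [rho [t8 nz e']]]; exists t, rho; split=> //; exact: sl2_equiv_trans e e'.
Qed.

Lemma has_nf_intro t rho F G : (t < 8)%N -> pden rho (nfnz t) != 0 ->
  F = sform rho 5 (nfF t) -> G = sform rho 3 (nfG t) -> has_nf F G.
Proof. by move=> t8 nz -> ->; exists t, rho; split=> //; apply: sl2_equiv_refl. Qed.

Lemma nondegN c g : nondeg (qf c) (bf 3 g) -> g 3 = 0 -> c 5 = 0 -> c 4 != 0.
Proof.
move=> nd g3 c5; apply/eqP => c4.
by apply: (nd 1%:M c g); rewrite ?det1 ?act1.
Qed.

Lemma qf_nf t rho c : (forall j, (j <= 5)%N -> c j = pden rho (nth (PC Z0) (nfc t) j)) ->
  qf c = sform rho 5 (nfF t).
Proof. by move=> e; rewrite nfF_qf; apply: qf_ext. Qed.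

Lemma has_nf_x3y3 c a : a != 0 -> has_nf (qf c) (cb [:: a; 0; 0; a]).
Proof.
move=> a0; apply: (@has_nf_intro 0 (fun j => if (j < 6)%N then c j else a)) => //.
- by apply: qf_nf => -[|[|[|[|[|[|//]]]]]].
- by apply: bf_ext => -[|[|[|[|//]]]].
Qed.

Lemma has_nf_x2y c : nondeg (qf c) (cb [:: 0; 1; 0; 0]) -> has_nf (qf c) (cb [:: 0; 1; 0;
    0]).
Proof.
move=> nd; have [c5|c5] := eqVneq (c 5) 0.
  apply: (@has_nf_intro 2 c) => //; first exact: nondegN nd _ c5.
    by apply: qf_nf => -[|[|[|[|[|[|//]]]]]].
  by apply: bf_ext => -[|[|[|[|//]]]].
apply: (@has_nf_intro 1 c) => //.
  by apply: qf_nf => -[|[|[|[|[|[|//]]]]]].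
by apply: bf_ext => -[|[|[|[|//]]]].
Qed.

Lemma shear_equiv u c a :
  sl2_equiv (qf c) (cb [:: a; 0; 0; 0]) (qf (sheared u c)) (cb [:: a; 0; 0; 0]).
Proof.
exists (mx2 1 0 u 1); first exact: reach_shear_det.
rewrite qf_shear; split=> //; rewrite /cb cubic_shear; apply: bf_ext.
by case=> [|[|[|[|//]]]] _ /=; rewrite ?mulr0 ?addr0.
Qed.

(** The shears y -> u x + y fix x^3, and one of them removes the coefficient just before the last
    nonzero one. Nondegeneracy at the root x = 0 of G makes c_4 or c_5 nonzero. *)
Lemma shear_exists c a : nondeg (qf c) (cb [:: a; 0; 0; 0]) -> exists2 c' : nat -> k,
  sl2_equiv (qf c) (cb [:: a; 0; 0; 0]) (qf c') (cb [:: a; 0; 0; 0]) &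
  (c' 5 != 0 /\ c' 4 = 0) \/ [/\ c' 5 = 0, c' 4 != 0 & c' 3 = 0].
Proof.
move=> nd; have [c5|c5] := eqVneq (c 5) 0.
  have c4 : c 4 != 0 by apply: nondegN nd _ c5.
  exists (sheared (- (c 3 / (2%:R * c 4))) c); first exact: shear_equiv.
  right; split; rewrite /sheared /= ?c5 ?mulr0 ?addr0 //.
  by field; rewrite c4 natr_neq0.
exists (sheared (- (c 4 / c 5)) c); first exact: shear_equiv.
by left; split=> //; rewrite /sheared /= mulNr divfK // subrr.
Qed.

Lemma has_nf_x3 c : nondeg (qf c) (cb [:: 1; 0; 0; 0]) -> has_nf (qf c) (cb [:: 1; 0; 0;
    0]).
Proof.
move=> /shear_exists[c' e h]; apply: (has_nf_equiv e).
have hg t : t \in [:: 3; 4]%N -> cb [:: 1; 0; 0; 0] = sform c' 3 (nfG t).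
  by rewrite !inE => /orP[] /eqP ->; apply: bf_ext => -[|[|[|[|//]]]].
case: h => [[c5 c4]|[c5 c4 c3]].
  apply: (@has_nf_intro 3 c') => //; last exact: hg.
  by apply: qf_nf => -[|[|[|[|[|[|//]]]]]].
apply: (@has_nf_intro 4 c') => //; last exact: hg.
by apply: qf_nf => -[|[|[|[|[|[|//]]]]]].
Qed.

(* The cubic covariant c_{3,3}; by [qj_apolar] it is apolar to the quintic. *)
Definition qj c := csem (qf c) 0 e33.

Lemma sform_nil rho n : sform rho n ([::] : seq (pexp 7)) = 0.
Proof. by apply: big1 => j _; rewrite nth_nil scale0r. Qed.

Lemma qf_generic rho c : (forall j, (j <= 5)%N -> c j = rho j) -> qf c = sform rho 5 (nfF
    0).
Proof. by move=> e; apply: qf_nf => -[|[|[|[|[|[|//]]]]]] /e ->. Qed.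

Lemma qj_cubic c : exists g, qj c = bf 3 g.
Proof.
rewrite /qj (@qf_generic c c) // -(sform_nil c 3) !sform_pform // csem_pform.
rewrite /pform /bf scaler_sumr.
exists (fun j => ccst k e33 * peval c (pcoef (ucomp (map (@pnorm 7) (nfF 0)) [::] e33)
    j)).
by apply: eq_bigr => j _; rewrite scalerA.
Qed.

Lemma qj_act M c c' : \det M = 1 -> act M (qf c) = qf c' -> act M (qj c) = qj c'.
Proof.
move=> dM e; rewrite /qj -csem_act // e; congr csem.
by rewrite /act comp_mpoly0.
Qed.

Lemma sform_eq0 rho n (us : seq (pexp 7)) j : sform rho n us = 0 -> (j <= n)%N -> pden
    rho (nth (PC Z0) us j) = 0.
Proof. by move=> e; apply: (bf_inj (etrans e (esym (bf0 k n)))). Qed.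

(** The identity (F, c_{3,3})_3 = 0 is checked on the generic quintic. Inserting a normal form s of
    c_{3,3} turns it into three linear equations on F, as in Sylvester's use of the canonizant. *)
Lemma qj_apolar rho s us : ccheck (nfF 0) s (CT 3 CF CG) us ->
  qj rho = sform rho 3 s -> forall j, (j <= 2)%N -> pden rho (nth (PC Z0) us j) = 0.
Proof.
move=> h e j j2; have z : ccheck (nfF 0) [::] (CT 3 CF e33) [::] by vm_compute.
have eF : qf rho = sform rho 5 (nfF 0) by apply: qf_generic.
have h0 := @csem_check 7 k rho _ _ _ _ z.
rewrite !sform_nil scaler0 -eF in h0.
have h1 := @csem_check 7 k rho _ _ _ _ h.
rewrite -eF -e in h1.
have {h1}/eqP := etrans (esym h1) h0.
by rewrite scaler_eq0 (negbTE (ccst_neq0 hk _)) /= => /eqP /sform_eq0; apply.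
Qed.

Lemma qj_coef c g t rho us : ccheck (nfF t) [::] e33 us ->
  qf c = sform rho 5 (nfF t) -> qj c = bf 3 g ->
  forall j, (j <= 3)%N -> g j = ccst k e33 * pden rho (nth (PC Z0) us j).
Proof.
move=> h e; rewrite /qj e -(sform_nil rho 3) (@csem_check 7 k rho _ _ _ _ h).
rewrite /sform [bf (cord _) _]/(bf 3 _) {1}/bf scaler_sumr => eg j.
apply: (@bf_inj k 3 g (fun j => ccst k e33 * pden rho (nth (PC Z0) us j))); apply: etrans
    (esym eg) _; apply: eq_bigr => i _; by rewrite scalerA.
Qed.

Lemma qf_root c : exists M c', [/\ \det M = 1, act M (qf c) = qf c' & c' 5 = 0].
Proof.
have [c5|c5] := eqVneq (c 5) 0; first by exists 1%:M, c; rewrite det1 act1.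
have p5 : 'C(5, 5)%:R * c 5 != 0 by rewrite binn mul1r.
have [u] := @poly_root k 5 (fun i => 'C(5, i)%:R * c i) isT p5.
rewrite !big_ord_recr big_ord0 /= add0r !bin5E => hu.
exists (mx2 1 0 u 1 *m mx2 0 1 (-1) 0), (fun j => 1 ^+ j * (-1) ^+ (5 - j) * sheared u c
    (5 - j)).
split; first by rewrite det_mulmx reach_shear_det swap_det mulr1.
  by rewrite -act_comp qf_shear qf_anti.
rewrite subnn expr0 expr1n !mul1r -[RHS]hu /sheared /=; ring.
Qed.

Lemma zk_neq0 z : ~~ Z.eqb z 0 -> zk k z != 0.
Proof. by rewrite zk_eq0. Qed.

Lemma has_nf_G0 c : nondeg (qf c) 0 -> has_nf (qf c) 0.
Proof.
move=> nd0; have [g eg] := qj_cubic c.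
(* SL2 is spent on c_{3,3}, which moves along with F by equivariance. *)
have [M [c1 [dM e1 h]]] : exists M c1, [/\ \det M = 1, act M (qf c) = qf c1 &
   [\/ exists2 a, a != 0 & qj c1 = cb [:: a; 0; 0; a],
      qj c1 = cb [:: 0; 1; 0; 0], qj c1 = cb [:: 1; 0; 0; 0] | qj c1 = 0]].
  have cM M : exists c1, act M (qf c) = qf c1.
    by apply: (homog_qf hk); apply: act_homog; apply: bf_homog.
  have [[a a0 [M dM eM]]|[M dM eM]|[M dM eM]|g0] := cubic_normal_form hk g.
  - have [c1 e1] := cM M; exists M, c1; split=> //.
    by constructor 1; exists a; rewrite // -(qj_act dM e1) eg.
  - by have [c1 e1] := cM M; exists M, c1; split=> //; constructor 2; rewrite -(qj_act dM
      e1) eg.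
  - by have [c1 e1] := cM M; exists M, c1; split=> //; constructor 3; rewrite -(qj_act dM
      e1) eg.
  - by exists 1%:M, c; rewrite det1 act1 eg g0; split=> //; constructor 4.
have e : sl2_equiv (qf c) 0 (qf c1) 0 by exists M; rewrite // e1 /act comp_mpoly0.
apply: (has_nf_equiv e); have nd := nondeg_equiv e nd0.
have nd4 : c1 5 = 0 -> c1 4 != 0.
  by move=> c5; apply: (@nondegN c1 (fun=> 0)) => //; rewrite bf0.
move: {c M nd0 g eg dM e e1} c1 nd nd4 h => c nd nd4.
have g0 t : (4 < t < 8)%N -> 0 = sform c 3 (nfG t) by move=> t8; rewrite nfG0.
case=> [[a a0 ej]|ej|ej|ej].
- pose r j := if (j < 6)%N then c j else a.
  have er : qf r = qf c by apply: qf_ext => -[|[|[|[|[|[|//]]]]]].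
  (* Apolarity to x^3 + y^3 says that c_j = c_(j+3). Slot 6 of r holds the coefficient a of
     c_{3,3}. *)
  have us : ccheck (nfF 0) [:: 'c_6; 0%:z; 0%:z; 'c_6]%pexp (CT 3 CF CG)
    [:: 360%:z * 'c_6 * ('c_0 - 'c_3); 720%:z * 'c_6 * ('c_1 - 'c_4);
        360%:z * 'c_6 * ('c_2 - 'c_5)]%pexp by vm_compute.
  have ejr : qj r = sform r 3 [:: 'c_6; 0%:z; 0%:z; 'c_6]%pexp.
    by rewrite /qj er -/(qj c) ej; apply: bf_ext => -[|[|[|[|//]]]].
  have cancel z x y : ~~ Z.eqb z 0 -> zk k z * a * (x + zk k (Zneg 1) * y) = 0 -> x = y.
    move=> z0 /eqP; rewrite !mulf_eq0 (negbTE (zk_neq0 z0)) (negbTE a0) /=.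
    by rewrite (_ : zk k (Zneg 1) = -1) // mulN1r subr_eq0 => /eqP.
  have h := qj_apolar us ejr.
  have c3 : c 0 = c 3 by apply: (cancel _ _ _ _ (h 0%N isT)).
  have c4 : c 1 = c 4 by apply: (cancel _ _ _ _ (h 1%N isT)).
  have c5 : c 2 = c 5 by apply: (cancel _ _ _ _ (h 2%N isT)).
  have eF : qf c = sform c 5 (nfF 5).
    by apply: qf_nf => -[|[|[|[|[|[|//]]]]]].
  apply: (@has_nf_intro 5 c) => //; last exact: g0.
  have vs : ccheck (nfF 5) [::] e33
    [:: 3456000%:z * nfnz 5; 0%:z; 0%:z; 3456000%:z * nfnz 5]%pexp by vm_compute.
  (* The leading coefficient of c_{3,3} is a multiple of the pivot, so a != 0 makes the pivot
     nonzero. *)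
  have ea : a = ccst k e33 * (zk k 3456000 * pden c (nfnz 5)).
    exact: (qj_coef vs eF ej (isT : (0 <= 3)%N)).
  by apply: contra_neq a0 => m0; rewrite ea m0 !mulr0.
- have us : ccheck (nfF 0) [:: 0%:z; 1%:z]%pexp (CT 3 CF CG)
    [:: 360%:z * 'c_2; 720%:z * 'c_3; 360%:z * 'c_4]%pexp by vm_compute.
  have ejr : qj c = sform c 3 [:: 0%:z; 1%:z]%pexp.
    by rewrite ej; apply: bf_ext => -[|[|[|[|//]]]].
  have cancel z x : ~~ Z.eqb z 0 -> zk k z * x = 0 -> x = 0.
    by move=> z0 /eqP; rewrite mulf_eq0 (negbTE (zk_neq0 z0)) => /eqP.
  have h := qj_apolar us ejr.
  have c2 : c 2 = 0 by apply: (cancel _ _ _ (h 0%N isT)).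
  have c3 : c 3 = 0 by apply: (cancel _ _ _ (h 1%N isT)).
  have c4 : c 4 = 0 by apply: (cancel _ _ _ (h 2%N isT)).
  have eF : qf c = sform c 5 (nfF 6).
    by apply: qf_nf => -[|[|[|[|[|[|//]]]]]].
  apply: (@has_nf_intro 6 c) => //; last exact: g0.
  have vs : ccheck (nfF 6) [::] e33
    [:: 0%:z; 3456000%:z * 'c_1 ^+ 2 * 'c_5; 0%:z; 0%:z]%pexp by vm_compute.
  have := qj_coef vs eF ej (isT : (1 <= 3)%N); rewrite /= => e1.
  have : c 1 != 0 /\ c 5 != 0.
    by split; apply: contra_eq_neq e1 => ->; rewrite ?expr0n /= !(mulr0, mul0r) oner_eq0.
  by move=> [c1 c5]; rewrite mulf_neq0 ?expf_neq0.
(* Apolarity to x^3 forces c_4 = c_5 = 0, a double root of F, against nondegeneracy. *)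
- have us : ccheck (nfF 0) [:: 1%:z]%pexp (CT 3 CF CG)
    [:: (-360)%:z * 'c_3; (-720)%:z * 'c_4; (-360)%:z * 'c_5]%pexp by vm_compute.
  have ejr : qj c = sform c 3 [:: 1%:z]%pexp.
    by rewrite ej; apply: bf_ext => -[|[|[|[|//]]]].
  have cancel z x : ~~ Z.eqb z 0 -> zk k z * x = 0 -> x = 0.
    by move=> z0 /eqP; rewrite mulf_eq0 (negbTE (zk_neq0 z0)) => /eqP.
  have h := qj_apolar us ejr.
  have c4 : c 4 = 0 by apply: (cancel _ _ _ (h 1%N isT)).
  have c5 : c 5 = 0 by apply: (cancel _ _ _ (h 2%N isT)).
  by move: (nd4 c5); rewrite c4 eqxx.
(* With c_{3,3} = 0 there is no covariant cubic to normalize. A root of F, simple by nondegeneracy,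
   is moved to x = 0 instead, and a shear then removes c_3. *)
have [M [c1 [dM e1 c15]]] := qf_root c.
have ej1 : qj c1 = 0 by rewrite -(qj_act dM e1) ej /act comp_mpoly0.
have eq1 : sl2_equiv (qf c) 0 (qf c1) 0 by exists M; rewrite // e1 /act comp_mpoly0.
apply: (has_nf_equiv eq1); have nd1 := nondeg_equiv eq1 nd.
have c14 : c1 4 != 0 by apply: (@nondegN c1 (fun=> 0)) => //; rewrite bf0.
pose u := - (c1 3 / (2%:R * c1 4)); pose d := sheared u c1.
have eq2 : sl2_equiv (qf c1) 0 (qf d) 0.
  exists (mx2 1 0 u 1); first exact: reach_shear_det.
  by rewrite qf_shear /act comp_mpoly0.
apply: (has_nf_equiv eq2); have nd2 := nondeg_equiv eq2 nd1.
have d5 : d 5 = 0 by [].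
have d4 : d 4 != 0 by rewrite /d /sheared /= c15 mulr0 addr0.
have d3 : d 3 = 0.
  by rewrite /d /sheared /= c15 mulr0 addr0 /u; field; rewrite c14 natr_neq0.
have ejd : qj d = bf 3 (fun=> 0).
  rewrite bf0 -(qj_act (reach_shear_det u) (qf_shear u c1)) ej1.
  by rewrite /act comp_mpoly0.
have eF : qf d = sform d 5 (nfF 4) by apply: qf_nf => -[|[|[|[|[|[|//]]]]]].
have vs : ccheck (nfF 4) [::] e33
  [:: 3456000%:z * ('c_2 ^+ 3 + 'c_1 ^+ 2 * 'c_4 - 'c_0 * 'c_2 * 'c_4);
      (-3456000)%:z * ('c_1 * 'c_2 * 'c_4);
      3456000%:z * ('c_4 * ('c_0 * 'c_4 - 'c_2 ^+ 2));
      3456000%:z * ('c_1 * 'c_4 ^+ 2)]%pexp by vm_compute.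
have cancel z x : ~~ Z.eqb z 0 -> 0 = ccst k e33 * (zk k z * x) -> x = 0.
  move=> z0 e; apply: (mulfI (zk_neq0 z0)); apply: (mulfI (ccst_neq0 hk e33)).
  by rewrite -e !mulr0.
have d1 : d 1 = 0.
  have e : d 1 * d 4 ^+ 2 = 0.
    by apply: (cancel _ _ _ (qj_coef vs eF ejd (isT : (3 <= 3)%N))).
  by move/eqP: e; rewrite mulf_eq0 expf_eq0 (negbTE d4) orbF => /eqP.
have d0 : d 0 * d 4 = d 2 ^+ 2.
  have e : d 4 * (d 0 * d 4 + zk k (Zneg 1) * d 2 ^+ 2) = 0.
    by apply: (cancel _ _ _ (qj_coef vs eF ejd (isT : (2 <= 3)%N))).
  move/eqP: e; rewrite mulf_eq0 (negbTE d4) (_ : zk k (Zneg 1) = -1) // mulN1r subr_eq0.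
  by move=> /eqP.
(* Otherwise F would be 5 d_4 x y^4; the swap brings its multiple root y = 0 to the place tested by
   [nondeg]. *)
have d2 : d 2 != 0.
  apply/eqP => d2.
  have d00 : d 0 = 0 by apply/eqP; have /eqP := d0; rewrite d2 expr0n mulf_eq0 (negbTE
      d4) orbF.
  have a0 : act (mx2 0 1 (-1) 0) 0 = bf 3 (fun=> 0 : k) by rewrite bf0 /act comp_mpoly0.
  have := nd2 _ _ _ (swap_det k) (qf_anti 1 (-1) d) a0.
  by rewrite /= d1 d00 !mulr0; apply.
(* This parametrizes d_0 d_4 = d_2^2. The resulting quintic is a sum of two fifth powers,
   proportional to (u x + y)^5 + (u x - y)^5 with u^2 = d_2 / d_4. *)
pose r j := nth 0 [:: d 4; d 2 / d 4] j.
apply: (@has_nf_intro 7 r) => //; last by rewrite nfG0.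
  by rewrite /= mulf_neq0 ?expf_neq0 ?mulf_neq0 ?invr_eq0.
apply: qf_nf => -[|[|[|[|[|[|//]]]]]] _ /=; rewrite ?d1 ?d3 ?d5 //.
- by apply: (mulIf d4); rewrite d0 /r /=; field.
- by rewrite /r /= mulrC divfK.
Qed.

End NormalFormExistence.

(** * Separation by the invariants *)

Section InvariantsSeparate.
Variables (k : closedFieldType) (hk : [pchar k] =i pred0).
Implicit Types (rho c g : nat -> k) (F G A B : {mpoly k[2]}) (M : 'M[k]_2).

Theorem nf_exists F G : F \is 5.-homog -> G \is 3.-homog -> nondeg F G -> has_nf F G.
Proof.
move=> hF /homog_bf; set g := (fun j => _) => eG nd.
have aF M : exists c, act M F = qf c by apply: (homog_qf hk); apply: act_homog.
have [[a a0 [M dM eM]]|[M dM eM]|[M dM eM]|g0] := cubic_normal_form hk g.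
- have [c ec] := aF M; have e : sl2_equiv F G (qf c) (cb [:: a; 0; 0; a]).
    by exists M; rewrite // eG ec eM.
  exact: has_nf_equiv e (has_nf_x3y3 _ a0).
- have [c ec] := aF M; have e : sl2_equiv F G (qf c) (cb [:: 0; 1; 0; 0]).
    by exists M; rewrite // eG ec eM.
  exact: has_nf_equiv e (has_nf_x2y (nondeg_equiv e nd)).
- have [c ec] := aF M; have e : sl2_equiv F G (qf c) (cb [:: 1; 0; 0; 0]).
    by exists M; rewrite // eG ec eM.
  exact: has_nf_equiv e (has_nf_x3 hk (nondeg_equiv e nd)).
- have [c ec] := aF 1%:M; rewrite eG g0 in nd *; rewrite act1 in ec.
  by rewrite ec in nd *; apply: has_nf_G0.
Qed.

Lemma nf_nonzero F G t rho : (t < 8)%N -> pden rho (nfnz t) != 0 ->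
  sl2_equiv F G (sform rho 5 (nfF t)) (sform rho 3 (nfG t)) -> Jinv F G (nfJ t) != 0.
Proof.
move=> t8 nz e; rewrite -(sl2_equiv_J _ e).
have [c c0 ->] := Jinv_check hk (nf_detect t8).
by rewrite mulf_neq0 // expf_neq0.
Qed.

Lemma nfJ_lt t : (nfJ t < 50)%N.
Proof. by do 8! [case: t => [|t] //]; rewrite /nfJ /= nth_nil. Qed.

(** If t were smaller than t', [nfJ t] would be nonzero on the first pair and zero on the second.
    The lemma is applied in both directions. *)
Lemma nf_tag F G F' G' t rho t' rho' :
  (forall i, (i < 50)%N -> Jinv F G i = Jinv F' G' i) ->
  (t < 8)%N -> pden rho (nfnz t) != 0 ->
  sl2_equiv F G (sform rho 5 (nfF t)) (sform rho 3 (nfG t)) ->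
  (t' < 8)%N -> sl2_equiv F' G' (sform rho' 5 (nfF t')) (sform rho' 3 (nfG t')) ->
  (t' <= t)%N.
Proof.
move=> h t8 nz e t8' e'; rewrite leqNgt; apply/negP => tt'.
have := nf_nonzero t8 nz e; rewrite h ?nfJ_lt // -(sl2_equiv_J _ e').
by rewrite Jinv_check0 ?eqxx //; apply: nf_vanish; rewrite tt'.
Qed.

Theorem Jinv_separates F G F' G' :
  F \is 5.-homog -> G \is 3.-homog -> nondeg F G ->
  F' \is 5.-homog -> G' \is 3.-homog -> nondeg F' G' ->
  (forall i, (i < 50)%N -> Jinv F G i = Jinv F' G' i) -> sl2_equiv F G F' G'.
Proof.
move=> hF hG nd hF' hG' nd' h.
have [t [rho [t8 nz e]]] := nf_exists hF hG nd.
have [t' [rho' [t8' nz' e']]] := nf_exists hF' hG' nd'.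
have h' i : (i < 50)%N -> Jinv F' G' i = Jinv F G i by move=> /h ->.
have tt : t = t'.
  by apply/eqP; rewrite eqn_leq (nf_tag h' t8' nz' e' t8 e) (nf_tag h t8 nz e t8' e').
subst t'; apply: (sl2_equiv_trans e); apply: (fun x => sl2_equiv_trans x (sl2_equiv_sym
    e')).
apply: (nf_unique hk t8 nz nz') => i i50.
by rewrite (sl2_equiv_J i e) (sl2_equiv_J i e') h.
Qed.

Theorem Jinv_nonzero F G : F \is 5.-homog -> G \is 3.-homog -> nondeg F G ->
  exists2 i, (i < 50)%N & Jinv F G i != 0.
Proof.
move=> hF hG nd; have [t [rho [t8 nz e]]] := nf_exists hF hG nd.
by exists (nfJ t); [apply: nfJ_lt | apply: nf_nonzero nz e].
Qed.

(** * Evaluation at a point and common roots *)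

Definition pt (p q : k) (i : 'I_2) : k := if i == 0 then p else q.

Lemma meval_mxy p q a b : ('X_[mxy a b] : {mpoly k[2]}).@[pt p q] = p ^+ a * q ^+ b.
Proof. by rewrite mevalX !big_ord_recl big_ord0 mulr1 mxy0 mxy1. Qed.

Lemma meval_bf n c p q : (bf n c).@[pt p q] = \sum_(j < n.+1) c j * (p ^+ (n - j) * q ^+
    j).
Proof. by rewrite /bf raddf_sum; apply: eq_bigr => j _ /=; rewrite mevalZ meval_mxy. Qed.

Lemma bcoef_bf n (A : bform k n) : (A : {mpoly k[2]}) = bf n (bcoef A).
Proof. by apply: homog_bf; case: A. Qed.

(** At a common root the Sylvester matrix annihilates the column of monomials of degree n + m - 1.
    Being invertible, it forces this column to vanish, in particular its end entries, which are
    powers of p and q. *)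
Lemma bresultant_root m n (A : bform k m) (B : bform k n) p q : (0 < n + m)%N ->
  bresultant A B != 0 -> (A : {mpoly k[2]}).@[pt p q] = 0 ->
  (B : {mpoly k[2]}).@[pt p q] = 0 -> p = 0 /\ q = 0.
Proof.
move=> nm0; rewrite /bresultant; set S := \matrix_(i, j) _ => S0 rA rB.
rewrite (bcoef_bf A) meval_bf in rA; rewrite (bcoef_bf B) meval_bf in rB.
pose w : 'cV[k]_(n + m) := \col_j (p ^+ ((n + m).-1 - j) * q ^+ j).
have Sw : S *m w = 0.
  apply/colP => i; rewrite !mxE.
  have ltim := ltn_ord i.
  (* A row of the matrix, paired with that column, is the value of the form times a monomial. *)
  have shift d r (a : nat -> k) : (r + d < n + m)%N ->
      \sum_(j < d.+1) a j * (p ^+ (d - j) * q ^+ j) = 0 ->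
      \sum_(j < n + m) (if (r <= j <= r + d)%N then a (j - r)%N else 0) *
        (p ^+ ((n + m).-1 - j) * q ^+ j) = 0.
    move=> rd a0; pose f j := (if (r <= j <= r + d)%N then a (j - r)%N else 0) *
      (p ^+ ((n + m).-1 - j) * q ^+ j).
    rewrite -(big_mkord xpredT f) (big_cat_nat (n := (r + d.+1)%N)) //; last by lia.
    rewrite (big_cat_nat (n := r)) //=; last by lia.
    have out l u : (forall j, (l <= j < u)%N -> ~~ (r <= j <= r + d)%N) ->
        \sum_(l <= j < u) f j = 0.
      move=> h; rewrite big_nat_cond big1 // => j; rewrite andbT => /h /negbTE h'.
      by rewrite /f h' mul0r.
    rewrite (out 0%N r) ?add0r; last by move=> j; lia.
    rewrite (out (r + d.+1)%N (n + m)%N) ?addr0; last by move=> j; lia.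
    rewrite -{1}[r]add0n big_addn addKn big_mkord.
    transitivity (p ^+ ((n + m).-1 - d - r) * q ^+ r *
      \sum_(j < d.+1) a j * (p ^+ (d - j) * q ^+ j)); last by rewrite a0 mulr0.
    rewrite mulr_sumr.
    apply: eq_bigr => j _; have jd : (j <= d)%N by rewrite -ltnS.
    rewrite /f addnK (_ : (r <= j + r <= r + d)%N = true); last by lia.
    have -> : ((n + m).-1 - (j + r) = ((n + m).-1 - d - r) + (d - j))%N.
      lia.
    by rewrite !exprD; ring.
  have [lt_in|le_ni] := ltnP i n.
    apply: etrans (shift m i (bcoef A) _ rA); last by lia.
    by apply: eq_bigr => j _; rewrite !mxE lt_in.
  apply: etrans (shift n (i - n)%N (bcoef B) _ rB); last by lia.
  by apply: eq_bigr => j _; rewrite !mxE ltnNge le_ni.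
have w0 : w = 0.
  have uS : S \in unitmx by rewrite unitmxE unitfE.
  by rewrite -[w](mulKmx uS) Sw mulmx0.
split; apply/eqP.
  have /eqP := congr1 (fun u : 'cV[k]_(n + m) => u (Ordinal nm0) 0) w0.
  by rewrite !mxE /= subn0 expr0 mulr1 expf_eq0 => /andP[].
have lt_nm : ((n + m).-1 < n + m)%N by lia.
have /eqP := congr1 (fun u : 'cV[k]_(n + m) => u (Ordinal lt_nm) 0) w0.
by rewrite !mxE /= subnn expr0 mul1r expf_eq0 => /andP[].
Qed.

End InvariantsSeparate.

(** * Clebsch-Gordan pairs and conjugacy *)

Section Conjugacy.
Variables (k : closedFieldType) (hk : [pchar k] =i pred0).
Implicit Types (c g : nat -> k) (F G A B : {mpoly k[2]}) (M : 'M[k]_2).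

Definition cgF A B := 'X_1 * A - 'X_0 * B.
Definition cgG A B := A^`M(0) + B^`M(1).

Lemma mderiv0_mxy a b :
  ('X_[mxy a b] : {mpoly k[2]})^`M(0) = a%:R *: 'X_[mxy a.-1 b].
Proof.
rewrite mderivX -[0]/ord0 mxy0; congr (_ *: 'X_[_]).
by rewrite [LHS]mxy_eq !mnmBE !mnm1E mxy0 mxy1 subn1 subn0.
Qed.

Lemma mderiv1_mxy a b :
  ('X_[mxy a b] : {mpoly k[2]})^`M(1) = b%:R *: 'X_[mxy a b.-1].
Proof.
have -> : 1 = lift ord0 ord0 :> 'I_2 by apply: val_inj.
rewrite mderivX mxy1; congr (_ *: 'X_[_]).
by rewrite [LHS]mxy_eq !mnmBE !mnm1E mxy0 mxy1 subn1 subn0.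
Qed.

Lemma euler n A : A \is n.-homog -> 'X_0 * A^`M(0) + 'X_1 * A^`M(1) = n%:R *: A.
Proof.
move=> /homog_bf ->; rewrite /bf !linear_sum !mulr_sumr -big_split /=.
apply: eq_bigr => j _; have jn : (j <= n)%N by rewrite -ltnS.
rewrite !mderivZ mderiv0_mxy mderiv1_mxy !mpolyX_mxy -!mul_mpolyC.
have -> : n%:R%:MP_[2] = (n - j)%:R%:MP + j%:R%:MP :> {mpoly k[2]}.
  by rewrite -mpolyCD -natrD subnK.
move: A@_(mxy (n - j) j) => x; move: (n - j)%N => a; move: (nat_of_ord j) => b.
by case: a b => [|a] [|b] /=; do ?rewrite exprS; ring.
Qed.

(** In the first identity the derivatives of B cancel, and Euler's identity turns the rest into A +
    4 A; the second is symmetric. *)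
Lemma cg_recover A B : A \is 4.-homog -> B \is 4.-homog ->
  5%:R *: A = (cgF A B)^`M(1) + 'X_0 * cgG A B /\
  5%:R *: B = - (cgF A B)^`M(0) + 'X_1 * cgG A B.
Proof.
move=> hA hB; rewrite /cgF /cgG !mderivB !mderivM.
have X i j : ('X_i : {mpoly k[2]})^`M(j) = (i == j)%:R.
  rewrite mderivX mnm1E; case: eqP => [->|_]; last by rewrite scale0r.
  by rewrite -{1}[U_(j)%MM]add0m addmK mpolyX0 scale1r.
rewrite !X /=.
have eA := euler hA; have eB := euler hB.
have -> : 5%:R *: A = A + 4%:R *: A by rewrite -{2}[A]scale1r -scalerDl; congr (_ *: _);
    ring.
have -> : 5%:R *: B = B + 4%:R *: B by rewrite -{2}[B]scale1r -scalerDl; congr (_ *: _);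
    ring.
by rewrite -eA -eB; split; ring.
Qed.

Lemma cg_inj A B A' B' : A \is 4.-homog -> B \is 4.-homog -> A' \is 4.-homog ->
  B' \is 4.-homog -> cgF A B = cgF A' B' -> cgG A B = cgG A' B' -> A = A' /\ B = B'.
Proof.
move=> hA hB hA' hB' eF eG.
have [rA rB] := cg_recover hA hB; have [rA' rB'] := cg_recover hA' hB'.
have five : 5%:R != 0 :> k by apply: natr_neq0.
by split; apply: (scalerI five); rewrite ?rA ?rB ?rA' ?rB' eF eG.
Qed.

(* The coordinates of M^-1 \o (A, B) \o M, for det M = 1. *)
Definition conjA M A B := M 1 1 *: act M A - M 0 1 *: act M B.
Definition conjB M A B := - M 1 0 *: act M A + M 0 0 *: act M B.

(** F is the determinant of the vectors (A, B) and (x, y), and G is the divergence of (A, B); both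
    constructions commute with SL2. *)
Lemma cg_conj M A B : \det M = 1 ->
  cgF (conjA M A B) (conjB M A B) = act M (cgF A B) /\
  cgG (conjA M A B) (conjB M A B) = act M (cgG A B).
Proof.
rewrite det2 => dM; rewrite /cgF /cgG /conjA /conjB; split.
  rewrite actB !actM !act_var -!mul_mpolyC mpolyCN; ring.
rewrite mderivB mderivD !mderivZ !mderiv_act actD.
move: (act M A^`M(0)) (act M A^`M(1)) (act M B^`M(0)) (act M B^`M(1)) => a0 a1 b0 b1.
rewrite -[RHS]scale1r -dM -!mul_mpolyC; ring.
Qed.

Lemma cg_scale s A B : cgF (s *: A) (s *: B) = s *: cgF A B /\ cgG (s *: A) (s *: B) = s
    *: cgG A B.
Proof.
by rewrite /cgF /cgG; split; [rewrite scalerBr !scalerAr | rewrite !mderivZ scalerDr].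
Qed.

Lemma act_bf M n c : act M (bf n c) = \sum_(j < n.+1) c j *: act M 'X_[mxy (n - j) j].
Proof. by rewrite /act /bf linear_sum; apply: eq_bigr => j _ /=; rewrite comp_mpolyZ. Qed.

Lemma act_scale s M n A : A \is n.-homog -> act (s *: M) A = s ^+ n *: act M A.
Proof.
move=> /homog_bf ->; rewrite !act_bf scaler_sumr; apply: eq_bigr => j _ /=.
have jn : (j <= n)%N by rewrite -ltnS.
rewrite !act_mxy !mxE -!scalerA -!scalerDr !exprZn.
have -> : s ^+ n = s ^+ (n - j) * s ^+ j by rewrite -exprD subnK.
by rewrite -scalerAl -scalerAr !scalerA; congr (_ *: _); ring.
Qed.

Lemma inv_entries M N : \det M = 1 -> N *m M = 1%:M ->
  [/\ N 0 0 = M 1 1, N 0 1 = - M 0 1, N 1 0 = - M 1 0 & N 1 1 = M 0 0].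
Proof.
rewrite det2 => dM NM.
have h i j : N i 0 * M 0 j + N i 1 * M 1 j = (i == j)%:R.
  by have := congr1 (fun P : 'M[k]_2 => P i j) NM; rewrite !mxE sum2.
have [h00 h01 h10 h11] := And4 (h 0 0) (h 0 1) (h 1 0) (h 1 1).
rewrite /= in h00 h01 h10 h11.
have row a b : a = M 1 1 * (a * M 0 0 + b * M 1 0) - M 1 0 * (a * M 0 1 + b * M 1 1) /\
    b = M 0 0 * (a * M 0 1 + b * M 1 1) - M 0 1 * (a * M 0 0 + b * M 1 0).
  by split; rewrite -[LHS]mul1r -dM; ring.
have [e00 e01] := row (N 0 0) (N 0 1); have [e10 e11] := row (N 1 0) (N 1 1).
rewrite h00 h01 in e00 e01; rewrite h10 h11 in e10 e11.
by rewrite e00 e01 e10 e11; split; ring.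
Qed.

Lemma act_meval M A (v : 'I_2 -> k) :
  (act M A).@[v] = A.@[pt (M 0 0 * v 0 + M 0 1 * v 1) (M 1 0 * v 0 + M 1 1 * v 1)].
Proof.
rewrite /act comp_mpoly_meval; apply: meval_eq => i; rewrite tnth_mktuple sum2.
by rewrite mevalD !mevalZ !mevalXU; have [->|->] := I2P i.
Qed.

Lemma conj_homog n M A B : A \is n.-homog -> B \is n.-homog ->
  conjA M A B \is n.-homog /\ conjB M A B \is n.-homog.
Proof.
move=> hA hB; have hA' := act_homog M hA; have hB' := act_homog M hB.
by split; [apply: rpredB | apply: rpredD]; apply: dhomogZ.
Qed.

(** A multiple root of F that is also a root of G is a common root of the components, by
    [cg_recover]; the resultant excludes this. *)
Lemma cg_nondeg (A B : bform k 4) : bresultant A B != 0 -> nondeg (cgF A B) (cgG A B).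
Proof.
move=> res M c g dM eF eG c4 c5 g3.
have hA : (A : {mpoly k[2]}) \is 4.-homog by case: A {res eF eG}.
have hB : (B : {mpoly k[2]}) \is 4.-homog by case: B {res eF eG}.
have [hA' hB'] := conj_homog M hA hB; have [rA rB] := cg_recover hA' hB'.
have [eF' eG'] := cg_conj A B dM; rewrite eF' eG' eF eG in rA rB.
have five : 5%:R != 0 :> k by apply: natr_neq0.
have ev : pt (0 : k) 1 0 = 0 /\ pt (0 : k) 1 1 = 1 by [].
(* The point (0, 1) corresponds to the second column of M for the original pair, a nonzero vector
   since M has determinant 1. *)
have A0 : (conjA M A B).@[pt 0 1] = 0.
  apply: (mulfI five); rewrite mulr0 -mevalZ rA mevalD mevalM mevalXU ev.1 mul0r addr0.
  rewrite /qf /bf !big_ord_recr big_ord0 /= add0r !mderivD !mderivZ !mderiv1_mxy.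
  by rewrite !mevalD !mevalZ !meval_mxy /= c4 c5 !expr0n /= !(mul0r, mulr0, addr0).
have B0 : (conjB M A B).@[pt 0 1] = 0.
  apply: (mulfI five); rewrite mulr0 -mevalZ rB mevalD mevalN mevalM mevalXU ev.2 mul1r.
  rewrite /qf /bf !big_ord_recr !big_ord0 /= !add0r !mderivD !mderivZ !mderiv0_mxy.
  by rewrite !mevalD !mevalZ !meval_mxy /= c4 c5 g3 !expr0n /= !(mul0r, mulr0, addr0)
      oppr0.
rewrite /conjA mevalB !mevalZ !act_meval ev.1 ev.2 !mulr0 !add0r !mulr1 in A0.
rewrite /conjB mevalD !mevalZ !act_meval ev.1 ev.2 !mulr0 !add0r !mulr1 mulNr in B0.
move: A0 B0; set a := meval _ (mpoly_of_dhomog A); set b := meval _ (mpoly_of_dhomog B)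
    => A0 B0.
have dM' := dM; rewrite det2 in dM'.
have a0 : a = 0.
  rewrite -[a]mul1r -dM'.
  have -> : (M 0 0 * M 1 1 - M 0 1 * M 1 0) * a =
    M 0 0 * (M 1 1 * a - M 0 1 * b) + M 0 1 * (- (M 1 0 * a) + M 0 0 * b) by ring.
  by rewrite A0 B0 !mulr0 addr0.
have b0 : b = 0.
  rewrite -[b]mul1r -dM'.
  have -> : (M 0 0 * M 1 1 - M 0 1 * M 1 0) * b =
    M 1 0 * (M 1 1 * a - M 0 1 * b) + M 1 1 * (- (M 1 0 * a) + M 0 0 * b) by ring.
  by rewrite A0 B0 !mulr0 addr0.
have [p0 q0] := bresultant_root (isT : (0 < 4 + 4)%N) res a0 b0.
by move: dM'; rewrite p0 q0 mulr0 mul0r subr0 => /esym/eqP; rewrite oner_eq0.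
Qed.

Lemma nondeg_scale s F G : s != 0 -> nondeg F G -> nondeg (s *: F) (s *: G).
Proof.
move=> s0 nd M c g dM; rewrite !actZ => eF eG c4 c5 g3.
have sK A B : s *: A = B -> A = s^-1 *: B by move=> <-; rewrite scalerA mulVf // scale1r.
have bfZ n (d : nat -> k) : s^-1 *: bf n d = bf n (fun j => s^-1 * d j).
  by rewrite /bf scaler_sumr; apply: eq_bigr => j _; rewrite scalerA.
apply: (nd M (fun j => s^-1 * c j) (fun j => s^-1 * g j)) => //.
- by rewrite (sK _ _ eF) /qf bfZ; apply: bf_ext => j _; rewrite mulrCA.
- by rewrite (sK _ _ eG) bfZ.
- by rewrite c4 mulr0.
- by rewrite c5 mulr0.
- by rewrite g3 mulr0.
Qed.

Lemma conjugate_cg (phi psi : ratmap k 4) : conjugate phi psi <->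
  exists s M, [/\ s != 0, \det M = 1,
    (CG_F psi : {mpoly k[2]}) = s *: act M (CG_F phi) &
    (CG_G psi : {mpoly k[2]}) = s *: act M (CG_G phi)].
Proof.
have h (f : ratmap k 4) i : (f i : {mpoly k[2]}) \is 4.-homog by case: (f i).
rewrite /= -!/(cgF _ _) -!/(cgG _ _).
split=> [[gam ugam [s s0 e]]|[s [M [s0 dM eF eG]]]].
  have dg0 : \det gam != 0 by rewrite -unitfE -unitmxE.
  (* A square root of the determinant normalizes gam to SL2; M is the inverse of the normalized
     matrix. *)
  have [de de2] := @root_exists k 2 (\det gam) isT.
  have de0 : de != 0 by apply: contra_neq dg0 => d0; rewrite -de2 d0 expr0n.
  have [M [dM gM eM]] : exists M, [/\ \det M = 1, (de^-1 *: gam) *m M = 1%:M &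
      invmx gam = de^-1 *: M].
    exists (de *: invmx gam); split; last by rewrite scalerA mulVf // scale1r.
      by rewrite detZ det_inv de2 divff.
    by rewrite -scalemxAl -scalemxAr scalerA mulVf // scale1r mulmxV.
  have [g00 g01 g10 g11] := inv_entries dM gM; rewrite !mxE in g00 g01 g10 g11.
  have gi i j x : de^-1 * gam i j = x -> gam i j = de * x by move=> <-; rewrite mulVKf.
  have ai i : phi i \mPo linear_change (invmx gam) = de^-1 ^+ 4 *: act M (phi i).
    by rewrite eM; apply: act_scale.
  have eA : (psi 0 : {mpoly k[2]}) = (s * (de * de^-1 ^+ 4)) *: conjA M (phi 0) (phi 1).
    rewrite e /conj_lift sum2 !ai (gi _ _ _ g00) (gi _ _ _ g01) /conjA.
    rewrite -!mul_mpolyC !mpolyCM !mpolyCN; ring.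
  have eB : (psi 1 : {mpoly k[2]}) = (s * (de * de^-1 ^+ 4)) *: conjB M (phi 0) (phi 1).
    rewrite e /conj_lift sum2 !ai (gi _ _ _ g10) (gi _ _ _ g11) /conjB.
    rewrite -!mul_mpolyC !mpolyCM !mpolyCN; ring.
  (* The factor de comes from gam on the left, and de^-4 from its inverse substituted into
     quartics. *)
  exists (s * (de * de^-1 ^+ 4)), M; split=> //.
  - by rewrite !mulf_neq0 ?expf_neq0 ?invr_eq0.
  - by rewrite eA eB (cg_scale _ _ _).1 (cg_conj _ _ dM).1.
  - by rewrite eA eB (cg_scale _ _ _).2 (cg_conj _ _ dM).2.
have [hA hB] := conj_homog M (h phi 0) (h phi 1).
have [eA eB] : (psi 0 : {mpoly k[2]}) = s *: conjA M (phi 0) (phi 1) /\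
               (psi 1 : {mpoly k[2]}) = s *: conjB M (phi 0) (phi 1).
  apply: cg_inj; rewrite ?dhomogZ //.
  - by rewrite (cg_scale _ _ _).1 (cg_conj _ _ dM).1.
  - by rewrite (cg_scale _ _ _).2 (cg_conj _ _ dM).2.
have uM : M \in unitmx by rewrite unitmxE dM unitr1.
have [g00 g01 g10 g11] := inv_entries dM (mulVmx uM).
exists (invmx M); first by rewrite unitmx_inv.
exists s => // i; rewrite /conj_lift sum2 invmxK -!/(act M _).
have [->|->] := I2P i.
- by rewrite eA g00 g01 /conjA scaleNr.
- by rewrite eB g10 g11 /conjB.
Qed.

End Conjugacy.

Theorem corollary4p9 (k : closedFieldType) (hk : [pchar k] =i pred0)
    (phi psi : ratmap k 4) :
  let J (f : ratmap k 4) (i : 'I_50) : k :=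
    joint_invariant (CG_F f) (CG_G f) i in
  (conjugate phi psi <->
     exists2 lambda : k, lambda != 0 &
       forall i : 'I_50, J psi i = lambda ^+ joint_degree i * J phi i) /\
  (conjugate phi psi <-> wproj_eq joint_degree (J phi) (J psi)).
Proof.
move=> J.
have hF (f : ratmap k 4) : (CG_F f : {mpoly k[2]}) \is 5.-homog by case: (CG_F f).
have hG (f : ratmap k 4) : (CG_G f : {mpoly k[2]}) \is 3.-homog by case: (CG_G f).
have nd (f : ratmap k 4) : nondeg (CG_F f : {mpoly k[2]}) (CG_G f).
  exact: (cg_nondeg hk (ratmap_res f)).
have JE f i : J f i = Jinv (CG_F f) (CG_G f) i by apply: joint_invariantE.
have main : conjugate phi psi <-> exists2 lambda : k, lambda != 0 &
    forall i : 'I_50, J psi i = lambda ^+ joint_degree i * J phi i.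
  rewrite conjugate_cg //; split=> [[s [M [s0 dM eF eG]]]|[s s0 e]].
    (* The common scalar of the two pairs is itself lambda. *)
    exists s => // i; rewrite !JE eF eG /Jinv csem_scale mcoeffZ -joint_degreeE.
    by rewrite -/(Jinv _ _ _) Jinv_act.
  (* After the pair of phi is rescaled by lambda, all fifty invariants agree on the nose. *)
  have [|||||||M dM [eF eG]] := @Jinv_separates k hk (s *: (CG_F phi : {mpoly k[2]}))
     (s *: (CG_G phi : {mpoly k[2]})) (CG_F psi) (CG_G psi); rewrite ?dhomogZ //.
  - exact: nondeg_scale.
  - move=> i i50; have := e (Ordinal i50); rewrite !JE joint_degreeE => ->.
    by rewrite /Jinv csem_scale mcoeffZ.
  by exists s, M; rewrite -!actZ.
split=> //; rewrite main; split=> [h|[_ _ h] //].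
(* Both vectors of invariants are points of the weighted projective space, because the detecting
   invariant of the normal form is nonzero. *)
have nz f : exists j, J f j != 0.
  have [i i50 Ji] := Jinv_nonzero hk (hF f) (hG f) (nd f).
  by exists (Ordinal i50); rewrite JE.
by split.
Qed.
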